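(* Let $\mathcal H,\mathcal U,\mathcal Y$ be complex Hilbert spaces, let $A:D(A)\subset\mathcal H\to\mathcal H$ generate a strongly continuous semigroup on $\mathcal H$, let $B\in L(\mathcal U,\mathcal H)$, $C\in L(\mathcal H,\mathcal Y)$, $K\in L(\mathcal U,\mathcal H)$ with $K$ coercive, and let $z\in\mathcal H$, $v\in\mathcal U$. Assume that $(A,B)$ is exponentially stabilizable and $(A,C)$ is exponentially detectable. Let $P$ be the non-negative solution of the differential Riccati equation $$\frac{dP}{dt}-A^*P-PA+PB(K^*K)^{-1}B^*P-C^*C=0,\qquad P(0)=0.$$ Let $(x_e,u_e)$ be the unique minimizer of $\ell(x,u)=\|Cx\|^2+\|Ku\|^2+2\operatorname{Re}\langle z,x\rangle+2\operatorname{Re}\langle v,u\rangle$ over $\{(x,u)\in D(A)\times\mathcal U:Ax+Bu=0\}$, and let $w\in D(A^* )$ satisfy $$A^*w=z+C^*Cx_e,\qquad B^*w=v+K^*Ku_e .$$ Let $T>0$ and, for $0\le\tau\le t\le T$, let $\hat U_T(t,\tau)$ be the evolution operator of the problem $$\dot\zeta(t)=\left(A^*-P(t)B(K^*K)^{-1}B^*\right)\zeta(t),\qquad \zeta(\tau)=\zeta_0\in\mathcal H,\qquad t\in[\tau,T],$$ i.e. $\hat U_T(t,\tau)\zeta_0:=\zeta(t)$. Then for every $x_0\in\mathcal H$ the optimal control $u^*$ of $$\min_{u\in L^2([0,T],\mathcal U)}\int_0^T\ell(x(t),u(t))\,dt\quad\text{s.t.}\quad\dot x=Ax+Bu,\ x(0)=x_0,$$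 with corresponding optimal trajectory $x^*$, is given in feedback form by $$u^*(t)=-(K^*K)^{-1}B^*P(T-t)\left(x^*(t)-x_e\right)-(K^*K)^{-1}B^*\hat U_T(T-t,0)w+u_e,\qquad t\in[0,T].$$
   Context: $L(X,Y)$ denotes bounded linear operators from $X$ to $Y$. $K$ coercive means that there is $m>0$ with $\langle K^*Ku,u\rangle\ge m\|u\|^2$ for all $u\in\mathcal U$. $(A,B)$ is exponentially stabilizable if there is $F\in L(\mathcal H,\mathcal U)$ such that $A+BF$ generates an exponentially stable semigroup; $(A,C)$ is exponentially detectable if there is $L\in L(\mathcal Y,\mathcal H)$ such that $A+LC$ generates an exponentially stable semigroup. Solutions of $\dot x=Ax+Bu$, $x(0)=x_0$ are mild: $x(t)=\mathcal T_tx_0+\int_0^t\mathcal T_{t-s}Bu(s)\,ds$, with $\mathcal T$ the semigroup generated by $A$. The optimal control problem has a unique optimal control (an equality of controls is in $L^2([0,T],\mathcal U)$, i.e. for a.e. $t$). The solution $\zeta$ of the evolution problem is the unique mild solution in $C([\tau,T],\mathcal H)$. $\Sigma(\mathcal H)$ is the set of bounded self-adjoint operators on $\mathcal H$. $P$ is a (weak) solution of the differential Riccati equation on $[0,T]$ if $P:[0,T]\to\Sigma(\mathcal H)$ is strongly continuous, has the prescribed initial value, and for all $x,y\in D(A)$ the function $\langle P(t)x,y\rangle$ is differentiable on $[0,T]$ with $$\frac{d}{dt}\langle P(t)x,y\rangle-\langle P(t)x,Ay\rangle-\langle P(t)Ax,y\rangle+\langle (K^*K)^{-1}B^*P(t)x,B^*P(t)y\rangle-\langle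 Cx,Cy\rangle=0 .$$ With $P(0)=0$ there is a unique non-negative solution on every $[0,T]$ (known fact). Under the stated assumptions the minimizer $(x_e,u_e)$ exists and is unique, and a vector $w$ as in the claim exists. *)

(* Defs.v *)
From HB Require Import structures.
From mathcomp Require Import all_boot all_order all_algebra complex.
From mathcomp Require Import all_classical all_reals all_analysis.
Set Implicit Arguments.
Unset Strict Implicit.
Unset Printing Implicit Defensive.
Import Order.TTheory GRing.Theory Num.Theory.
Import numFieldNormedType.Exports.
Local Open Scope classical_set_scope.
Local Open Scope ring_scope.

(* Complex Hilbert spaces. The inner product is linear in its first argument
   and conjugate-linear in its second one. *)
HB.mixin Record isHilbert (R : realType) H of CompleteNormedModule R[i] H := {
  hdot : {dot H for Num.conj};
  norm_hdot : forall x : H, `|x| ^+ 2 = hdot x x }.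

#[short(type="hilbertType")]
HB.structure Definition Hilbert (R : realType) :=
  {H of CompleteNormedModule R[i] H & isHilbert R H}.

#[short(type="boundedOp")]
HB.structure Definition BoundedOp (K : numFieldType) (V W : normedModType K) :=
  {f of @GRing.Linear K V W *:%R f & @Continuous V W f}.

Notation "{ 'bounded' V -> W }" := (@BoundedOp.type _ V%type W%type)
  (at level 0, V at level 98, W at level 99,
   format "{ 'bounded'  V  ->  W }") : type_scope.

(* The norm of a normedModType R[i] lies in R[i]; this is the same number
   in R. *)
Definition rnorm (R : realType) (V : normedModType R[i]) (x : V) : R :=
  complex.Re `|x|.

Section Operators.
Variables (R : realType) (X Y : hilbertType R).

(* x' is a value of the adjoint of A : D -> Y at y; it is unique when D is
   dense. *)
Definition adj_rel (D : set X) (A : X -> Y) (y : Y) (x' : X) : Prop :=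
  forall x, D x -> hdot (A x) y = hdot x x'.

Definition adj_dom (D : set X) (A : X -> Y) : set Y :=
  [set y | exists x', adj_rel D A y x'].

Definition adjoint (D : set X) (A : X -> Y) (y : Y) : X :=
  xget 0 [set x' | adj_rel D A y x'].

Definition adj (A : {bounded X -> Y}) : Y -> X := adjoint setT A.

Definition gram (K : {bounded X -> Y}) : X -> X := fun u => adj K (K u).

Definition gram_inv (K : {bounded X -> Y}) : X -> X :=
  'pinv_(fun=> 0) setT (gram K).

Definition coercive (K : {bounded X -> Y}) : Prop :=
  exists2 m : R, 0 < m &
    forall u, ((m * rnorm u ^+ 2)%:C)%C <= hdot (gram K u) u.

End Operators.

Section Semigroups.
Variables (R : realType) (H : hilbertType R).
Implicit Types (S : R -> {bounded H -> H}) (D : set H) (A : H -> H).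

(* Only the values S t with 0 <= t matter. *)
Definition C0_semigroup S : Prop :=
  [/\ forall x, S 0 x = x,
      forall s t x, 0 <= s -> 0 <= t -> S (s + t) x = S s (S t x)
    & forall x, S t x @[t --> 0^'+] --> x].

(* The operator with domain D and values A x, x \in D, is the infinitesimal
   generator of S (equality of graphs). Values of A off D are irrelevant. *)
Definition generates D A S : Prop :=
  C0_semigroup S /\
  forall x l, D x /\ A x = l <->
    (((h^-1)%:C)%C *: (S h x - x)) @[h --> 0^'+] --> l.

Definition exp_stable S : Prop :=
  exists M omega : R, 0 < omega /\
    forall t x, 0 <= t -> rnorm (S t x) <= M * expR (- (omega * t)) * rnorm x.

Definition exp_stabilizable (U : hilbertType R) D A (B : {bounded U -> H}) :=
  exists (F : {bounded H -> U}) S,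
    generates D (fun x => A x + B (F x)) S /\ exp_stable S.

Definition exp_detectable (Y : hilbertType R) D A (C : {bounded H -> Y}) :=
  exists (L : {bounded Y -> H}) S,
    generates D (fun x => A x + L (C x)) S /\ exp_stable S.

End Semigroups.

Section Bochner.
Variables (R : realType) (V : normedModType R[i]).
Implicit Types (D : set R) (f s : R -> V).

Definition simple_function s : Prop :=
  finite_set (range s) /\ forall v, measurable (s @^-1` [set v]).

(* D is meant to have finite measure. *)
Definition simple_integral D s : V :=
  \sum_(v \in range s)
    ((fine (lebesgue_measure (D `&` s @^-1` [set v])))%:C)%C *: v.

Definition strongly_measurable D f : Prop :=
  exists s : nat -> R -> V, (forall n, simple_function (s n)) /\
    forall t, D t -> s n t @[n --> \oo] --> f t.

(* f is Bochner integrable on D, with integral I. *)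
Definition is_bochner_integral D f (I : V) : Prop :=
  strongly_measurable D f /\
  exists s : nat -> R -> V,
    [/\ forall n, simple_function (s n),
        (\int[lebesgue_measure]_(t in D) (rnorm (f t - s n t))%:E)%E
          @[n --> \oo] --> 0%E
      & simple_integral D (s n) @[n --> \oo] --> I].

(* Representatives of the elements of L^2(D, V); every class modulo a.e.
   equality has a strongly measurable representative. *)
Definition L2 D f : Prop :=
  strongly_measurable D f /\
  (\int[lebesgue_measure]_(t in D) (rnorm (f t) ^+ 2)%:E < +oo)%E.

(* Derivative at t of f restricted to D; it is one-sided at an endpoint of an
   interval D. *)
Definition is_derive_in D f (t : R) (l : V) : Prop :=
  (((h^-1)%:C)%C *: (f (t + h) - f t))
    @[h --> within [set h | D (t + h)] 0^'] --> l.

End Bochner.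

(* Mild solution on [a, b] of x' = G x + f, x(a) = x0, where G generates S. *)
Definition mild_solution (R : realType) (H : hilbertType R)
    (S : R -> {bounded H -> H}) (f : R -> H) (a b : R) (x0 : H)
    (x : R -> H) : Prop :=
  forall t, t \in `[a, b] ->
    is_bochner_integral `[a, t] (fun s => S (t - s) (f s)) (x t - S (t - a) x0).

Section OptimalControl.
Variables (R : realType) (H U Y : hilbertType R).
Variables (B : {bounded U -> H}) (C : {bounded H -> Y}) (K : {bounded U -> H}).

Definition ell (z : H) (v : U) (x : H) (u : U) : R :=
  rnorm (C x) ^+ 2 + rnorm (K u) ^+ 2
  + 2 * complex.Re (hdot z x) + 2 * complex.Re (hdot v u).

Definition steady_state_minimizer (D : set H) (A : H -> H) (z : H) (v : U)
    (xe : H) (ue : U) : Prop :=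
  [/\ D xe, A xe + B ue = 0
    & forall x u, D x -> A x + B u = 0 -> ell z v xe ue <= ell z v x u].

Definition cost (z : H) (v : U) (T : R) (x : R -> H) (u : R -> U) : \bar R :=
  (\int[lebesgue_measure]_(t in `[0%R, T]) (ell z v (x t) (u t))%:E)%E.

Definition admissible (S : R -> {bounded H -> H}) (T : R) (x0 : H)
    (x : R -> H) (u : R -> U) : Prop :=
  L2 `[0, T] u /\ mild_solution S (fun s => B (u s)) 0 T x0 x.

Definition optimal (S : R -> {bounded H -> H}) (z : H) (v : U) (T : R) (x0 : H)
    (x : R -> H) (u : R -> U) : Prop :=
  admissible S T x0 x u /\
  forall x' u', admissible S T x0 x' u' ->
    (cost z v T x u <= cost z v T x' u')%E.

(* (K^* K)^{-1} B^* *)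
Definition feedback (x : H) : U := gram_inv K (adj B x).

Definition riccati_solution (D : set H) (A : H -> H) (T : R)
    (P : R -> {bounded H -> H}) : Prop :=
  [/\ forall t x y, t \in `[0, T] -> hdot (P t x) y = hdot x (P t y),
      forall x, {within `[0, T], continuous (fun t => P t x)},
      forall x, P 0 x = 0
    & forall x y t, D x -> D y -> t \in `[0, T] ->
        is_derive_in `[0, T] (fun s => hdot (P s x) y : R[i]^o) t
          (hdot (P t x) (A y) + hdot (P t (A x)) y
           - hdot (feedback (P t x)) (adj B (P t y)) + hdot (C x) (C y))].

(* E t tau is the evolution operator on 0 <= tau <= t <= T of
   zeta' = (G - P(t) B (K^* K)^{-1} B^* ) zeta, where G generates S. *)
Definition evolution_operator (S P : R -> {bounded H -> H}) (T : R)
    (E : R -> R -> H -> H) : Prop :=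
  forall tau zeta0, tau \in `[0, T] ->
    {within `[tau, T], continuous (fun t => E t tau zeta0)} /\
    mild_solution S (fun s => - P s (B (feedback (E s tau zeta0)))) tau T zeta0
      (fun t => E t tau zeta0).

End OptimalControl.

(* Main.v *)
Require Import Defs.
From HB Require Import structures.
From mathcomp Require Import all_boot all_order all_algebra complex.
From mathcomp Require Import all_classical all_reals all_analysis.
From mathcomp Require Import finmap measurable_realfun ring lra.
Set Implicit Arguments.
Unset Strict Implicit.
Unset Printing Implicit Defensive.
Import Order.TTheory GRing.Theory Num.Theory.
Import numFieldNormedType.Exports.
Local Open Scope classical_set_scope.
Local Open Scope ring_scope.

(* The first variation of the cost vanishes at the optimal pair. Write g for u
   minus its feedback law, X(t) = x(t) - xe and
     p(t) = P(T-t) X(t) + E(T-t, 0) w - w.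
   The integrated Riccati and evolution equations give
     p(t) = \int_t^T S(s-t)^* f(s) ds,  f = z + C^* C x - P(T-s) B g.
   For a variation (xi, phi), where xi is the response to phi from 0, Fubini's
   theorem turns \int <f, xi> into \int <p, B phi>; as B^* p + K^* K u + v =
   K^* K g, the first variation reduces to
     \int_0^T Re <K^* K g, phi> + Re <B g, P(T-s) xi> ds = 0.
   With q = K^* K g and phi = q on [a, T], phi = 0 before a, this yields
     \int_a^T |q|^2 <= c (\int_a^T |q|)^2,
   and q = 0 a.e. follows by backward induction over short time steps. *)

(** The textbook derivation differentiates P(T-t) (x - xe) along the optimal trajectory. That is not
    possible here: the control is only square integrable, the trajectory is only mild and need not
    enter D(A), and the Riccati equation holds only when tested on D(A). Derivatives are therefore
    taken only along free orbits S(s-t) a with a in D(A), where the terms with A cancel; what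
    remains involves bounded operators alone and extends to all vectors by density. The trajectory
    enters afterwards, through variation of constants and Fubini. Every identity is tested with the
    real part of the inner product, which still determines vectors and turns vector integrals into
    real ones. The term with P(T-s) xi in the first variation is harmless because xi depends
    causally on phi: it vanishes before the support of phi and is bounded by the integral of |phi|.
    So this term is at most a constant times the square of an L^1 norm over [a, T], whereas the main
    term is the square of an L^2 norm, and on a short interval Cauchy-Schwarz makes the first one
    the smaller. *)

Lemma cvg_continuous (T : Type) (F : set_system T) {FF : Filter F}
    (X Y : topologicalType) (f : T -> X) (g : X -> Y) x :
  continuous g -> f @ F --> x -> (fun t => g (f t)) @ F --> g x.
Proof. by move=> cg fx; apply: continuous_cvg => //; exact: cg. Qed.

Lemma continuous_fun (X Y Z : topologicalType) (f : X -> Y) (g : Y -> Z) :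
  continuous g -> continuous f -> continuous (fun x => g (f x)).
Proof. by move=> cg cf x; exact: (cvg_continuous cg (cf x)). Qed.

Lemma cvg_pairT (T : Type) (F : set_system T) {FF : Filter F}
    (X Y : topologicalType) (f : T -> X) (g : T -> Y) (x : X) (y : Y) :
  f @ F --> x -> g @ F --> y -> (fun t => (f t, g t)) @ F --> (x, y).
Proof. by move=> fx gy; exact: cvg_pair. Qed.

Lemma continuous_pair (X Y Z : topologicalType) (f : X -> Y) (g : X -> Z) :
  continuous f -> continuous g -> continuous (fun x => (f x, g x)).
Proof. by move=> cf cg x; exact: (cvg_pairT (cf x) (cg x)). Qed.

Lemma continuous_fst (X Y : topologicalType) : continuous (@fst X Y).
Proof. by move=> x; exact: cvg_fst. Qed.

Lemma continuous_snd (X Y : topologicalType) : continuous (@snd X Y).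
Proof. by move=> x; exact: cvg_snd. Qed.

(** * The real inner product *)

Section RealInnerProduct.
Variables (R : realType) (H : hilbertType R).
Implicit Types (x y z : H) (a b : R).

(** The real part turns H into a real Hilbert space with the same norm ([rnorm_sqr]), and [rdot_inj]
    shows that it still separates vectors. *)
Definition rdot x y : R := complex.Re (hdot x y).

Definition rscale a x : H := (a%:C)%C *: x.
Local Notation "a **: x" := (rscale a x) (at level 40).

Lemma hdot_conj x y : hdot x y = Num.conj (hdot y x).
Proof. by rewrite hermC expr0 mul1r. Qed.

Lemma rdotC x y : rdot x y = rdot y x.
Proof. by rewrite /rdot hdot_conj; case: (hdot y x). Qed.

Lemma ReD (p q : R[i]) : complex.Re (p + q) = complex.Re p + complex.Re q.
Proof. by case: p q => [? ?] [? ?]. Qed.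

Lemma ReN (p : R[i]) : complex.Re (- p) = - complex.Re p.
Proof. by case: p. Qed.

Lemma ReZ a (p : R[i]) : complex.Re ((a%:C)%C * p) = a * complex.Re p.
Proof. by case: p => u v /=; rewrite mul0r subr0. Qed.

Lemma rdotDl x y z : rdot (x + y) z = rdot x z + rdot y z.
Proof. by rewrite /rdot linearDl ReD. Qed.
Lemma rdotDr x y z : rdot x (y + z) = rdot x y + rdot x z.
Proof. by rewrite rdotC rdotDl !(rdotC x). Qed.
Lemma rdotZl a x y : rdot (a **: x) y = a * rdot x y.
Proof. by rewrite /rdot /rscale linearZl_LR ReZ. Qed.
Lemma rdotZr a x y : rdot x (a **: y) = a * rdot x y.
Proof. by rewrite rdotC rdotZl rdotC. Qed.
Lemma rdotNl x y : rdot (- x) y = - rdot x y.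
Proof. by rewrite /rdot linearNl ReN. Qed.
Lemma rdotNr x y : rdot x (- y) = - rdot x y.
Proof. by rewrite rdotC rdotNl rdotC. Qed.
Lemma rdot0l y : rdot 0 y = 0.
Proof. by have := rdotNl 0 y; rewrite oppr0; lra. Qed.
Lemma rdot0r x : rdot x 0 = 0.
Proof. by rewrite rdotC rdot0l. Qed.
Lemma rdotBl x y z : rdot (x - y) z = rdot x z - rdot y z.
Proof. by rewrite rdotDl rdotNl. Qed.
Lemma rdotBr x y z : rdot x (y - z) = rdot x y - rdot x z.
Proof. by rewrite rdotDr rdotNr. Qed.
Definition rdotE := (rdotDl, rdotDr, rdotNl, rdotNr, rdotZl, rdotZr).

Lemma rscaleDr a x y : a **: (x + y) = a **: x + a **: y.
Proof. exact: scalerDr. Qed.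
Lemma rscaleN a x : a **: (- x) = - (a **: x).
Proof. exact: scalerN. Qed.
Lemma rscaleBr a x y : a **: (x - y) = a **: x - a **: y.
Proof. exact: scalerBr. Qed.
Lemma rscaleDl a b x : (a + b) **: x = a **: x + b **: x.
Proof. by rewrite /rscale rmorphD scalerDl. Qed.
Lemma rscaleA a b x : a **: (b **: x) = (a * b) **: x.
Proof. by rewrite /rscale rmorphM scalerA. Qed.
Lemma rscale1 x : 1 **: x = x. Proof. by rewrite /rscale rmorph1 scale1r. Qed.
Lemma rscale0 x : 0 **: x = 0. Proof. by rewrite /rscale rmorph0 scale0r. Qed.
Lemma rscale0r a : a **: 0 = 0. Proof. exact: scaler0. Qed.

Lemma rnormE (V : normedModType R[i]) (x : V) : `|x| = ((rnorm x)%:C)%C.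
Proof.
by rewrite /rnorm; have := normr_ge0 x; case: (`|x|) => p q; rewrite lecE /= => /andP[/eqP-> _].
Qed.

Lemma rnorm_ge0 (V : normedModType R[i]) (x : V) : 0 <= rnorm x.
Proof. by have := normr_ge0 x; rewrite rnormE lecR. Qed.
Hint Resolve rnorm_ge0 : core.

Lemma rnorm_sqr x : rnorm x ^+ 2 = rdot x x.
Proof.
have := norm_hdot x; rewrite rnormE /rdot => <-.
by rewrite -rmorphXn /= .
Qed.

Lemma rnormD (V : normedModType R[i]) (x y : V) : rnorm (x + y) <= rnorm x + rnorm y.
Proof. by have := ler_normD x y; rewrite !rnormE -rmorphD lecR. Qed.
Lemma rnormN (V : normedModType R[i]) (x : V) : rnorm (- x) = rnorm x.
Proof. by rewrite /rnorm normrN. Qed.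
Lemma rnormB (V : normedModType R[i]) (x y : V) : rnorm (x - y) <= rnorm x + rnorm y.
Proof. by rewrite -(rnormN y) rnormD. Qed.
Lemma rnorm_distC (V : normedModType R[i]) (x y : V) : rnorm (x - y) = rnorm (y - x).
Proof. by rewrite -rnormN opprB. Qed.
Lemma rnorm0 (V : normedModType R[i]) : rnorm (0 : V) = 0.
Proof. by rewrite /rnorm normr0. Qed.
Lemma rnorm_eq0 (V : normedModType R[i]) (x : V) : rnorm x = 0 -> x = 0.
Proof. by move=> h; apply/normr0_eq0; rewrite rnormE h. Qed.
Lemma rnormZ a x : rnorm (a **: x) = `|a| * rnorm x.
Proof.
rewrite /rscale; have := normrZ (a%:C)%C x; rewrite !rnormE => h.
apply: complexI; rewrite [LHS]h rmorphM; congr (_ * _).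
by rewrite -[LHS]/(`|(a%:C)%C|) normc_def /= expr0n /= addr0 sqrtr_sqr.
Qed.

Lemma rdot_ge0 x : 0 <= rdot x x.
Proof. by rewrite -rnorm_sqr exprn_ge0. Qed.

Lemma rdot_eq0 x : rdot x x = 0 -> x = 0.
Proof. by rewrite -rnorm_sqr => /eqP; rewrite sqrf_eq0 => /eqP/rnorm_eq0. Qed.

Lemma rdot_inj x y : (forall z, rdot x z = rdot y z) -> x = y.
Proof.
move=> h; apply/eqP; rewrite -subr_eq0; apply/eqP/rdot_eq0.
by rewrite rdotBl h subrr.
Qed.

(** Cauchy-Schwarz: the squared norm of |y| x - |x| y equals 2 |x| |y| (|x| |y| - <x, y>). *)
Lemma rdot_le x y : rdot x y <= rnorm x * rnorm y.
Proof.
have [/eqP|x0] := eqVneq (rnorm x) 0.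
  by move=> /eqP/rnorm_eq0 ->; rewrite rdot0l rnorm0 mul0r.
have [/eqP|y0] := eqVneq (rnorm y) 0.
  by move=> /eqP/rnorm_eq0 ->; rewrite rdot0r rnorm0 mulr0.
have nx : 0 < rnorm x by rewrite lt_def x0 rnorm_ge0.
have ny : 0 < rnorm y by rewrite lt_def y0 rnorm_ge0.
have := rdot_ge0 (rnorm y **: x - rnorm x **: y).
rewrite !rdotE (rdotC y x) -!rnorm_sqr => h.
have h2 : 0 <= (rnorm x * rnorm y) * (rnorm x * rnorm y - rdot x y) by nra.
by move: h2; rewrite pmulr_rge0 ?mulr_gt0 // subr_ge0.
Qed.

Lemma abs_rdot_le x y : `|rdot x y| <= rnorm x * rnorm y.
Proof.
rewrite ler_norml rdot_le andbT lerNl -rdotNl (le_trans (rdot_le _ _))//.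
by rewrite rnormN.
Qed.

(** The passage from estimates of tested integrals to norm bounds; the test vector y = x
    suffices. *)
Lemma rnorm_le_dual x c : 0 <= c ->
  (forall y, rdot x y <= c * rnorm y) -> rnorm x <= c.
Proof.
move=> c0 /(_ x); rewrite -rnorm_sqr expr2; have := rnorm_ge0 x.
by rewrite le_eqVlt => /predU1P[<- //|x0]; rewrite ler_pM2r.
Qed.

Lemma parallelogram x y :
  rnorm (x + y) ^+ 2 + rnorm (x - y) ^+ 2 = 2 * rnorm x ^+ 2 + 2 * rnorm y ^+ 2.
Proof. by rewrite !rnorm_sqr !rdotE (rdotC y x); ring. Qed.

Lemma cvg_rnorm (T : Type) (F : set_system T) {FF : Filter F}
    (V : normedModType R[i]) (f : T -> V) (l : V) :
  f @ F --> l <-> (fun t => rnorm (f t - l)) @ F --> (0 : R).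
Proof.
split.
  move=> /cvgrPdist_lt h; apply/cvgrPdist_lt => e e0.
  have := h (e%:C)%C; rewrite ltcR => /(_ e0); apply: filterS => t.
  by rewrite rnormE ltcR sub0r normrN ger0_norm ?rnorm_ge0// rnorm_distC.
move=> /cvgrPdist_lt h; apply/cvgrPdist_lt => e e0.
have [r re] : exists r : R, e = (r%:C)%C.
  by exists (complex.Re e); rewrite RRe_real ?gtr0_real.
have := h r; move: e0; rewrite re ltcR => e0 /(_ e0); apply: filterS => t.
by rewrite rnormE ltcR sub0r normrN ger0_norm ?rnorm_ge0// rnorm_distC.
Qed.

Lemma cvg_rnorm_le (T : Type) (F : set_system T) {FF : Filter F}
    (V : normedModType R[i]) (f : T -> V) (l : V) (g : T -> R) :
  (\forall t \near F, rnorm (f t - l) <= g t) -> g @ F --> 0 -> f @ F --> l.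
Proof.
move=> fg /cvgrPdist_lt g0; apply/cvg_rnorm/cvgrPdist_lt => e e0.
apply: filterS2 fg (g0 _ e0) => t h1; rewrite !sub0r !normrN => h2.
by rewrite ger0_norm// (le_lt_trans h1)// (le_lt_trans (ler_norm _)).
Qed.

Lemma rdot_continuous : continuous (fun p : H * H => rdot p.1 p.2).
Proof.
move=> [x y]; apply/cvgrPdist_lt => e e0 /=.
(* The error has two linear terms and one quadratic term; d <= 1 absorbs the quadratic one, so the
   sum is below d (1 + |x| + |y|). *)
pose d := Num.min 1 (e / (2 * (1 + rnorm x + rnorm y))).
have s0 : 0 < 1 + rnorm x + rnorm y by rewrite -addrA ltr_pwDl// addr_ge0.
have d0 : 0 < d by rewrite lt_min ltr01 divr_gt0// mulr_gt0.
have d1 : d <= 1 by rewrite ge_min lexx.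
have de : d * (1 + rnorm x + rnorm y) < e.
  have : d <= e / (2 * (1 + rnorm x + rnorm y)) by rewrite ge_min lexx orbT.
  by rewrite ler_pdivlMr ?mulr_gt0//; lra.
have nb (z : H) : \forall z' \near z, rnorm (z - z') < d.
  apply/nbhs_normP; exists (d%:C)%C; first by rewrite /= ltcR.
  by move=> z' /=; rewrite rnormE ltcR.
exists ([set x' | rnorm (x - x') < d], [set y' | rnorm (y - y') < d]); first by split; exact: nb.
move=> [x' y'] /= [hx hy].
have -> : rdot x y - rdot x' y' = rdot (x - x') y + rdot x (y - y') - rdot (x - x') (y - y').
  by rewrite !rdotE; ring.
apply: le_lt_trans (ler_normB _ _) _; apply: le_lt_trans (lerD (ler_normD _ _) (lexx _)) _.
have := abs_rdot_le (x - x') y; have := abs_rdot_le x (y - y').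
have := abs_rdot_le (x - x') (y - y').
have := rnorm_ge0 (x - x'); have := rnorm_ge0 (y - y').
have := rnorm_ge0 x; have := rnorm_ge0 y.
nra.
Qed.

Lemma cvg_rdot (T : Type) (F : set_system T) {FF : Filter F} (f g : T -> H) x y :
  f @ F --> x -> g @ F --> y -> (fun t => rdot (f t) (g t)) @ F --> rdot x y.
Proof.
move=> fx gy.
exact: (cvg_continuous rdot_continuous (cvg_pairT fx gy)).
Qed.

Lemma cvg_rscale (T : Type) (F : set_system T) {FF : Filter F} (a : T -> R) (f : T -> H) c x :
  a @ F --> c -> f @ F --> x -> (fun t => a t **: f t) @ F --> c **: x.
Proof.
move=> ac fx; apply: cvgZ fx.
apply/cvgrPdist_lt => e e0.
have [r re] : exists r : R, e = (r%:C)%C.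
  by exists (complex.Re e); rewrite RRe_real ?gtr0_real.
move/cvgrPdist_lt : ac => /(_ r); move: e0; rewrite re ltcR => e0 /(_ e0).
apply: filterS => t h; rewrite -rmorphB normc_def /= expr0n /= addr0 sqrtr_sqr.
by rewrite ltcR.
Qed.

End RealInnerProduct.
Notation "a **: x" := (rscale a x) (at level 40).
#[global] Hint Extern 0 (is_true (0 <= rnorm _)) => exact: rnorm_ge0 : core.

(** * Bounded operators and adjoints *)

Section BoundedOperators.
Variable (R : realType).
Implicit Types (V W X : hilbertType R).

(* Only linearity over the reals is recorded: all the arguments use [rdot]. *)
Definition bop V W (f : V -> W) : Prop :=
  [/\ {morph f : x y / x + y}, forall a x, f (a **: x) = a **: f x
    & exists2 M, 0 <= M & forall x, rnorm (f x) <= M * rnorm x].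

Lemma bopD V W (f : V -> W) : bop f -> {morph f : x y / x + y}.
Proof. by case. Qed.
Lemma bopZ V W (f : V -> W) : bop f -> forall a x, f (a **: x) = a **: f x.
Proof. by case. Qed.
Lemma bopN V W (f : V -> W) : bop f -> {morph f : x / - x}.
Proof.
by case=> _ h _ x; have := h (-1) x; rewrite /rscale rmorphN rmorph1 !scaleN1r.
Qed.
Lemma bopB V W (f : V -> W) : bop f -> {morph f : x y / x - y}.
Proof. by move=> h x y; rewrite (bopD h) (bopN h). Qed.
Lemma bop0 V W (f : V -> W) : bop f -> f 0 = 0.
Proof. by move=> h; have := bopB h 0 0; rewrite !subrr. Qed.

Lemma bop_comp V W X (f : V -> W) (g : W -> X) :
  bop f -> bop g -> bop (fun x => g (f x)).
Proof.
move=> [fD fZ [M M0 fM]] [gD gZ [N N0 gN]]; split.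
- by move=> x y; rewrite fD gD.
- by move=> a x; rewrite fZ gZ.
- exists (N * M); first exact: mulr_ge0.
  by move=> x; rewrite (le_trans (gN _))// -mulrA ler_wpM2l.
Qed.

Lemma bop_sub V W (f g : V -> W) : bop f -> bop g -> bop (fun x => f x - g x).
Proof.
move=> hf hg; split.
- by move=> x y; rewrite (bopD hf) (bopD hg) opprD addrACA.
- by move=> a x; rewrite (bopZ hf) (bopZ hg) rscaleBr.
- case: hf hg => _ _ [M M0 fM] [_ _ [N N0 gN]].
  exists (M + N); first exact: addr_ge0.
  by move=> x; rewrite (le_trans (rnormB _ _))// mulrDl lerD.
Qed.

Lemma bop_cvg V W (f : V -> W) (T : Type) (F : set_system T) {FF : Filter F}
    (g : T -> V) l : bop f -> g @ F --> l -> (fun t => f (g t)) @ F --> f l.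
Proof.
move=> hf /cvg_rnorm gl.
have [_ _ [M M0 fM]] := hf.
apply: (@cvg_rnorm_le _ _ _ _ _ _ _ (fun t => M * rnorm (g t - l))).
  by apply: nearW => t; rewrite -(bopB hf) fM.
by rewrite -[0](mulr0 M); apply: cvgM gl; exact: cvg_cst.
Qed.

Lemma bounded_bop V W (f : {bounded V -> W}) : bop f.
Proof.
split; first exact: linearD.
  by move=> a x; rewrite /rscale linearZ.
have /cvg_rnorm /cvgrPdist_lt /(_ _ ltr01) : f x @[x --> (0 : V)] --> f 0.
  exact: cts_fun.
rewrite linear0 => /nbhs_normP[e' /= e'0 he].
have [e re] : exists r : R, e' = (r%:C)%C.
  by exists (complex.Re e'); rewrite RRe_real ?gtr0_real.
move: e'0; rewrite re ltcR => e0.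
have {}he y : rnorm y < e -> rnorm (f y) < 1.
  move=> ye; have := he y; rewrite /ball_ /= re sub0r normrN rnormE ltcR => /(_ ye).
  by rewrite subr0 sub0r normrN ger0_norm.
(* Rescaling x to norm e / 2 puts it in the ball where the image has norm below 1. *)
exists (2 / e); first by rewrite divr_ge0 ?ltW.
move=> x; have [x0|x0] := eqVneq (rnorm x) 0.
  by rewrite (rnorm_eq0 x0) linear0 !rnorm0 mulr0.
have nx : 0 < rnorm x by rewrite lt_def x0 rnorm_ge0.
have c0 : 0 < e / (2 * rnorm x) by rewrite divr_gt0// mulr_gt0.
have := he ((e / (2 * rnorm x)) **: x).
rewrite rnormZ gtr0_norm// /rscale linearZ -/(rscale _ _) rnormZ gtr0_norm// => h.
have /h : e / (2 * rnorm x) * rnorm x < e.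
  by rewrite [X in X < _](_ : _ = e / 2); [lra | field].
rewrite -ltr_pdivlMl// mulr1 invf_div => /ltW /le_trans; apply.
by rewrite mulrAC.
Qed.

Lemma complete_rnorm V (x : nat -> V) :
  (forall e, 0 < e -> exists N, forall n k, (N <= n)%N -> (N <= k)%N -> rnorm (x n - x k) < e) ->
  exists l : V, x n @[n --> \oo] --> l.
Proof.
move=> h; suff xc : cauchy (x @ \oo) by exists (lim (x @ \oo)); exact: cauchy_cvg xc.
apply: cauchy_exP => e e0.
have [r re] : exists r : R, e = (r%:C)%C.
  by exists (complex.Re e); rewrite RRe_real ?gtr0_real.
move: e0; rewrite re ltcR => /h [N hN]; exists (x N).
exists N => // n /= Nn; rewrite -ball_normE /= rnormE ltcR; exact: hN.
Qed.

(** A Baire argument by hand: were there no uniform bound, nested balls could be chosen so that on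
    the n-th one some member of the family is at least n in norm; a common point of the balls
    contradicts pointwise boundedness. *)
Lemma uniform_boundedness V W (I : Type) (F : I -> V -> W) :
  (forall i, bop (F i)) -> (forall x, exists M, forall i, rnorm (F i x) <= M) ->
  exists2 M, 0 <= M & forall i x, rnorm (F i x) <= M * rnorm x.
Proof.
move=> bF pF; apply: contrapT => nU.
have big (r M : R) : 0 < r -> exists i x, rnorm x = r /\ M < rnorm (F i x).
  move=> r0; have M0 : 0 <= `|M| / r by rewrite divr_ge0// ltW.
  apply: contrapT => nE; apply: nU; exists (`|M| / r) => // i x.
  rewrite leNgt; apply/negP => h; apply: nE.
  have x0 : 0 < rnorm x.
    rewrite lt_def rnorm_ge0 andbT; apply/eqP => /rnorm_eq0 x0.
    by move: h; rewrite x0 (bop0 (bF i)) !rnorm0 mulr0 ltxx.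
  exists i, ((r / rnorm x) **: x); rewrite (bopZ (bF i)) !rnormZ gtr0_norm ?divr_gt0//.
  split; first by field; rewrite gt_eqF.
  apply: (le_lt_trans (ler_norm M)).
  rewrite -ltr_pdivrMl ?divr_gt0// invf_div.
  by rewrite (_ : _ * `|M| = `|M| / r * rnorm x)//; ring.
have step (p : V * R * nat) : exists q : V * R, 0 < p.1.2 ->
    [/\ 0 < q.2, q.2 <= p.1.2 / 2, rnorm (q.1 - p.1.1) <= p.1.2 / 2 &
     exists i, forall y, rnorm (y - q.1) <= q.2 -> p.2%:R <= rnorm (F i y)].
  case: p => [[x r] n] /=; have [r0|] := ltP 0 r; last by move=> _; exists (x, r).
  have r20 : 0 < r / 2 by rewrite divr_gt0.
  have [i [xi [nxi hi]]] := big (r / 2) (n%:R + 1) r20.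
  (* One of x + xi and x - xi works: the two images differ by 2 F i xi, whose norm exceeds 2 (n +
     1). *)
  have [x' hx' hF] : exists2 x', rnorm (x' - x) <= r / 2 & n%:R + 1 < rnorm (F i x').
    have [h|h] := ltP (n%:R + 1) (rnorm (F i (x + xi))).
      by exists (x + xi) => //; rewrite addrC addKr nxi.
    exists (x - xi); first by rewrite addrC addKr rnormN nxi.
    rewrite ltNge; apply/negP => h2.
    have := rnormB (F i (x + xi)) (F i (x - xi)).
    rewrite -(bopB (bF i)).
    have -> : x + xi - (x - xi) = 2 **: xi.
      by rewrite opprB addrC addrA subrK -[2]/(1 + 1) rscaleDl rscale1.
    rewrite (bopZ (bF i)).
    rewrite rnormZ ger0_norm//; lra.
  have [_ _ [M M0 FM]] := bF i.
  have M1 : 0 < M + 1 by rewrite ltr_wpDl.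
  (* On a ball of radius 1 / (M + 1) the operator F i varies by at most 1, so the bound n + 1 at the
     centre leaves n. *)
  exists (x', Num.min (r / 2) (1 / (M + 1))) => _ /=; split => //.
  - by rewrite lt_min r20 divr_gt0.
  - by rewrite ge_min lexx.
  exists i => y; rewrite le_min => /andP[_ hy].
  have := FM (x' - y); rewrite (bopB (bF i)) rnorm_distC (rnorm_distC x').
  have : M * rnorm (y - x') <= 1.
    rewrite (le_trans (ler_wpM2l M0 hy))// mulrA mulr1 ler_pdivrMr// mul1r.
    by rewrite lerDl.
  have := rnormB (F i y) (F i y - F i x'); rewrite opprB addrC subrK; lra.
have {step}[g hg] := choice step.
pose s := fix s n : V * R := if n is m.+1 then g (s m, m) else (0, 1).
have s0 n : 0 < (s n).2.
  by elim: n => [/=|n IH]; [exact: ltr01 | have [] := hg (s n, n) IH].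
have sS n := hg (s n, n) (s0 n).
have s2 n : (s n).2 <= 1 / 2 ^+ n.
  elim: n => [|n IH]; first by rewrite expr0 divr1.
  have [_ h _ _] := sS n; rewrite (le_trans h)//= exprS.
  have -> : 1 / (2 * 2 ^+ n) = 1 / 2 ^+ n / 2 :> R by rewrite invfM; ring.
  by rewrite ler_wpM2r.
(* A move is at most half the radius and the radius at least halves, so distances between centres
   telescope into differences of radii. *)
have sk n k : rnorm ((s (n + k)%N).1 - (s n).1) <= (s n).2 - (s (n + k)%N).2.
  elim: k => [|k IH]; first by rewrite addn0 !subrr rnorm0.
  rewrite addnS; have [_ h1 h2 _] := sS (n + k)%N.
  have := rnormD ((s (n + k).+1).1 - (s (n + k)%N).1) ((s (n + k)%N).1 - (s n).1).
  rewrite addrA subrK; move: h1 h2 IH => /=; set a := rnorm _; set b := rnorm _; lra.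
have [l hl] : exists l : V, (s n).1 @[n --> \oo] --> l.
  apply: complete_rnorm => e e0.
  have [N hN] : exists N, (1 / 2 ^+ N : R) < e / 2.
    have : (fun n => (1 / 2 ^+ n : R)) @ \oo --> (0 : R).
      have -> : (fun n => (1 / 2 ^+ n : R)) = geometric 1 (2^-1).
        by apply/funext => n; rewrite /geometric /= exprVn.
      by apply: cvg_geometric; rewrite ger0_norm ?invr_ge0// invf_lt1// ltr1n.
    move/cvgrPdist_lt => /(_ (e / 2)); rewrite divr_gt0// => /(_ isT)[N _ h].
    by exists N; have := h N (leqnn N); rewrite sub0r normrN ger0_norm// divr_ge0// exprn_ge0.
  exists N => n k Nn Nk.
  have a := sk N (n - N)%N; have b := sk N (k - N)%N.
  rewrite !subnKC// in a b.
  have := rnormB ((s n).1 - (s N).1) ((s k).1 - (s N).1).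
  rewrite opprB addrA subrK; have := s0 n; have := s0 k; have := s2 N.
  move: a b hN; set x1 := rnorm _; set x2 := rnorm _; set x3 := rnorm _; lra.
have lb n : rnorm (l - (s n).1) <= (s n).2.
  move/cvg_rnorm/cvgrPdist_lt : hl => hl; rewrite leNgt; apply/negP => h.
  have [N _ hN] := hl (rnorm (l - (s n).1) - (s n).2) ltac:(by rewrite subr_gt0).
  have := hN (n + N)%N (leq_addl _ _); rewrite sub0r normrN ger0_norm//.
  have := sk n N; have := s0 (n + N)%N.
  have := rnormB ((s (n + N)%N).1 - (s n).1) ((s (n + N)%N).1 - l).
  have -> : (s (n + N)%N).1 - (s n).1 - ((s (n + N)%N).1 - l) = l - (s n).1.
    by rewrite opprB addrC addrA subrK.
  set x1 := rnorm _; set x2 := rnorm _; lra.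
have [M hM] := pF l.
(* Stage n gives the lower bound n on the ball of index n + 1, which contains l; n is taken above
   the bound M at l. *)
have [_ _ _ [i hi]] := sS (Num.bound `|M|).
have := le_trans (hi l (lb (Num.bound `|M|).+1)) (hM i); rewrite /= leNgt.
by rewrite (le_lt_trans (ler_norm M))// archi_boundP.
Qed.
End BoundedOperators.

(** * Lax-Milgram, adjoints and the inverse of K^* K *)

Section Adjoint.
Variable (R : realType).
Implicit Types (V W X : hilbertType R).

(** The first-order condition at a minimum, for a quadratic polynomial. It serves both the
    Lax-Milgram argument and the first variation of the cost. The test value t = - b / c gives - b^2
    / c >= 0. *)
Lemma quadratic_ge0_linear (b c : R) :
  (forall t, 0 <= 2 * t * b + t ^+ 2 * c) -> b = 0.
Proof.
move=> h; have c0 : 0 <= c by have := h 1; have := h (-1); lra.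
have [ce|cn] := eqVneq c 0.
  by have := h (- b); have := h b; rewrite ce; nra.
have cp : 0 < c by rewrite lt_def cn.
have := h (- b / c); rewrite (_ : _ + _ = - (b ^+ 2 / c)); last by field.
rewrite oppr_ge0 pmulr_lle0 ?invr_gt0// => b2.
by apply/eqP; rewrite -sqrf_eq0 eq_le b2 sqr_ge0.
Qed.

(** Minimization of |G x|^2 - 2 phi x. With G the identity this is the Riesz theorem; with G = K it
    gives surjectivity of K^* K. *)
Lemma lax_milgram V W (G : V -> W) (phi : V -> R) (m : R) :
  bop G -> 0 < m -> (forall x, m * rnorm x ^+ 2 <= rnorm (G x) ^+ 2) ->
  {morph phi : x y / x + y} -> (forall a x, phi (a **: x) = a * phi x) ->
  (exists c, forall x, `|phi x| <= c * rnorm x) ->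
  exists u, forall x, rdot (G u) (G x) = phi x.
Proof.
move=> bG m0 Gm phiD phiZ [c phic].
pose J x := rnorm (G x) ^+ 2 - 2 * phi x.
(* Completing the square: J x >= m |x|^2 - 2 c |x| >= - c^2 / m. *)
have Jge x : - (c ^+ 2 / m) <= J x.
  have := phic x; rewrite ler_norml => /andP[_ h1]; have h2 := Gm x.
  have h3 : 0 <= (m * rnorm x - c) ^+ 2 / m by rewrite divr_ge0 ?sqr_ge0 ?ltW.
  have h4 : (m * rnorm x - c) ^+ 2 / m = m * rnorm x ^+ 2 - 2 * c * rnorm x + c ^+ 2 / m.
    by field; rewrite gt_eqF.
  by rewrite /J; move: h4 h3 => ->; lra.
have infJ : has_inf (range J).
  by split; [exists (J 0), 0 | exists (- (c ^+ 2 / m)) => _ [x _ <-]].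
pose j := inf (range J).
have jJ x : j <= J x by apply: ge_inf; [case: infJ | exists x].
have /choice [x xP] : forall n, exists x, J x < j + n.+1%:R^-1.
  move=> n; have /inf_adherent : 0 < n.+1%:R^-1 :> R by rewrite invr_gt0.
  by move=> /(_ _ infJ)[_ [y _ <-] hy]; exists y.
(* The parallelogram law for G a and G b, together with J >= j at the midpoint, makes a minimizing
   sequence Cauchy. *)
have mid a b : m * rnorm (a - b) ^+ 2 <= 2 * (J a - j) + 2 * (J b - j).
  rewrite (le_trans (Gm _))// (bopB bG).
  have := parallelogram (G a) (G b); have := jJ (2^-1 **: (a + b)).
  rewrite /J (bopZ bG) phiZ rnormZ (bopD bG) phiD ger0_norm ?invr_ge0// exprMn.
  lra.
have [u xu] : exists u : V, x n @[n --> \oo] --> u.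
  apply: complete_rnorm => e e0.
  (* Beyond N both excesses over j are below m e^2 / 4, so [mid] bounds m times the squared distance
     by m e^2. *)
  have [N hN] : exists N, 4 / m / e ^+ 2 < N%:R.
    exists (Num.bound (4 / m / e ^+ 2)); apply: archi_boundP.
    by rewrite !divr_ge0 ?exprn_ge0 ?ltW.
  exists N => n k Nn Nk; rewrite -(@ltr_pXn2r _ 2)// ?nnegrE ?(ltW e0)//.
  have inv p : (N <= p)%N -> p.+1%:R^-1 < m * e ^+ 2 / 4.
    move=> Np; have me : 0 < m * e ^+ 2 / 4 by rewrite divr_gt0// mulr_gt0// exprn_gt0.
    rewrite invf_plt ?posrE// ; apply: (lt_le_trans _ (_ : N%:R <= _)).
      by rewrite (_ : (m * e ^+ 2 / 4)^-1 = 4 / m / e ^+ 2)//; field; rewrite !gt_eqF.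
    by rewrite ler_nat (leq_trans Np).
  rewrite -(ltr_pM2l m0) (le_lt_trans (mid _ _))//.
  move: (xP n) (xP k) (inv _ Nn) (inv _ Nk); move: (_^-1) (_^-1) (m * _) (J _) (J _).
  by move=> a b d Jn Jk; lra.
have Ju : J u <= j.
  have cJ : (fun n => J (x n)) @ \oo --> J u.
    have cG : (fun n => rdot (G (x n)) (G (x n))) @ \oo --> rdot (G u) (G u).
      by apply: cvg_rdot; apply: (bop_cvg bG xu).
    have cphi : (fun n => phi (x n)) @ \oo --> phi u.
      apply/cvgrPdist_le => e e0; have c1 : 0 < `|c| + 1 by rewrite ltr_wpDl.
      move/cvg_rnorm/cvgrPdist_lt : xu => /(_ (e / (`|c| + 1))).
      rewrite divr_gt0// => /(_ isT); apply: filterS => n.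
      rewrite sub0r normrN ger0_norm// ltr_pdivlMr// => h.
      have -> : phi u - phi (x n) = phi (u - x n).
        rewrite phiD; have := phiZ (-1) (x n).
        by rewrite /rscale rmorphN rmorph1 scaleN1r => ->; rewrite mulN1r.
      rewrite (le_trans (phic _))// rnorm_distC (le_trans _ (ltW h))// mulrC ler_wpM2l//.
      by rewrite (le_trans (ler_norm c))// lerDl.
    rewrite /J; under eq_fun do rewrite rnorm_sqr; rewrite rnorm_sqr.
    by apply: cvgB => //; apply: cvgM cphi; exact: cvg_cst.
  apply: (ler_cvg_to cJ (_ : (fun n => j + n.+1%:R^-1) @ \oo --> j)).
    rewrite -[X in _ --> X]addr0; apply: cvgD; first exact: cvg_cst.
    exact: cvg_harmonic.
  by apply: nearW => n; apply/ltW/xP.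
exists u => y; apply/eqP; rewrite -subr_eq0; apply/eqP.
apply: (@quadratic_ge0_linear _ (rdot (G y) (G y))) => t.
have := le_trans Ju (jJ (u + t **: y)).
rewrite /J !rnorm_sqr (bopD bG) (bopZ bG) phiD phiZ !rdotE (rdotC (G y) (G u)); lra.
Qed.

Lemma Re_hdot_i V (x y : V) : rdot (('i%C : R[i]) *: x) y = - complex.Im (hdot x y).
Proof. by rewrite /rdot linearZl_LR /=; case: (hdot x y) => p q /=; lra. Qed.

Lemma bop_dual V W (F : V -> W) y : bop F -> exists u, forall x, rdot (F x) y = rdot x u.
Proof.
move=> bF; have [_ _ [M M0 FM]] := bF.
have [u hu] : exists u, forall x, rdot u x = rdot (F x) y.
  apply: (@lax_milgram V V id (fun x => rdot (F x) y) 1) => //.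
  - by split => //; exists 1 => // x; rewrite mul1r.
  - by move=> x; rewrite mul1r.
  - by move=> x1 x2; rewrite (bopD bF) rdotDl.
  - by move=> a x; rewrite (bopZ bF) rdotZl.
  - exists (M * rnorm y) => x; rewrite (le_trans (abs_rdot_le _ _))//.
    by rewrite mulrAC ler_wpM2r.
by exists u => x; rewrite -hu rdotC.
Qed.

(** The real Riesz vector is also the complex adjoint: testing at x gives the real part of the
    identity, and testing at i x gives the imaginary part. *)
Lemma adjP V W (A : {bounded V -> W}) y : adj_rel setT A y (adj A y).
Proof.
suff [x' hx'] : adj_dom setT A y by rewrite /adj /adjoint; case: xgetP => [x'' -> //|/(_ x')].
have [u hu] := bop_dual y (bounded_bop A).
exists u => x _.
have h1 := hu x; have h2 := hu ('i%C *: x).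
move: h2; rewrite linearZ /= !Re_hdot_i => /oppr_inj.
move: h1; rewrite /rdot; case: (hdot x u) => a b; case: (hdot (A x) y) => c d.
by move=> /= -> ->.
Qed.

Lemma rdot_adj V W (A : {bounded V -> W}) x y : rdot (A x) y = rdot x (adj A y).
Proof. by rewrite /rdot (adjP A). Qed.

Lemma bop_adj V W (A : {bounded V -> W}) : bop (adj A).
Proof.
have [_ _ [M M0 AM]] := bounded_bop A.
split.
- by move=> x y; apply: rdot_inj => z; rewrite !(rdotDl, rdotC _ z) -!rdot_adj rdotDr.
- by move=> a x; apply: rdot_inj => z; rewrite !(rdotZl, rdotC _ z) -!rdot_adj rdotZr.
- exists M => // x; apply: rnorm_le_dual; first exact: mulr_ge0.
  move=> y; rewrite rdotC -rdot_adj (le_trans (rdot_le _ _))//.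
  by rewrite mulrAC ler_wpM2r.
Qed.

Lemma rdot_gram V W (K : {bounded V -> W}) u x : rdot (gram K u) x = rdot (K u) (K x).
Proof. by rewrite /gram rdotC -rdot_adj rdotC. Qed.

Lemma bop_gram V W (K : {bounded V -> W}) : bop (gram K).
Proof. exact: bop_comp (bounded_bop K) (bop_adj K). Qed.

Lemma coercive_lower V W (K : {bounded V -> W}) : coercive K ->
  exists2 m : R, 0 < m & forall u, m * rnorm u ^+ 2 <= rnorm (K u) ^+ 2.
Proof.
move=> [m m0 h]; exists m => // u; have := h u.
rewrite lecE => /andP[_]; rewrite [X in _ <= X](_ : _ = rdot (gram K u) u)//.
by rewrite rdot_gram rnorm_sqr (rnorm_sqr (K u)).
Qed.

(** The pseudo-inverse is a right inverse only on the range of [gram K]; Lax-Milgram shows that this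
    range is the whole space. *)
Lemma gram_invK V W (K : {bounded V -> W}) : coercive K -> cancel (gram_inv K) (gram K).
Proof.
move=> /coercive_lower[m m0 hm] y; rewrite /gram_inv.
suff : (gram K @` setT) y by move=> h; apply: (@pinvK _ _ (fun=> 0) setT (gram K)); exact: mem_set.
have [u hu] : exists u, forall x, rdot (K u) (K x) = rdot y x.
  apply: (@lax_milgram _ _ _ _ m) => //.
  - exact: bounded_bop.
  - by move=> a b; rewrite rdotDr.
  - by move=> a x; rewrite rdotZr.
  - by exists (rnorm y) => x; exact: abs_rdot_le.
by exists u => //; apply: rdot_inj => x; rewrite rdot_gram hu.
Qed.

Lemma gram_inj V W (K : {bounded V -> W}) : coercive K -> injective (gram K).
Proof.
move=> /coercive_lower[m m0 hm] u1 u2 h.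
apply/eqP; rewrite -subr_eq0; apply/eqP/rnorm_eq0.
have := hm (u1 - u2); rewrite (rnorm_sqr (K _)) -rdot_gram (bopB (bop_gram K)) h subrr rdot0l.
rewrite pmulr_rle0// => e; apply/eqP; rewrite -sqrf_eq0 eq_le e; exact: sqr_ge0.
Qed.

Lemma gram_sym V W (K : {bounded V -> W}) x y : rdot (gram K x) y = rdot x (gram K y).
Proof. by rewrite rdot_gram (rdotC x) rdot_gram rdotC. Qed.

Lemma gram_inv_sym V W (K : {bounded V -> W}) x y : coercive K ->
  rdot (gram_inv K x) y = rdot x (gram_inv K y).
Proof. by move=> cK; rewrite -{1}(gram_invK cK y) -gram_sym gram_invK. Qed.

Lemma bop_gram_inv V W (K : {bounded V -> W}) : coercive K -> bop (gram_inv K).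
Proof.
move=> cK; have gK := gram_invK cK; have [m m0 hm] := coercive_lower cK.
split.
- by move=> x y; apply: (gram_inj cK); rewrite (bopD (bop_gram K)) !gK.
- by move=> a x; apply: (gram_inj cK); rewrite (bopZ (bop_gram K)) !gK.
- exists m^-1; first by rewrite invr_ge0 ltW.
  move=> x; have := hm (gram_inv K x); rewrite [X in _ <= X]rnorm_sqr -rdot_gram gK => h.
  have := le_trans h (rdot_le _ _); rewrite expr2.
  have := rnorm_ge0 (gram_inv K x); rewrite le_eqVlt => /predU1P[<- _|n0].
    by rewrite mulr_ge0// invr_ge0 ltW.
  by rewrite mulrA ler_pM2r// ler_pdivlMl.
Qed.

End Adjoint.

(** * Bochner integration *)

Import HBSimple.

(** * Strong measurability *)

Section StrongMeasurability.
Variable (R : realType).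
Implicit Types (D : set R).
Local Notation mu := (@lebesgue_measure R).

(** [simple_function] for an arbitrary target type, so that pairs, booleans and reals are covered by
    the same closure lemmas. *)
Definition simple (X : Type) (s : R -> X) : Prop :=
  finite_set (range s) /\ forall v, measurable (s @^-1` [set v]).

Lemma simple_preimage (X : Type) (s : R -> X) (B : set X) :
  simple s -> measurable (s @^-1` B).
Proof.
move=> [fs ms].
have -> : s @^-1` B = \bigcup_(v in range s `&` B) s @^-1` [set v].
  apply/seteqP; split => [t Bt|t [v [_ Bv] /= sv]]; last by rewrite /preimage /= sv.
  by exists (s t) => //; split => //; exists t.
by apply: fin_bigcup_measurable => //; exact: finite_setIl.
Qed.

Lemma simple2 (X Y Z : Type) (f : X -> Y -> Z) (s : R -> X) (r : R -> Y) :
  simple s -> simple r -> simple (fun t => f (s t) (r t)).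
Proof.
move=> ss sr; split.
  apply: (sub_finite_set _ (finite_image2 f ss.1 sr.1)).
  by move=> _ [t _ <-]; exists (s t); [exists t|exists (r t); [exists t|]].
move=> v.
have -> : (fun t => f (s t) (r t)) @^-1` [set v] =
    \bigcup_(x in range s) (s @^-1` [set x] `&` r @^-1` [set y | f x y = v]).
  apply/seteqP; split => [t /= h|t [x _ [/= sx]]].
    by exists (s t) => //; exists t.
  by rewrite sx.
apply: fin_bigcup_measurable; first exact: ss.1.
by move=> x _; apply: measurableI; [exact: ss.2|exact: simple_preimage].
Qed.

Lemma simple_cst (X : Type) (x : X) : simple (fun=> x).
Proof.
split; first by apply: (sub_finite_set _ (finite_set1 x)) => _ [_ _ <-].
move=> v; have [<-|nv] := pselect (x = v).
  by rewrite (_ : _ @^-1` _ = setT)//; apply/seteqP.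
by rewrite (_ : _ @^-1` _ = set0)//; apply/seteqP; split.
Qed.

Lemma simple1 (X Y : Type) (f : X -> Y) (s : R -> X) : simple s -> simple (fun t => f (s t)).
Proof. by move=> ss; exact: (simple2 (fun x _ => f x) ss (simple_cst tt)). Qed.

Lemma simple_mem D : measurable D -> simple (fun t => t \in D).
Proof.
move=> mD; split; first exact: finite_finset.
case; first by rewrite (_ : _ @^-1` _ = D)//; apply/seteqP; split=> t /= => [/set_mem|/mem_set].
rewrite (_ : _ @^-1` _ = ~` D); first exact: measurableC.
apply/seteqP; split=> t /= => [+ Dt|nD]; first by rewrite mem_set.
by apply/negbTE; rewrite notin_setE.
Qed.

Lemma simple_measurable (s : R -> R) D : measurable D -> simple s -> measurable_fun D s.
Proof. by move=> mD ss _ B _; apply: measurableI => //; exact: simple_preimage. Qed.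

Lemma simple_approx_id : exists theta : nat -> R -> R,
  (forall n, simple (theta n)) /\ forall t, theta n t @[n --> \oo] --> t.
Proof.
have [g hg] := approximation_sfun measurableT (@EFin_measurable R setT).
exists g; split => [n|t].
  split; first exact: fimfunP.
  by move=> v; rewrite -[X in measurable X]setTI; exact: measurable_funP.
by have /fine_cvgP[_] := hg t I.
Qed.

(** Time is approximated by simple functions as well ([simple_approx_id]), so Phi may depend on t.
    This covers kernels such as S(s - t) (f t), which are jointly continuous in time and vector. *)
Lemma strongly_measurable_comp (V W X : normedModType R[i]) (Phi : R * (V * W) -> X) D f g :
  continuous Phi -> strongly_measurable D f -> strongly_measurable D g ->
  strongly_measurable D (fun t => Phi (t, (f t, g t))).
Proof.
move=> cPhi [s [ss sf]] [r [rs rg]]; have [th [ths thid]] := simple_approx_id.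
exists (fun n t => Phi (th n t, (s n t, r n t))); split.
  by move=> n; exact: (simple2 (fun a b => Phi (a, b)) (ths n) (simple2 pair (ss n) (rs n))).
move=> t Dt.
exact: (cvg_continuous cPhi (cvg_pairT (thid t) (cvg_pairT (sf _ Dt) (rg _ Dt)))).
Qed.

Lemma strongly_measurable_cst (V : normedModType R[i]) D (v : V) :
  strongly_measurable D (fun=> v).
Proof. by exists (fun _ _ => v); split => [n|t _]; [exact: simple_cst|exact: cvg_cst]. Qed.

Lemma strongly_measurable_joint (V X : normedModType R[i]) (Phi : R * V -> X) D f :
  continuous Phi -> strongly_measurable D f ->
  strongly_measurable D (fun t => Phi (t, f t)).
Proof.
move=> cPhi mf.
apply: (@strongly_measurable_comp V V X (fun p => Phi (p.1, p.2.1)) D f f) => //.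
apply: (continuous_fun cPhi); apply: continuous_pair; first exact: continuous_fst.
by apply: continuous_fun; [exact: continuous_fst|exact: continuous_snd].
Qed.

Lemma strongly_measurable_continuous (X : normedModType R[i]) D (f : R -> X) :
  continuous f -> strongly_measurable D f.
Proof.
move=> cf; apply: (@strongly_measurable_joint X X (fun p => f p.1) D (fun=> 0)).
  by apply: (continuous_fun cf); exact: continuous_fst.
exact: strongly_measurable_cst.
Qed.

Lemma strongly_measurable_map (V X : normedModType R[i]) (F : V -> X) D f :
  continuous F -> strongly_measurable D f -> strongly_measurable D (fun t => F (f t)).
Proof.
move=> cF; apply: (@strongly_measurable_joint V X (fun p => F p.2)).
by apply: (continuous_fun cF); exact: continuous_snd.
Qed.

Lemma strongly_measurableD (V : normedModType R[i]) D (f g : R -> V) :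
  strongly_measurable D f -> strongly_measurable D g ->
  strongly_measurable D (fun t => f t + g t).
Proof.
apply: (@strongly_measurable_comp V V V (fun p => p.2.1 + p.2.2)) => p.
have c2 := @continuous_snd R (V * V)%type.
have c1 := continuous_fun (@continuous_fst V V) c2.
have c3 := continuous_fun (@continuous_snd V V) c2.
exact: (cvgD (c1 p) (c3 p)).
Qed.

Lemma strongly_measurableN (V : normedModType R[i]) D (f : R -> V) :
  strongly_measurable D f -> strongly_measurable D (fun t => - f t).
Proof. by apply: strongly_measurable_map; exact: opp_continuous. Qed.

Lemma strongly_measurable_indic (V : normedModType R[i]) D E (f : R -> V) :
  measurable E -> strongly_measurable D f ->
  strongly_measurable D (fun t => if t \in E then f t else 0).
Proof.
move=> mE [s [ss sf]]; exists (fun n t => if t \in E then s n t else 0); split.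
  by move=> n; exact: (simple2 (fun (b : bool) v => if b then v else 0) (simple_mem mE) (ss n)).
by move=> t Dt; case: ifP => _; [exact: sf|exact: cvg_cst].
Qed.

Lemma strongly_measurable_subset (V : normedModType R[i]) D E (f : R -> V) :
  E `<=` D -> strongly_measurable D f -> strongly_measurable E f.
Proof. by move=> ED [s [ss sf]]; exists s; split => // t /ED; exact: sf. Qed.

Lemma strongly_measurable_eq (V : normedModType R[i]) D (f g : R -> V) :
  (forall t, D t -> f t = g t) -> strongly_measurable D f -> strongly_measurable D g.
Proof. by move=> fg [s [ss sf]]; exists s; split => // t Dt; rewrite -fg//; exact: sf. Qed.

Lemma measurable_rdot (V : hilbertType R) D (f g : R -> V) : measurable D ->
  strongly_measurable D f -> strongly_measurable D g ->
  measurable_fun D (fun t => rdot (f t) (g t)).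
Proof.
move=> mD [s [ss sf]] [r [rs rg]].
apply: (@measurable_fun_cvg _ _ _ D (fun n t => rdot (s n t) (r n t))).
  by move=> n; apply: simple_measurable => //; exact: (simple2 (@rdot _ _) (ss n) (rs n)).
by move=> t Dt; apply: cvg_rdot; [exact: sf|exact: rg].
Qed.

Lemma cvg_rnorm_to (T : Type) (F : set_system T) {FF : Filter F}
    (V : normedModType R[i]) (f : T -> V) (l : V) :
  f @ F --> l -> (fun t => rnorm (f t)) @ F --> rnorm l.
Proof.
move=> /cvg_rnorm/cvgrPdist_lt fl; apply/cvgrPdist_lt => e e0.
apply: filterS (fl _ e0) => t; rewrite sub0r normrN ger0_norm// => h.
apply: le_lt_trans h; rewrite ler_norml; apply/andP; split.
  by have := rnormB (f t - l) (- l); rewrite opprK subrK rnormN; lra.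
by have := rnormB (f t) (f t - l); rewrite subKr; lra.
Qed.

Lemma measurable_rnorm (V : normedModType R[i]) D (f : R -> V) : measurable D ->
  strongly_measurable D f -> measurable_fun D (fun t => rnorm (f t)).
Proof.
move=> mD [s [ss sf]].
apply: (@measurable_fun_cvg _ _ _ D (fun n t => rnorm (s n t))).
  by move=> n; apply: simple_measurable => //; exact: (simple1 _ (ss n)).
by move=> t Dt; apply: cvg_rnorm_to; exact: sf.
Qed.

End StrongMeasurability.

(** * Integrable vector functions and integrals of simple functions *)

Section Bochner.
Variable (R : realType).
Implicit Types (D E : set R).
Local Notation mu := (@lebesgue_measure R).
Local Notation integ D h := (mu.-integrable D (EFin \o h)).

Lemma integ_le D (h k : R -> R) : measurable D -> measurable_fun D h ->
  (forall t, D t -> `|h t| <= k t) -> integ D k -> integ D h.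
Proof.
move=> mD mh hk; apply: le_integrable => //; first exact/measurable_EFinP.
by move=> t Dt /=; rewrite lee_fin (le_trans (hk _ Dt))// ler_norm.
Qed.

Lemma integ_measurable D (h : R -> R) : integ D h -> measurable_fun D h.
Proof. by move=> /integrableP[/measurable_EFinP]. Qed.

Lemma integD D (h k : R -> R) : measurable D -> integ D h -> integ D k ->
  integ D (fun t => h t + k t).
Proof. by move=> mD ih ik; exact: (@integrableD _ _ _ mu D mD _ _ ih ik). Qed.

Lemma integB D (h k : R -> R) : measurable D -> integ D h -> integ D k ->
  integ D (fun t => h t - k t).
Proof. by move=> mD ih ik; exact: (@integrableB _ _ _ mu D mD _ _ ih ik). Qed.

Lemma integZ D c (h : R -> R) : measurable D -> integ D h -> integ D (fun t => c * h t).
Proof. by move=> mD ih; exact: (@integrableZl _ _ _ mu D mD c _ ih). Qed.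

Lemma integ_cst D c : measurable D -> (mu D < +oo)%E -> integ D (fun=> c).
Proof.
move=> mD fD.
apply: (@measurable_bounded_integrable _ _ _ mu (fun=> c) D mD fD) => //.
by exists `|c|; split; [exact: num_real|move=> x hx t _ /=; exact: ltW].
Qed.

Lemma integ_eq D (h k : R -> R) : measurable D -> (forall t, D t -> h t = k t) -> integ D h -> integ D k.
Proof.
move=> mD hk; apply: (@eq_integrable _ _ _ mu D mD) => t Dt /=.
by rewrite hk //; apply: set_mem.
Qed.

Definition L1 (V : normedModType R[i]) D (f : R -> V) : Prop :=
  strongly_measurable D f /\ integ D (fun t => rnorm (f t)).

Lemma L1_le (V : normedModType R[i]) D (f : R -> V) (h : R -> R) : measurable D ->
  strongly_measurable D f -> (forall t, D t -> rnorm (f t) <= h t) -> integ D h -> L1 D f.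
Proof.
move=> mD mf fh ih; split => //; apply: integ_le ih => //; first exact: measurable_rnorm.
by move=> t Dt; rewrite ger0_norm// fh.
Qed.

Lemma L1D (V : normedModType R[i]) D (f g : R -> V) : measurable D -> L1 D f -> L1 D g ->
  L1 D (fun t => f t + g t).
Proof.
move=> mD [mf lf] [mg lg]; apply: (L1_le mD _ _ (integD mD lf lg)).
  exact: strongly_measurableD.
by move=> t _; exact: rnormD.
Qed.

Lemma L1N (V : normedModType R[i]) D (f : R -> V) : measurable D -> L1 D f ->
  L1 D (fun t => - f t).
Proof.
move=> mD [mf lf]; apply: (L1_le mD _ _ lf); first exact: strongly_measurableN.
by move=> t _; rewrite rnormN.
Qed.

Lemma L1B (V : normedModType R[i]) D (f g : R -> V) : measurable D -> L1 D f -> L1 D g ->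
  L1 D (fun t => f t - g t).
Proof. by move=> mD lf lg; apply: L1D => //; exact: L1N. Qed.

Lemma bop_continuous (V W : hilbertType R) (F : V -> W) : bop F -> continuous F.
Proof. by move=> bF x; exact: (bop_cvg bF). Qed.

Lemma L1_bop (V W : hilbertType R) (F : V -> W) D f : measurable D -> bop F ->
  L1 D f -> L1 D (fun t => F (f t)).
Proof.
move=> mD bF [mf lf]; have [_ _ [M M0 hM]] := bF.
apply: (L1_le mD _ _ (integZ M mD lf)) => [|t _]; last exact: hM.
by apply: strongly_measurable_map => //; exact: bop_continuous.
Qed.

Lemma L1_eq (V : normedModType R[i]) D (f g : R -> V) : measurable D ->
  (forall t, D t -> f t = g t) -> L1 D f -> L1 D g.
Proof.
move=> mD fg [mf lf]; split; first exact: strongly_measurable_eq mf.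
by apply: (integ_eq mD) lf => t Dt; rewrite fg.
Qed.

Lemma L1_subset (V : normedModType R[i]) D E (f : R -> V) : measurable D -> measurable E ->
  E `<=` D -> L1 D f -> L1 E f.
Proof.
move=> mD mE ED [mf lf]; split; first exact: strongly_measurable_subset mf.
exact: integrableS lf.
Qed.

Lemma integ_rdot (V : hilbertType R) D (f g : R -> V) c : measurable D -> L1 D f ->
  strongly_measurable D g -> (forall t, D t -> rnorm (g t) <= c) ->
  integ D (fun t => rdot (f t) (g t)).
Proof.
move=> mD [mf lf] mg gc; apply: (integ_le mD _ _ (integZ c mD lf)).
  exact: measurable_rdot.
move=> t Dt; rewrite (le_trans (abs_rdot_le _ _))// mulrC ler_wpM2r//.
exact: gc.
Qed.

Lemma integ_rdotl (V : hilbertType R) D (f : R -> V) y : measurable D -> L1 D f ->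
  integ D (fun t => rdot (f t) y).
Proof.
move=> mD lf; apply: (@integ_rdot V D f (fun=> y) (rnorm y)) => //.
exact: strongly_measurable_cst.
Qed.

Lemma simple_bounded (V : normedModType R[i]) (s : R -> V) : simple s ->
  exists2 c, 0 <= c & forall t, rnorm (s t) <= c.
Proof.
move=> [fs _]; exists (\sum_(v <- fset_set (range s)) rnorm v); first exact: sumr_ge0.
move=> t; have st : s t \in fset_set (range s).
  by rewrite in_fset_set//; apply: mem_set; exists t.
by rewrite (big_fsetD1 _ st)/= lerDl sumr_ge0.
Qed.

Lemma simple_L1 (V : normedModType R[i]) D (s : R -> V) : measurable D ->
  (mu D < +oo)%E -> simple s -> L1 D s.
Proof.
move=> mD fD ss; have [c c0 sc] := simple_bounded ss.
apply: (L1_le mD _ _ (integ_cst c mD fD)) => [|t _]; last exact: sc.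
by exists (fun=> s); split => // t _; exact: cvg_cst.
Qed.

Lemma rdot_simple_integral (V : hilbertType R) D (s : R -> V) y : measurable D ->
  (mu D < +oo)%E -> simple s ->
  rdot (simple_integral D s) y = \int[mu]_(t in D) rdot (s t) y.
Proof.
move=> mD fD ss; have [fs ms] := ss.
rewrite /simple_integral fsbig_finite//=; set F := fset_set _.
have piece v : (\int[mu]_(t in D) (rdot v y * \1_(s @^-1` [set v]) t)%:E)%E =
    (rdot v y * fine (mu (D `&` s @^-1` [set v])))%:E.
  have mI : measurable (D `&` s @^-1` [set v]) by exact: measurableI.
  have fin : mu (D `&` s @^-1` [set v]) \is a fin_num.
    rewrite ge0_fin_numE// (le_lt_trans _ fD)//.
    by apply: (@le_measure _ _ _ mu); [exact: mem_set|exact: mem_set|exact: subIsetl].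
  under eq_integral do rewrite EFinM.
  rewrite integralZl//; last first.
    have mi : measurable_fun D (\1_(s @^-1` [set v]) : R -> R) by exact: measurable_indic.
    apply: (integ_le mD mi _ (integ_cst 1 mD fD)).
    by move=> t _; rewrite ger0_norm indicE//; case: (_ \in _).
  rewrite (@integral_indic _ _ _ mu D mD _ (ms v)) setIC.
  by rewrite EFinM fineK.
rewrite /Rintegral.
(* s is the sum of its values times the indicators of its level sets; at t only the term v = s t
   survives. *)
have -> : (\int[mu]_(t in D) (rdot (s t) y)%:E)%E =
    (\int[mu]_(t in D) (\sum_(v <- F) (rdot v y * \1_(s @^-1` [set v]) t)%:E))%E.
  apply: eq_integral => t _; rewrite sumEFin; congr (_%:E).
  have st : s t \in F by rewrite in_fset_set//; apply: mem_set; exists t.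
  rewrite (big_fsetD1 _ st)/= indicE mem_set// mulr1 big_seq big1 ?addr0// => v.
  rewrite in_fsetD1 => /andP[vs _]; rewrite indicE memNset ?mulr0// => /= h.
  by rewrite h eqxx in vs.
rewrite integral_sum//; last first.
  move=> v; apply: (@integ_le _ _ (fun=> `|rdot v y|)) (integ_cst _ mD fD) => //.
    by apply: measurable_funM => //; exact: measurable_indic.
  move=> t _; rewrite normrM ler_piMr// ger0_norm indicE//; case: (_ \in _) => //.
rewrite (eq_bigr (fun v => (rdot v y * fine (mu (D `&` s @^-1` [set v])))%:E)); last first.
  by move=> v _; exact: piece.
rewrite sumEFin /=.
rewrite (big_morph (fun x => rdot x y) (id1 := 0) (op1 := +%R)); last exact: rdot0l.
  by apply: eq_bigr => v _; rewrite rdotZl mulrC.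
by move=> a b; exact: rdotDl.
Qed.

Lemma simple_integral_approx (V : hilbertType R) D (f s : R -> V) y : measurable D ->
  (mu D < +oo)%E -> simple s -> L1 D f ->
  `|rdot (simple_integral D s) y - \int[mu]_(t in D) rdot (f t) y|
    <= (\int[mu]_(t in D) rnorm (f t - s t)) * rnorm y.
Proof.
move=> mD fD ss lf; have ls := simple_L1 mD fD ss.
rewrite rdot_simple_integral// -RintegralB//; [|exact: integ_rdotl..].
apply: (le_trans (le_normr_Rintegral _ _)) => //.
  by apply: integB => //; exact: integ_rdotl.
have [_ li] := L1B mD lf ls.
rewrite mulrC -RintegralZl//; apply: le_Rintegral => //.
- apply: integrable_norm.
  by apply: integB => //; exact: integ_rdotl.
- exact: integZ.
move=> t _ /=; rewrite -rdotBl (le_trans (abs_rdot_le _ _))// mulrC.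
by rewrite rnorm_distC.
Qed.

End Bochner.

(** * Existence of the Bochner integral and its weak characterization *)

Section BochnerIntegral.
Variable (R : realType).
Implicit Types (D E : set R).
Local Notation mu := (@lebesgue_measure R).
Local Notation integ D h := (mu.-integrable D (EFin \o h)).

Lemma EFin_Rintegral D (h : R -> R) : measurable D -> integ D h ->
  (\int[mu]_(t in D) (h t)%:E)%E = (\int[mu]_(t in D) h t)%:E.
Proof.
by move=> mD ih; rewrite fineK//; exact: (@integrable_fin_num _ _ _ mu D mD _ ih).
Qed.

Lemma simple_measurable_strong (V : normedModType R[i]) D (s : R -> V) :
  simple s -> strongly_measurable D s.
Proof. by move=> ss; exists (fun=> s); split => // t _; exact: cvg_cst. Qed.

(** Integrability of f comes from a single approximation at finite L^1 distance. The tested identity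
    is the limit of [simple_integral_approx]. *)
Lemma bochner_integral_weak (V : hilbertType R) D (f : R -> V) I : measurable D ->
  (mu D < +oo)%E -> is_bochner_integral D f I ->
  L1 D f /\ forall y, rdot I y = \int[mu]_(t in D) rdot (f t) y.
Proof.
move=> mD fD [mf [s [ss sf sI]]].
have mfs n : measurable_fun D (fun t => rnorm (f t - s n t)).
  apply: measurable_rnorm => //; apply: strongly_measurableD => //.
  by apply: strongly_measurableN; exact: (simple_measurable_strong _ (ss n)).
have lf : L1 D f.
  have /fine_cvgP[[N _ hN] _] := sf.
  have i1 : integ D (fun t => rnorm (f t - s N t)).
    apply/integrableP; split; first by apply/measurable_EFinP; exact: mfs.
    rewrite (_ : integral _ _ _ = \int[mu]_(t in D) (rnorm (f t - s N t))%:E)%E.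
      by move: (hN N (leqnn N)); rewrite fin_numElt => /andP[].
    by apply: eq_integral => t _ /=; rewrite ger0_norm.
  have [_ i2] := simple_L1 mD fD (ss N).
  apply: (L1_le mD mf _ (integD mD i1 i2)) => t _ /=.
  by rewrite -[X in rnorm X <= _](subrK (s N t)) rnormD.
split => // y; apply/eqP; rewrite -subr_eq0 -normr_eq0; apply/eqP.
apply/eqP; rewrite eq_le normr_ge0 andbT.
set J := \int[mu]_(t in D) _.
have c1 : (fun n => `|rdot (simple_integral D (s n)) y - J|) @ \oo --> `|rdot I y - J|.
  exact: cvg_norm (cvgB (cvg_rdot sI (cvg_cst y)) (cvg_cst J)).
have c2 : (fun n => (\int[mu]_(t in D) rnorm (f t - s n t)) * rnorm y) @ \oo --> 0 * rnorm y.
  exact: cvgM (fine_cvg sf) (cvg_cst _).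
rewrite -(mul0r (rnorm y)); apply: (ler_cvg_to c1 c2).
by apply: nearW => n; exact: (simple_integral_approx y mD fD (ss n) lf).
Qed.

Lemma bochner_integral_exists (V : hilbertType R) D (f : R -> V) : measurable D ->
  (mu D < +oo)%E -> L1 D f -> exists I, is_bochner_integral D f I.
Proof.
move=> mD fD [mf lf]; have [s [ss sf]] := mf.
(* The approximation is cut to 0 where |s n| > 2 |f|. Off this set |f - s n| <= 3 |f|; on it |f| <
   |f - s n|. Hence the truncation [r n] still converges to f and is dominated by 3 |f|. *)
pose En n := D `&` (fun t => 2 * rnorm (f t) - rnorm (s n t)) @^-1` `[0, +oo[.
have mE n : measurable (En n).
  have h : measurable_fun D (fun t => 2 * rnorm (f t) - rnorm (s n t)).
    apply: measurable_funB; first by apply: measurable_funM => //; exact: measurable_rnorm.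
    by apply: measurable_rnorm => //; exact: (simple_measurable_strong _ (ss n)).
  exact: (h mD _ (measurable_itv _)).
pose r n t := if t \in En n then s n t else 0.
have sr n : simple (r n).
  exact: (simple2 (fun (b : bool) v => if b then v else 0) (simple_mem (mE n)) (ss n)).
have rle n t : D t -> rnorm (f t - r n t) <= rnorm (f t - s n t) /\
    rnorm (f t - r n t) <= 3 * rnorm (f t).
  move=> Dt; rewrite /r; case: ifPn => [|/negP] tE.
    split => //; have := rnormB (f t) (s n t).
    by move/set_mem : tE => [_]; rewrite /= in_itv/= andbT; lra.
  rewrite subr0; have : rnorm (s n t) > 2 * rnorm (f t).
    rewrite ltNge; apply/negP => h; apply: tE; apply: mem_set; split => //=.
    by rewrite in_itv/= andbT subr_ge0.
  have := rnormB (f t) (f t - s n t); rewrite subKr.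
  by have := rnorm_ge0 (f t); split; lra.
have mfr n : measurable_fun D (fun t => rnorm (f t - r n t)).
  apply: measurable_rnorm => //; apply: strongly_measurableD => //.
  by apply: strongly_measurableN; exact: (simple_measurable_strong _ (sr n)).
have lfr n : integ D (fun t => rnorm (f t - r n t)).
  apply: (integ_le mD (mfr n) _ (integZ 3 mD lf)) => t Dt.
  by rewrite ger0_norm//; case: (rle n t Dt).
have cvr : (fun n => (\int[mu]_(t in D) (rnorm (f t - r n t))%:E)%E) @ \oo --> 0%E.
  have [|||||_ _ +] := @dominated_convergence _ _ _ mu D mD
      (fun n t => (rnorm (f t - r n t))%:E) (cst 0%E) (fun t => (3 * rnorm (f t))%:E).
  - by move=> n; apply/measurable_EFinP; exact: mfr.
  - exact: measurable_cst.
  - apply: aeW => t Dt; apply: cvg_EFin; first exact: nearW.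
    apply: (@squeeze_cvgr _ _ _ _ (cst 0) (fun n => rnorm (f t - s n t))).
    + by apply: nearW => n /=; rewrite rnorm_ge0; case: (rle n t Dt).
    + exact: cvg_cst.
    + rewrite (_ : (fun n => _) = (fun n => rnorm (s n t - f t))).
        by apply/cvg_rnorm; exact: sf.
      by apply/funext => n; rewrite rnorm_distC.
  - exact: integZ.
  - apply: aeW => t n Dt; rewrite gee0_abs ?lee_fin//.
    by case: (rle n t Dt).
  - by rewrite integral0; apply.
have cvr' : (fun n => \int[mu]_(t in D) rnorm (f t - r n t)) @ \oo --> (0 : R).
  exact: fine_cvg cvr.
(* The integrals are Cauchy by duality: tested against y, each is within e / 2 times |y| of the same
   number. *)
have [I hI] : exists I : V, simple_integral D (r n) @[n --> \oo] --> I.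
  apply: complete_rnorm => e e0.
  have e2 : 0 < e / 2 by rewrite divr_gt0.
  have /cvgrPdist_lt /(_ _ e2) [N _ hN] := cvr'.
  exists N => n k Nn Nk.
  pose a n := \int[mu]_(t in D) rnorm (f t - r n t).
  have a0 m : 0 <= a m by apply: Rintegral_ge0.
  have ale m : (N <= m)%N -> a m < e / 2.
    by move=> /hN; rewrite sub0r normrN ger0_norm//; exact: a0.
  apply: (@le_lt_trans _ _ (a n + a k)); last by have := ale _ Nn; have := ale _ Nk; lra.
  apply: rnorm_le_dual; first by rewrite addr_ge0.
  move=> y; rewrite rdotBl.
  have := @simple_integral_approx _ _ D f (r n) y mD fD (sr n) (conj mf lf).
  have := @simple_integral_approx _ _ D f (r k) y mD fD (sr k) (conj mf lf).
  rewrite -/(a n) -/(a k) !ler_norml => /andP[h1 _] /andP[_ h2]; lra.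
by exists I; split => //; exists r; split.
Qed.

(** Some Bochner integral exists, and the tested identity forces I to be that one. *)
Lemma is_bochner_integralP (V : hilbertType R) D (f : R -> V) I : measurable D ->
  (mu D < +oo)%E -> L1 D f ->
  (forall y, rdot I y = \int[mu]_(t in D) rdot (f t) y) -> is_bochner_integral D f I.
Proof.
move=> mD fD lf wI; have [J hJ] := bochner_integral_exists mD fD lf.
suff -> : I = J by [].
by apply: rdot_inj => y; rewrite wI; have [_ ->] := bochner_integral_weak mD fD hJ.
Qed.

End BochnerIntegral.

(** * Strongly continuous families and semigroups *)

Section OperatorFamilies.
Variable (R : realType).
Implicit Types (V W X : hilbertType R).

Definition sfam V W (T : R -> V -> W) : Prop :=
  (forall t, bop (T t)) /\ forall x, continuous (fun t => T t x).

Lemma continuous_bounded_itv V (f : R -> V) a b : continuous f ->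
  exists2 M, 0 <= M & forall t, t \in `[a, b] -> rnorm (f t) <= M.
Proof.
move=> cf; have [ab|ba] := leP a b; last first.
  by exists 0 => // t; rewrite in_itv/= => /andP[at_ tb]; have := le_trans at_ tb; rewrite leNgt ba.
have crf : continuous (fun t => rnorm (f t)) by move=> t; exact: cvg_rnorm_to (cf t).
have [c _ hc] := @EVT_max R (fun t => rnorm (f t)) a b ab (continuous_subspaceT crf).
by exists (rnorm (f c)).
Qed.

(** Orbits are bounded on a compact interval, so uniform boundedness applies; off [a, b] the family
    is replaced by 0. *)
Lemma sfam_bound V W (T : R -> V -> W) a b : sfam T ->
  exists2 M, 0 <= M & forall t x, t \in `[a, b] -> rnorm (T t x) <= M * rnorm x.
Proof.
move=> [bT cT].
have [|x|M M0 hM] := @uniform_boundedness R V W R (fun t => if t \in `[a, b] then T t else fun=> 0).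
- move=> t; case: ifP => // _; split => //.
  + by move=> x y; rewrite addr0.
  + by move=> c x; rewrite rscale0r.
  + by exists 0 => // x; rewrite rnorm0 mul0r.
- have [M M0 hM] := continuous_bounded_itv a b (cT x).
  by exists M => t; case: ifP => [/hM//|_]; rewrite rnorm0.
- by exists M => // t x tab; have := hM t x; rewrite tab.
Qed.

(** The local uniform bound controls T t' (x' - x), and strong continuity controls T t' x - T t
    x. *)
Lemma sfam_joint V W (T : R -> V -> W) : sfam T -> continuous (fun p : R * V => T p.1 p.2).
Proof.
move=> sT [t x]; have [bT cT] := sT.
have [M M0 hM] := sfam_bound (t - 1) (t + 1) sT.
apply: (@cvg_rnorm_le R _ _ _ _ _ _
  (fun p : R * V => M * rnorm (p.2 - x) + rnorm (T p.1 x - T t x))) => /=.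
  have h1 : \forall p \near (t, x), p.1 \in `[t - 1, t + 1].
    have h : \forall t' \near t, t' \in `[t - 1, t + 1].
      near=> t'; rewrite in_itv/= lerBlDl.
      have : `|t - t'| <= 1 by near: t'; exact: cvgr_dist_le.
      by rewrite ler_norml => /andP[h1 h2]; apply/andP; split; lra.
    exact: (@continuous_fst R V (t, x) _ h).
  apply: filterS h1 => -[t' x'] /= ht.
  have -> : T t' x' - T t x = T t' (x' - x) + (T t' x - T t x).
    by rewrite (bopB (bT t')) addrA subrK.
  by rewrite (le_trans (rnormD _ _))// lerD// hM.
have c1 : (fun p : R * V => rnorm (p.2 - x)) @ (t, x) --> (0 : R).
  by apply/cvg_rnorm; exact: (@continuous_snd R V (t, x)).
have c2 : (fun p : R * V => rnorm (T p.1 x - T t x)) @ (t, x) --> (0 : R).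
  apply/cvg_rnorm; exact: (cvg_continuous (cT x) (@continuous_fst R V (t, x))).
rewrite -[X in _ --> X](addr0 0) -[X in _ --> X + _](mulr0 M).
by apply: cvgD c2; apply: cvgM c1; exact: cvg_cst.
Unshelve. all: by end_near. Qed.

Lemma sfam_cont V W (X : topologicalType) (T : R -> V -> W) (phi : X -> R) (f : X -> V) :
  sfam T -> continuous phi -> continuous f -> continuous (fun x => T (phi x) (f x)).
Proof.
by move=> /sfam_joint cT cphi cf; exact: (continuous_fun cT (continuous_pair cphi cf)).
Qed.

Lemma sfam_cvg V W (T : R -> V -> W) (I : Type) (F : set_system I) {FF : Filter F}
    (phi : I -> R) (f : I -> V) t x : sfam T -> phi @ F --> t -> f @ F --> x ->
  (fun i => T (phi i) (f i)) @ F --> T t x.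
Proof. by move=> /sfam_joint cT cphi cf; exact: (cvg_continuous cT (cvg_pairT cphi cf)). Qed.

End OperatorFamilies.

(** * Local boundedness and strong continuity of semigroups *)

Section Semigroup.
Variables (R : realType) (H : hilbertType R).
Implicit Types (S : R -> {bounded H -> H}) (T : R -> H -> H).

(* Freezing the family at negative times makes it strongly continuous on the
   whole real line, so that no one-sided limits are needed. *)
Definition posfam (V W : hilbertType R) (S : R -> {bounded V -> W}) (t : R) : V -> W :=
  S (Num.max 0 t).

Lemma posfamE (V W : hilbertType R) (S : R -> {bounded V -> W}) t x :
  0 <= t -> posfam S t x = S t x.
Proof. by move=> t0; rewrite /posfam max_r. Qed.

Lemma C0_right S x e : C0_semigroup S -> 0 < e ->
  exists2 d, 0 < d & forall h, 0 <= h -> h < d -> rnorm (S h x - x) < e.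
Proof.
move=> [S0 _ Sr] e0; have /cvg_rnorm/cvgrPdist_lt /(_ _ e0) := Sr x.
rewrite near_withinE => /nbhs_normP[d /= d0 hd]; exists d => // h h0 hdl.
have [->|hn] := eqVneq h 0; first by rewrite S0 subrr rnorm0.
have h1 : 0 < h by rewrite lt_def hn.
have := hd h; rewrite /= sub0r normrN gtr0_norm// => /(_ hdl h1).
by rewrite sub0r normrN ger0_norm.
Qed.

(** Otherwise there are times t n tending to 0 with operator norms above n + 1, although S (t n) x
    tends to x for every x; uniform boundedness excludes this. *)
Lemma C0_bounded_near0 S : C0_semigroup S ->
  exists2 d, 0 < d & exists2 M, 1 <= M & forall t x, 0 <= t -> t <= d -> rnorm (S t x) <= M * rnorm x.
Proof.
move=> cS; apply: contrapT => nU.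
have : forall n : nat, exists t, [/\ 0 <= t, t <= n.+1%:R^-1 &
    exists x, n.+1%:R * rnorm x < rnorm (S t x)].
  move=> n; apply: contrapT => nE; apply: nU.
  exists n.+1%:R^-1; first by rewrite invr_gt0.
  exists n.+1%:R; first by rewrite ler1n.
  move=> t x t0 tn; rewrite leNgt; apply/negP => h; apply: nE.
  by exists t; split => //; exists x.
move=> /choice[t ht].
have [|x|M M0 hM] := @uniform_boundedness R H H nat (fun n => S (t n)).
- by move=> n; exact: bounded_bop.
- have c : (fun n => rnorm (S (t n) x)) @ \oo --> rnorm x.
    apply: cvg_rnorm_to; apply/cvg_rnorm/cvgrPdist_lt => e e0.
    have [d d0 hd] := C0_right x cS e0.
    have := @cvg_harmonic R => /cvgrPdist_lt/(_ _ d0); apply: filterS => n.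
    rewrite sub0r normrN ger0_norm ?invr_ge0// => hn.
    have [tn0 tn _] := ht n.
    by rewrite sub0r normrN ger0_norm// hd// (le_lt_trans tn).
  have [M [_ hM]] := cvg_seq_bounded (cvgP _ c).
  exists (`|M| + 1) => n.
  have := hM (`|M| + 1); rewrite (le_lt_trans (ler_norm M)) ?ltrDl// => /(_ isT n I) /=.
  by rewrite ger0_norm//; exact: rnorm_ge0.
have [_ _ [x hx]] := ht (Num.bound M).
have := hM (Num.bound M) x; rewrite leNgt => /negP; apply.
apply: le_lt_trans hx; rewrite ler_wpM2r// ltW//.
by apply: (lt_trans (archi_boundP M0)); rewrite ltr_nat.
Qed.

Lemma C0_bounded S b : C0_semigroup S ->
  exists2 M, 0 <= M & forall t x, 0 <= t -> t <= b -> rnorm (S t x) <= M * rnorm x.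
Proof.
move=> cS; have [d d0 [M M1 hM]] := C0_bounded_near0 cS; have [_ SD _] := cS.
have M0 : 0 <= M by rewrite (le_trans _ M1).
(* Peeling off one step of length d costs one factor M; M >= 1 lets shorter times share the
   bound. *)
have hn n : forall t x, 0 <= t -> t <= n%:R * d -> rnorm (S t x) <= M ^+ n.+1 * rnorm x.
  elim: n => [|n IH] t x t0 tn.
    by rewrite expr1 hM// (le_trans tn)// mul0r ltW.
  have [td|dt] := leP t d.
    rewrite (le_trans (hM _ _ t0 td))// ler_wpM2r//.
    by rewrite exprS ler_peMr// exprn_ege1.
  have -> : t = d + (t - d) by rewrite addrC subrK.
  rewrite SD ?subr_ge0 ?(ltW d0) ?(ltW dt)// exprS -mulrA.
  rewrite (le_trans (hM _ _ (ltW d0) (lexx _)))// ler_wpM2l// IH ?subr_ge0 ?(ltW dt)//.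
  by move: tn; rewrite -natr1 mulrDl mul1r; lra.
exists (M ^+ (Num.bound (`|b| / d)).+1); first exact: exprn_ge0.
move=> t x t0 tb; apply: hn => //; rewrite (le_trans tb)// (le_trans (ler_norm b))//.
by rewrite -ler_pdivrMr// ltW// archi_boundP// divr_ge0// ltW.
Qed.

Lemma maxr0_continuous : continuous (Num.max 0 : R -> R).
Proof.
move=> t; apply/cvgrPdist_lt => e e0; near=> s.
have : `|t - s| < e by near: s; exact: cvgr_dist_lt.
rewrite !ltr_norml => /andP[h1 h2]; rewrite /Num.max; case: ifP => c1; case: ifP => c2; lra.
Unshelve. all: by end_near. Qed.

(** Right continuity at 0 suffices: for t <= s, S s x - S t x = S t (S (s - t) x - x), and the local
    bound makes the estimate symmetric in s and t. *)
Lemma posfam_sfam S : C0_semigroup S -> sfam (posfam S).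
Proof.
move=> cS; split; first by move=> t; exact: bounded_bop.
have [_ SD _] := cS.
have key x b e : 0 < e -> exists2 d, 0 < d & forall s t, 0 <= s -> s <= b -> 0 <= t -> t <= b ->
    `|s - t| < d -> rnorm (S s x - S t x) < e.
  move=> e0; have [M M0 hM] := C0_bounded b cS.
  have M1 : 0 < M + 1 by rewrite ltr_wpDl.
  have e1 : 0 < e / (M + 1) by rewrite divr_gt0.
  have [d d0 hd] := C0_right x cS e1; exists d => //.
  have wlog s t : 0 <= t -> t <= s -> t <= b -> `|s - t| < d -> rnorm (S s x - S t x) < e.
    move=> t0 ts tb; rewrite ger0_norm ?subr_ge0// => st.
    have -> : s = t + (s - t) by rewrite addrC subrK.
    rewrite SD ?subr_ge0// -(bopB (bounded_bop (S t))).
    have h := hd (s - t) ltac:(by rewrite subr_ge0) st.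
    rewrite (le_lt_trans (hM _ _ t0 tb))//.
    rewrite ltr_pdivlMr// in h; apply: le_lt_trans h.
    by rewrite mulrC ler_wpM2l// lerDl.
  move=> s t s0 sb t0 tb; have [ts|st] := leP t s; first exact: wlog.
  by rewrite rnorm_distC distrC; apply: wlog => //; exact: ltW.
move=> x t; apply/cvg_rnorm/cvgrPdist_lt => e e0.
have [d d0 hd] := key x (`|t| + 1) e e0.
have cm := @maxr0_continuous t.
near=> s; rewrite sub0r normrN ger0_norm//; apply: hd.
- by rewrite le_max lexx.
- rewrite ge_max; apply/andP; split; first by rewrite addr_ge0.
  have : `|t - s| < 1 by near: s; exact: cvgr_dist_lt.
  by rewrite ltr_norml => /andP[h1 h2]; have := ler_norm t; lra.
- by rewrite le_max lexx.
- by rewrite ge_max; apply/andP; split; [rewrite addr_ge0|rewrite (le_trans (ler_norm t))// lerDl].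
- by rewrite distrC; near: s; exact: (cvgr_dist_lt _ _ cm).
Unshelve. all: by end_near. Qed.

End Semigroup.

(** * The fundamental theorem of calculus and changes of variable *)

Section Calculus.
Variable (R : realType).
Implicit Types (V W : hilbertType R) (F f : R -> R) (a b c s t k l : R).
Local Notation mu := (@lebesgue_measure R).

Lemma cvg_near_eq (T : Type) (G : set_system T) {FG : Filter G} (X : topologicalType)
    (f g : T -> X) (l : X) :
  (\forall t \near G, f t = g t) -> f @ G --> l -> g @ G --> l.
Proof. by move=> fg; apply: cvg_trans; apply: near_eq_cvg. Qed.

Definition hasd (V : hilbertType R) (f : R -> V) (s : R) (l : V) : Prop :=
  (fun h => h^-1 **: (f (s + h) - f s)) @ 0^' --> l.

Definition hasdR (f : R -> R) (s l : R) : Prop :=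
  (fun h => h^-1 * (f (s + h) - f s)) @ 0^' --> l.

Lemma hasdR_derive F t l : hasdR F t l <->
  h^-1 *: (F (h *: (1 : R) + t) - F t) @[h --> 0^'] --> l.
Proof.
rewrite /hasdR (_ : (fun h => h^-1 * _) = (fun h => h^-1 *: (F (h *: (1 : R) + t) - F t)))//.
by apply/funext => h; rewrite [h *: (1 : R)]mulr1 [h + t]addrC.
Qed.

(** Differentiability is asked only inside the interval, because orbits are differentiated only at
    positive times; the degenerate interval is included. *)
Lemma ftc F f a b : a <= b -> continuous f ->
  (forall t, a <= t -> t <= b -> {for t, continuous F}) ->
  (forall t, a < t -> t < b -> hasdR F t (f t)) ->
  \int[mu]_(t in `[a, b]) f t = F b - F a.
Proof.
rewrite le_eqVlt => /predU1P[-> _ _ _|ab cf cF dF].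
  by rewrite set_itv1 Rintegral_set1 subrr.
rewrite /Rintegral (@continuous_FTC2 R f F a b ab).
- by rewrite -EFinB.
- exact: continuous_subspaceT.
- split.
  + move=> t; rewrite in_itv/= => /andP[h1 h2]; apply/cvg_ex; exists (f t).
    exact/hasdR_derive/dF.
  + by apply: cvg_at_right_filter; apply: cF => //; exact: ltW.
  + by apply: cvg_at_left_filter; apply: cF => //; exact: ltW.
- move=> t; rewrite in_itv/= => /andP[h1 h2]; rewrite derive1E /derive.
  by apply/cvg_lim => //; exact/hasdR_derive/dF.
Qed.

Lemma cvg_dnbhs0N : (fun h : R => - h) @ 0^' --> (0 : R)^'.
Proof.
move=> P; rewrite !near_simpl /dnbhs !near_withinE => /nbhs_normP[e /= e0 he].
apply/nbhs_normP; exists e => // h /=; rewrite sub0r normrN => hl hn.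
by apply: (he (- h)); rewrite /= ?sub0r ?opprK// oppr_eq0.
Qed.

Lemma hasdR_shift F t k l : hasdR F (t + k) l -> hasdR (fun t => F (t + k)) t l.
Proof. by rewrite /hasdR; under eq_fun do rewrite [t + _ + _]addrAC. Qed.

Lemma hasdR_reflect F c t l : hasdR F (c - t) l -> hasdR (fun t => F (c - t)) t (- l).
Proof.
move=> h; have h2 := cvg_comp _ _ cvg_dnbhs0N h.
apply: cvg_near_eq (cvgN h2); apply: nearW => u /=.
have -> : c - (t + u) = c - t - u by rewrite opprD addrA.
by rewrite -[LHS]/(- ((- u)^-1 * (F (c - t - u) - F (c - t)))) invrN mulNr opprK.
Qed.

Lemma antiderivative f a b : continuous f -> exists F,
  forall t, a <= t -> t <= b -> {for t, continuous F} /\ hasdR F t (f t).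
Proof.
(* Starting the integral at a - 1 makes a itself an interior point. *)
move=> cf; exists (fun x => \int[mu]_(t in `[a - 1, x]) f t) => t at_ tb.
have tb1 : t < b + 1 by rewrite (le_lt_trans tb)// ltrDl.
have i1 : mu.-integrable [set` Interval (BLeft (a - 1)) (BRight (b + 1))] (EFin \o f).
  apply: continuous_compact_integrable; first exact: segment_compact.
  exact: continuous_subspaceT.
have at1 : a - 1 < t by rewrite (lt_le_trans _ at_)// ltrBlDr ltrDl.
have [dF F'] := continuous_FTC1_closed tb1 i1 at1 (cf t).
split; first by apply: differentiable_continuous; exact/derivable1_diffP.
apply/hasdR_derive; rewrite -F' derive1E; exact: dF.
Qed.

Lemma Rintegral_shift f a b k : a <= b -> continuous f ->
  \int[mu]_(t in `[a, b]) f (t + k) = \int[mu]_(t in `[a + k, b + k]) f t.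
Proof.
move=> ab cf; have [F hF] := antiderivative (a + k) (b + k) cf.
have cs : continuous (fun t : R => t + k).
  by move=> t; apply: cvgD; [exact: cvg_id|exact: cvg_cst].
rewrite (@ftc F f)// ?lerD2r//; last by move=> t h1 h2; have [] := hF t (ltW h1) (ltW h2).
  rewrite (@ftc (fun t => F (t + k)) (fun t => f (t + k)))//.
  - exact: (continuous_fun cf cs).
  - move=> t h1 h2; have [c _] := hF (t + k) ltac:(by rewrite lerD2r) ltac:(by rewrite lerD2r).
    by apply: (@continuous_comp _ _ _ (fun t => t + k) F) => //; exact: cs.
  - move=> t h1 h2; apply: hasdR_shift.
    by have [] := hF (t + k) ltac:(by rewrite lerD2r ltW) ltac:(by rewrite lerD2r ltW).
by move=> t h1 h2; have [] := hF t h1 h2.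
Qed.

Lemma RintegralN (D : set R) f : measurable D -> mu.-integrable D (EFin \o f) ->
  \int[mu]_(t in D) - f t = - \int[mu]_(t in D) f t.
Proof.
move=> mD fi; rewrite -mulN1r -RintegralZl//; apply: eq_Rintegral => t _.
by rewrite mulN1r.
Qed.

Lemma Rintegral_reflect f a b c : a <= b -> continuous f ->
  \int[mu]_(t in `[a, b]) f (c - t) = \int[mu]_(t in `[c - b, c - a]) f t.
Proof.
move=> ab cf; have [F hF] := antiderivative (c - b) (c - a) cf.
have cc : continuous (fun t : R => c - t).
  by move=> t; apply: cvgB; [exact: cvg_cst|exact: cvg_id].
rewrite (@ftc F f)// ?lerB//; last by move=> t h1 h2; have [] := hF t (ltW h1) (ltW h2).
  have cf' : continuous (fun t => f (c - t)) by exact: (continuous_fun cf cc).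
  have -> : \int[mu]_(t in `[a, b]) f (c - t) = - \int[mu]_(t in `[a, b]) - f (c - t).
    have i : mu.-integrable `[a, b] (EFin \o (fun t => f (c - t))).
      by apply: continuous_compact_integrable; [exact: segment_compact|exact: continuous_subspaceT].
    by rewrite RintegralN// opprK.
  rewrite (@ftc (fun t => F (c - t)) (fun t => - f (c - t)))//.
  - by rewrite opprB.
  - by move=> t; apply: cvgN; exact: cf'.
  - move=> t h1 h2; have [ct _] := hF (c - t) ltac:(by rewrite lerB) ltac:(by rewrite lerB).
    by apply: (@continuous_comp _ _ _ (fun t => c - t) F) => //; exact: cc.
  - move=> t h1 h2; apply: hasdR_reflect.
    by have [] := hF (c - t) ltac:(by rewrite lerB// ltW) ltac:(by rewrite lerB// ltW).
by move=> t h1 h2; have [] := hF t h1 h2.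
Qed.

Lemma Rintegral_split f a b c : a <= b -> b <= c ->
  mu.-integrable `[a, c] (EFin \o f) ->
  \int[mu]_(t in `[a, c]) f t = \int[mu]_(t in `[a, b]) f t + \int[mu]_(t in `[b, c]) f t.
Proof.
move=> ab bc fi; rewrite -(@Rintegral_itv_obnd_cbnd _ b); last first.
  apply: integrableS fi => //.
  by apply: subset_itv; rewrite bnd_simp.
by rewrite -(@Rintegral_itvB _ f (BLeft a) (BRight c) b)// ?bnd_simp//; ring.
Qed.

Lemma continuous_integ f a b : continuous f -> mu.-integrable `[a, b] (EFin \o f).
Proof.
move=> cf; apply: continuous_compact_integrable; first exact: segment_compact.
exact: continuous_subspaceT.
Qed.

Lemma mu_itv a b : a <= b -> mu (`[a, b]%classic : set R) = (b - a)%:E.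
Proof.
move=> ab; rewrite lebesgue_measure_itv/= lte_fin; case: ltP => // ba.
by rewrite (_ : a = b) ?subrr//; apply: le_anti; rewrite ab ba.
Qed.

Lemma mu_itv_lty a b : (mu (`[a, b]%classic : set R) < +oo)%E.
Proof. by rewrite lebesgue_measure_itv; case: ifP => _; rewrite ?ltry. Qed.

End Calculus.

(** * Derivatives of orbits *)

Section SemigroupCalculus.
Variables (R : realType) (H : hilbertType R).
Implicit Types (T : R -> H -> H) (D : set H) (A : H -> H).
Local Notation mu := (@lebesgue_measure R).

Definition sgroup T : Prop :=
  [/\ sfam T, forall x, T 0 x = x
    & forall s t x, 0 <= s -> 0 <= t -> T (s + t) x = T s (T t x)].

Definition generator D A T : Prop := forall x l, D x /\ A x = l <->
  (fun h => h^-1 **: (T h x - x)) @ 0^'+ --> l.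

Lemma generates_sgroup D A (S : R -> {bounded H -> H}) : generates D A S ->
  sgroup (posfam S) /\ generator D A (posfam S).
Proof.
move=> [cS gS]; split.
  have [S0 SD _] := cS; split; first exact: posfam_sfam.
    by move=> x; rewrite posfamE.
  by move=> s t x s0 t0; rewrite !posfamE ?addr_ge0// SD.
move=> x l; rewrite gS.
have e : {near (0 : R)^'+, (fun h => ((h^-1)%:C)%C *: (S h x - x)) =1 (fun h => h^-1 **: (posfam S h x - x))}.
  rewrite near_withinE; apply: nearW => h h0; rewrite posfamE//; exact: ltW.
split; apply: cvg_near_eq => //.
by apply: filterS e => h ->.
Qed.

Lemma cvg_add0 (t : R) : (fun h : R => t + h) @ 0^' --> t.
Proof.
apply: cvg_within_filter; apply/cvgrPdist_lt => e e0; near=> h.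
by rewrite opprD addrA subrr; near: h; exact: cvgr_dist_lt.
Unshelve. all: by end_near. Qed.

Lemma cvg_dnbhs_sides (X : topologicalType) (f : R -> X) (p : R) (l : X) :
  f @ p^'+ --> l -> f @ p^'- --> l -> f @ p^' --> l.
Proof.
move=> fr fl P lP; have := fr P lP; have := fl P lP.
rewrite !near_simpl /dnbhs !near_withinE; apply: filterS2 => t h1 h2 tp.
by have [tp'|tp'] := ltP t p; [exact: h1|apply: h2; rewrite lt_def tp'; apply/andP; split=> //; apply/eqP].
Qed.

(** The right quotient is T t applied to the quotient at 0. The left one is T (t - h) applied to it,
    and converges by joint continuity. *)
Lemma sgroup_hasd T D A x t : sgroup T -> generator D A T -> D x -> 0 < t ->
  hasd (fun s => T s x) t (T t (A x)).
Proof.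
move=> [sT T0 TD] gT Dx t0; have [bT cT] := sT.
have gx : (fun h => h^-1 **: (T h x - x)) @ 0^'+ --> A x by apply/gT.
apply: cvg_dnbhs_sides.
  apply: cvg_near_eq (bop_cvg (bT t) gx); rewrite near_withinE; apply: nearW => h h0.
  by rewrite (bopZ (bT t)) (bopB (bT t)) TD// ltW.
apply/cvg_at_leftNP; rewrite oppr0.
have c1 : (fun h : R => t - h) @ 0^'+ --> t.
  apply: cvg_within_filter; apply/cvgrPdist_lt => e e0; near=> h.
  rewrite opprB addrC subrK -normrN -sub0r; near: h; exact: cvgr_dist_lt.
apply: cvg_near_eq (sfam_cvg sT c1 gx); rewrite near_withinE.
near=> h => h0 /=.
have ht : h <= t.
  have : `|0 - h| < t by near: h; exact: cvgr_dist_lt.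
  by rewrite sub0r normrN gtr0_norm// => /ltW.
rewrite (bopZ (bT _)) (bopB (bT _)) -TD ?subr_ge0// ?(ltW h0)// subrK.
by rewrite invrN /rscale rmorphN scaleNr -scalerN opprB.
Unshelve. all: by end_near. Qed.
End SemigroupCalculus.

(** * Density of the generator domain and adjoint semigroups *)

Section SemigroupAdjoint.
Variables (R : realType) (H : hilbertType R).
Implicit Types (T : R -> H -> H) (D : set H) (A : H -> H).
Local Notation mu := (@lebesgue_measure R).

Lemma sgroup_dom T D A x t : sgroup T -> generator D A T -> D x -> 0 <= t ->
  D (T t x) /\ A (T t x) = T t (A x).
Proof.
move=> [[bT _] _ TD] gT Dx t0; apply/gT.
have gx : (fun h => h^-1 **: (T h x - x)) @ 0^'+ --> A x by apply/gT.
apply: cvg_near_eq (bop_cvg (bT t) gx); rewrite near_withinE; apply: nearW => h h0.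
by rewrite (bopZ (bT t)) (bopB (bT t)) -(TD t h) ?(ltW h0)// [t + h]addrC TD// ltW.
Qed.

Lemma hasd_cvg (f : R -> H) s l : hasd f s l -> (fun h => f (s + h)) @ 0^' --> f s.
Proof.
move=> fl; have h0 : (fun h : R => h) @ 0^' --> (0 : R) by apply: cvg_within_filter; exact: cvg_id.
have : (fun h => h **: (h^-1 **: (f (s + h) - f s)) + f s) @ 0^' --> 0 **: l + f s.
  exact: cvgD (cvg_rscale h0 fl) (cvg_cst (f s)).
rewrite rscale0 add0r => c; apply: cvg_near_eq c; rewrite near_withinE; apply: nearW => h hn /=.
by rewrite rscaleA divff// rscale1 subrK.
Qed.

Lemma hasdR_rdot (f g : R -> H) s f' g' : hasd f s f' -> hasd g s g' ->
  hasdR (fun t => rdot (f t) (g t)) s (rdot f' (g s) + rdot (f s) g').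
Proof.
move=> hf hg; have cg := hasd_cvg hg.
apply: cvg_near_eq (cvgD (cvg_rdot hf cg) (cvg_rdot (cvg_cst (f s)) hg)).
apply: nearW => h.
rewrite [LHS](_ : _ = rdot (h^-1 **: (f (s + h) - f s)) (g (s + h)) +
  rdot (f s) (h^-1 **: (g (s + h) - g s)))// rdotZl rdotZr -mulrDr rdotBl rdotBr; congr (_ * _); ring.
Qed.

Lemma hasd_reflect (f : R -> H) c t l : hasd f (c - t) l -> hasd (fun t => f (c - t)) t (- l).
Proof.
move=> h; have h2 := cvg_comp _ _ (@cvg_dnbhs0N R) h.
apply: cvg_near_eq (cvgN h2); apply: nearW => u /=.
have -> : c - (t + u) = c - t - u by rewrite opprD addrA.
by rewrite -[LHS]/(- ((- u)^-1 **: (f (c - t - u) - f (c - t)))) invrN /rscale rmorphN scaleNr opprK.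
Qed.

Lemma hasd_shift (f : R -> H) c t l : hasd f (t - c) l -> hasd (fun t => f (t - c)) t l.
Proof. by rewrite /hasd; under eq_fun do rewrite [t - _ + _]addrAC. Qed.

Lemma hasd_cst (y : H) t : hasd (fun=> y) t 0.
Proof. by rewrite /hasd; under eq_fun do rewrite subrr rscale0r; exact: cvg_cst. Qed.

Lemma continuous_rdot (X : topologicalType) (f g : X -> H) :
  continuous f -> continuous g -> continuous (fun x => rdot (f x) (g x)).
Proof. by move=> cf cg x; exact: cvg_rdot (cf x) (cg x). Qed.

Lemma continuous_cstT (X Y : topologicalType) (y : Y) : continuous (fun _ : X => y).
Proof. by move=> x; exact: cvg_cst. Qed.

Lemma continuous_subl (c : R) : continuous (fun t : R => c - t).
Proof. by move=> t; apply: cvgB; [exact: cvg_cst|exact: cvg_id]. Qed.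

Lemma continuous_subr (c : R) : continuous (fun t : R => t - c).
Proof. by move=> t; apply: cvgB; [exact: cvg_id|exact: cvg_cst]. Qed.

Lemma sgroup_integral T D A y v t : sgroup T -> generator D A T -> D y -> 0 <= t ->
  \int[mu]_(s in `[0, t]) rdot (T s (A y)) v = rdot (T t y - y) v.
Proof.
move=> sgT gT Dy t0; have [[bT cT] T0 _] := sgT.
rewrite (@ftc R (fun s => rdot (T s y) v))//.
- by rewrite T0 rdotBl.
- by apply: continuous_rdot => //; exact: continuous_cstT.
- by move=> s _ _; apply: continuous_rdot => //; exact: continuous_cstT.
move=> s s0 _; have := hasdR_rdot (sgroup_hasd sgT gT Dy s0) (hasd_cst v s).
by rewrite rdot0r addr0.
Qed.

Let arith (a b p q h r n : R) : a - h * p <= h * (r / 2 * n) ->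
  - (h * (r / 2 * n)) <= b - h * q -> a - b - h * (p - q) <= h * (r * n).
Proof. lra. Qed.

(** The averages of T s x over [0, d] lie in D and tend to x as d tends to 0. *)
Lemma sgroup_dense T D A x e : sgroup T -> generator D A T -> 0 < e ->
  exists2 y, D y & rnorm (y - x) < e.
Proof.
move=> sgT gT e0; have [sT T0 TD] := sgT; have [bT cT] := sT.
have [d d0 hd] : exists2 d, 0 < d & forall s, 0 <= s -> s <= d -> rnorm (T s x - x) < e / 2.
  have := cT x 0 => /cvg_rnorm/cvgrPdist_lt /(_ (e / 2)); rewrite divr_gt0// => /(_ isT).
  move=> /nbhs_normP[d /= d0 hd]; exists (d / 2); first by rewrite divr_gt0.
  move=> s s0 sd; have := hd s; rewrite /= sub0r normrN ger0_norm// T0.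
  by rewrite sub0r normrN ger0_norm//; apply; lra.
have mI a b : measurable (`[a, b]%classic : set R) by exact: measurable_itv.
pose f y s := rdot (T s x) y.
have cf y : continuous (f y) by apply: continuous_rdot => //; exact: continuous_cstT.
have iT a b y := continuous_integ a b (cf y).
have [I hI] : exists I, is_bochner_integral `[0, d] (fun s => T s x) I.
  apply: bochner_integral_exists; [exact: mI|exact: mu_itv_lty|].
  split; first exact: strongly_measurable_continuous.
  by apply: continuous_integ => s; exact: cvg_rnorm_to (cT x s).
have [_ wI] := bochner_integral_weak (mI _ _) (mu_itv_lty _ _) hI.
(* An average stays within c of z, in tested form, when its integrand does. It is used at both ends
   of the window [0, d] and for the final estimate. *)
have bound a b y c z : a <= b -> (forall s, a <= s -> s <= b -> rnorm (T s x - z) <= c) ->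
    `|\int[mu]_(s in `[a, b]) f y s - (b - a) * rdot z y| <= (b - a) * (c * rnorm y).
  move=> ab hc.
  have cst (k : R) : (b - a) * k = \int[mu]_(s in `[a, b]) k.
    by rewrite Rintegral_cst// [X in fine X](mu_itv ab) mulrC.
  have icst (k : R) : mu.-integrable `[a, b] (EFin \o (fun=> k)).
    by apply: integ_cst; [exact: mI|exact: mu_itv_lty].
  rewrite !cst -RintegralB; [|exact: mI|exact: iT|exact: icst].
  have iB : mu.-integrable `[a, b] (EFin \o (fun s => f y s - rdot z y)).
    by apply: integB; [exact: mI|exact: iT|exact: icst].
  apply: le_trans (le_normr_Rintegral _ iB) _; first exact: mI.
  apply: le_Rintegral; [exact: mI|exact: integrable_norm|exact: icst|].
  move=> s; rewrite /= in_itv/= => /andP[s1 s2].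
  by rewrite -rdotBl (le_trans (abs_rdot_le _ _))// ler_wpM2r// hc.
have gI : (fun h => h^-1 **: (T h I - I)) @ 0^'+ --> T d x - x.
  apply/cvg_rnorm/cvgrPdist_le => r r0.
  have [q q0 hq] : exists2 q, 0 < q & forall s, 0 <= s -> s <= q ->
      rnorm (T s x - x) <= r / 2 /\ rnorm (T (d + s) x - T d x) <= r / 2.
    have r2 : 0 < r / 2 by rewrite divr_gt0.
    have := cT x 0 => /cvg_rnorm/cvgrPdist_le /(_ _ r2)/nbhs_normP[q1 /= q10 h1].
    have := cT x d => /cvg_rnorm/cvgrPdist_le /(_ _ r2)/nbhs_normP[q2 /= q20 h2].
    exists (Num.min q1 q2 / 2); first by rewrite divr_gt0// lt_min q10.
    move=> s s0; rewrite ler_pdivlMr// le_min => /andP[sq1 sq2]; split.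
      have := h1 s; rewrite /= !sub0r !normrN !ger0_norm// T0; apply.
      by have [->|sn] := eqVneq s 0; [exact: q10|have : 0 < s by rewrite lt_def sn]; lra.
    have := h2 (d + s); rewrite /= opprD addrA subrr !sub0r !normrN !ger0_norm//; apply.
    by have [->|sn] := eqVneq s 0; [exact: q20|have : 0 < s by rewrite lt_def sn]; lra.
  rewrite near_withinE; near=> h => h0.
  have hq' : h <= q.
    have : `|0 - h| < q by near: h; exact: cvgr_dist_lt.
    by rewrite sub0r normrN gtr0_norm// => /ltW.
  rewrite sub0r normrN ger0_norm//; apply: rnorm_le_dual; first exact: ltW.
  move=> y.
  have e1 : rdot (T h I) y = \int[mu]_(s in `[h, d + h]) f y s.
    have [y' hy'] := bop_dual y (bT h).
    transitivity (\int[mu]_(s in `[0, d]) f y (s + h)); last first.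
      by rewrite (Rintegral_shift h (ltW d0) (cf y)) add0r.
    rewrite hy' wI; apply: eq_Rintegral => s /set_mem; rewrite /= in_itv/= => /andP[s0 _].
    by rewrite -hy' -TD ?(ltW h0)// addrC.
  (* T h shifts the window of integration by h, so only the two end pieces remain; divided by h they
     tend to T d x and x. *)
  have e2 : rdot (T h I - I) y =
      \int[mu]_(s in `[d, d + h]) f y s - \int[mu]_(s in `[0, h]) f y s.
    rewrite rdotBl e1 wI -/(f y).
    have := @Rintegral_split R (f y) 0 h (d + h) (ltW h0) ltac:(by rewrite lerDr ltW) (iT _ _ _).
    rewrite (@Rintegral_split R (f y) 0 d (d + h) (ltW d0) ltac:(by rewrite lerDl ltW) (iT _ _ _)).
    by rewrite /f; lra.
  have b1 : `|\int[mu]_(s in `[d, d + h]) f y s - h * rdot (T d x) y| <= h * (r / 2 * rnorm y).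
    have := @bound d (d + h) y (r / 2) (T d x); rewrite [d + h]addrC addrK [h + d]addrC; apply.
      by rewrite lerDl ltW.
    move=> s s1 s2; have -> : s = d + (s - d) by rewrite addrC subrK.
    by have [||_] := hq (s - d) => //; lra.
  have b2 : `|\int[mu]_(s in `[0, h]) f y s - h * rdot x y| <= h * (r / 2 * rnorm y).
    have := @bound 0 h y (r / 2) x (ltW h0); rewrite subr0; apply => s s1 s2.
    by have [|] := hq s s1 => //; lra.
  rewrite rdotBl rdotZl e2 rdotBl -(ler_pM2l h0) mulrBr mulrA divff ?gt_eqF// mul1r.
  move: b1 b2; rewrite !ler_norml => /andP[_ c1] /andP[c2 _].
  exact: arith c1 c2.
have [DI AI] := (gT I _).2 gI.
have DdI : D (d^-1 **: I).
  suff [] : D (d^-1 **: I) /\ A (d^-1 **: I) = d^-1 **: (T d x - x) by [].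
  apply/gT; apply: cvg_near_eq (cvg_rscale (cvg_cst d^-1) gI).
  apply: nearW => h /=; rewrite (bopZ (bT h)) -rscaleBr !rscaleA; congr (_ **: _).
  by rewrite mulrC.
exists (d^-1 **: I) => //; apply: le_lt_trans (_ : e / 2 < e); last by lra.
apply: rnorm_le_dual => [|y]; first by rewrite ltW// divr_gt0.
rewrite rdotBl rdotZl wI -/(f y) -(ler_pM2l d0) mulrBr mulrA divff ?gt_eqF// mul1r.
have := @bound 0 d y (e / 2) x (ltW d0) (fun s s1 s2 => ltW (hd s s1 s2)).
by rewrite subr0 ler_norml => /andP[_].
Unshelve. all: by end_near. Qed.

(** For u in D and v in D', the function s -> <T s u, T' (t - s) v> has derivative zero; its values
    at 0 and t give the identity, and density extends it. *)
Lemma sgroup_adjoint T D A T' D' A' t x y : sgroup T -> generator D A T ->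
  sgroup T' -> generator D' A' T' ->
  (forall u v, D u -> D' v -> rdot (A u) v = rdot u (A' v)) -> 0 <= t ->
  rdot (T t x) y = rdot x (T' t y).
Proof.
move=> sgT gT sgT' gT' adjA t0.
have [[bT cT] T0 _] := sgT; have [[bT' cT'] T0' _] := sgT'.
have onD u v : D u -> D' v -> rdot (T t u) v = rdot u (T' t v).
  move=> Du Dv.
  have cF : continuous (fun s => rdot (T s u) (T' (t - s) v)).
    apply: continuous_rdot => //.
    by apply: (continuous_fun (cT' v)); exact: continuous_subl.
  have := @ftc R (fun s => rdot (T s u) (T' (t - s) v)) (fun=> 0) 0 t t0.
  rewrite Rintegral_cst//= mul0r subr0 subrr T0 T0' => h.
  apply/eqP; rewrite -subr_eq0 -h//.
  - exact: continuous_cstT.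
  - by move=> s _ _; exact: cF.
  - move=> s s0 st.
    have ts : 0 < t - s by rewrite subr_gt0.
    have h1 := sgroup_hasd sgT gT Du s0.
    have h2 := hasd_reflect (sgroup_hasd sgT' gT' Dv ts).
    have := hasdR_rdot h1 h2.
    have [Ds As] := sgroup_dom sgT gT Du (ltW s0).
    have [Dts Ats] := sgroup_dom sgT' gT' Dv (ltW ts).
    by rewrite -As -Ats rdotNr adjA// subrr.
have [_ _ [M M0 hM]] := bT t; have [_ _ [M' M'0 hM']] := bT' t.
apply/eqP; rewrite -subr_eq0 -normr_le0; apply/ler_addgt0Pl => e e0; rewrite addr0.
(* Approximating x and y within q <= 1 produces four errors whose sum is at most q (M + M') (|x| +
   |y| + 1); q k <= e closes the estimate. *)
pose k := 1 + (M + M') * (rnorm y + rnorm x + 1).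
have k0 : 0 < k by rewrite ltr_pwDl// mulr_ge0// !addr_ge0.
pose q := Num.min 1 (e / k).
have q0 : 0 < q by rewrite lt_min ltr01 divr_gt0.
have q1 : q <= 1 by rewrite ge_min lexx.
have qe : q * k <= e by rewrite -ler_pdivlMr// ge_min lexx orbT.
have [u Du hu] := sgroup_dense x sgT gT q0.
have [v Dv hv] := sgroup_dense y sgT' gT' q0.
have -> : rdot (T t x) y - rdot x (T' t y) =
   - (rdot (T t (u - x)) y + rdot (T t u) (v - y)) + (rdot (u - x) (T' t y) + rdot u (T' t (v - y))).
  rewrite (bopB (bT t)) (bopB (bT' t)) !rdotBl !rdotBr (onD u v Du Dv); ring.
have n1 : rnorm u <= rnorm x + 1.
  by have := rnormD (u - x) x; rewrite subrK; lra.
have a1 := abs_rdot_le (T t (u - x)) y; have a2 := abs_rdot_le (T t u) (v - y).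
have a3 := abs_rdot_le (u - x) (T' t y); have a4 := abs_rdot_le u (T' t (v - y)).
have b1 := hM (u - x); have b2 := hM u; have b3 := hM' y; have b4 := hM' (v - y).
rewrite (le_trans (ler_normD _ _))// normrN.
rewrite (le_trans (lerD (ler_normD _ _) (ler_normD _ _)))//.
have c1 : `|rdot (T t (u - x)) y| <= M * q * rnorm y.
  by rewrite (le_trans a1)// ler_wpM2r// (le_trans b1)// ler_wpM2l// ltW.
have c2 : `|rdot (T t u) (v - y)| <= M * (rnorm x + 1) * q.
  by rewrite (le_trans a2)// ler_pM// ?(ltW hv)// (le_trans b2)// ler_wpM2l.
have c3 : `|rdot (u - x) (T' t y)| <= q * (M' * rnorm y).
  by rewrite (le_trans a3)// ler_pM// ltW.
have c4 : `|rdot u (T' t (v - y))| <= (rnorm x + 1) * (M' * q).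
  by rewrite (le_trans a4)// ler_pM// (le_trans b4)// ler_wpM2l// ltW.
apply: le_trans qe; rewrite /k.
apply: le_trans (_ : q * ((M + M') * (rnorm y + rnorm x + 1)) <= _); last first.
  by rewrite ler_wpM2l// ?(ltW q0)// lerDr.
apply: le_trans (lerD (lerD c1 c2) (lerD c3 c4)) _.
rewrite le_eqVlt; apply/orP; left; apply/eqP; ring.
Qed.
End SemigroupAdjoint.

(** * Extension by clamping, a product rule, and density for bilinear forms *)

Section Clamping.
Variable (R : realType).
Implicit Types (H U Y : hilbertType R).
Local Notation mu := (@lebesgue_measure R).

(** For a <= b, the nonexpansive retraction of the line onto [a, b]; composing with it turns
    continuity within the interval into continuity everywhere. *)
Definition clamp (a b t : R) : R := Num.max a (Num.min b t).

Lemma clampE a b t : t \in `[a, b] -> clamp a b t = t.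
Proof. by rewrite in_itv/= /clamp => /andP[h1 h2]; rewrite min_r// max_r. Qed.

Lemma clamp_le a b t : t <= b -> clamp a b t = Num.max a t.
Proof. by move=> tb; rewrite /clamp min_r. Qed.

Lemma clamp_in a b t : a <= b -> clamp a b t \in `[a, b].
Proof.
by move=> ab; rewrite in_itv/= /clamp le_max lexx/= ge_max ab ge_min lexx.
Qed.

Lemma clamp_lip a b s t : `|clamp a b s - clamp a b t| <= `|s - t|.
Proof.
have aux (u v : R) : u <= v -> 0 <= clamp a b v - clamp a b u <= v - u.
  move=> uv; rewrite /clamp.
  by case: (leP b u) => ?; case: (leP b v) => ?; case: (leP a b) => ?;
    case: (leP a u) => ?; case: (leP a v) => ?; lra.
have [st|ts] := leP s t.
  have /andP[h1 h2] := aux s t st.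
  by rewrite distrC ger0_norm// distrC ger0_norm// subr_ge0.
have /andP[h1 h2] := aux t s (ltW ts).
by rewrite ger0_norm// ger0_norm// subr_ge0 ltW.
Qed.

Lemma clamp_continuous (X : topologicalType) (f : R -> X) a b : a <= b ->
  {within `[a, b], continuous f} -> continuous (fun t => f (clamp a b t)).
Proof.
move=> ab /subspace_continuousP cf t.
have tin : (`[a, b]%classic : set R) (clamp a b t) by exact: clamp_in.
apply: cvg_comp (cf _ tin) => P /nbhs_normP[e /= e0 he].
apply/nbhs_normP; exists e => // s /= st.
apply: (he (clamp a b s)); first by rewrite /= (le_lt_trans (clamp_lip _ _ _ _)).
exact: clamp_in.
Qed.

Lemma sfam_reflect H U (Q : R -> H -> U) c : sfam Q -> sfam (fun s => Q (c - s)).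
Proof.
move=> [bQ cQ]; split => [t|x]; first exact: bQ.
by apply: (continuous_fun (cQ x)); exact: continuous_subl.
Qed.

(** A product rule in which Q is differentiable only in the weak sense, at the two frozen vectors f
    s and g s. The increments of f and g need only the strong continuity of Q. *)
Lemma hasdR_sfam H (Q : R -> H -> H) (f g : R -> H) s f' g' q :
  sfam Q -> hasd f s f' -> hasd g s g' -> hasdR (fun r => rdot (Q r (f s)) (g s)) s q ->
  hasdR (fun r => rdot (Q r (f r)) (g r)) s (rdot (Q s f') (g s) + rdot (Q s (f s)) g' + q).
Proof.
move=> sQ hf hg hq; have [bQ cQ] := sQ.
have c1 : (fun h => rdot (Q (s + h) (h^-1 **: (f (s + h) - f s))) (g (s + h))) @ 0^'
    --> rdot (Q s f') (g s).
  exact: cvg_rdot (sfam_cvg sQ (@cvg_add0 R s) hf) (hasd_cvg hg).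
have c2 : (fun h => rdot (Q (s + h) (f s)) (h^-1 **: (g (s + h) - g s))) @ 0^'
    --> rdot (Q s (f s)) g'.
  exact: cvg_rdot (sfam_cvg sQ (@cvg_add0 R s) (cvg_cst (f s))) hg.
have c3 : (fun h => h^-1 * (rdot (Q (s + h) (f s)) (g s) - rdot (Q s (f s)) (g s))) @ 0^' --> q.
  exact: hq.
apply: cvg_near_eq (cvgD (cvgD c1 c2) c3); apply: nearW => h.
rewrite [LHS](_ : _ = rdot (Q (s + h) (h^-1 **: (f (s + h) - f s))) (g (s + h)) +
  rdot (Q (s + h) (f s)) (h^-1 **: (g (s + h) - g s)) +
  h^-1 * (rdot (Q (s + h) (f s)) (g s) - rdot (Q s (f s)) (g s)))//.
rewrite (bopZ (bQ _)) (bopB (bQ _)) rdotZl rdotZr -!mulrDr rdotBl rdotBr; congr (_ * _); ring.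
Qed.

Lemma bilinear_dense H (D : set H) (G : H -> H -> R) k :
  (forall x e, 0 < e -> exists2 y, D y & rnorm (y - x) < e) ->
  (forall a b c, G (a - b) c = G a c - G b c) -> (forall a b c, G a (b - c) = G a b - G a c) ->
  0 <= k -> (forall a b, `|G a b| <= k * rnorm a * rnorm b) ->
  (forall a b, D a -> D b -> G a b = 0) -> forall a b, G a b = 0.
Proof.
move=> dD Gl Gr k0 Gk GD a b.
apply/eqP; rewrite -normr_le0; apply/ler_addgt0Pl => e e0; rewrite addr0.
pose K := 1 + k * (rnorm b + rnorm a + 1).
have K0 : 0 < K by rewrite ltr_pwDl// mulr_ge0// !addr_ge0.
pose q := Num.min 1 (e / K).
have q0 : 0 < q by rewrite lt_min ltr01 divr_gt0.
have q1 : q <= 1 by rewrite ge_min lexx.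
have qe : q * K <= e by rewrite -ler_pdivlMr// ge_min lexx orbT.
have [u Du hu] := dD a q q0; have [v Dv hv] := dD b q q0.
have -> : G a b = - (G (u - a) b + G u (v - b)).
  by rewrite Gl Gr (GD u v Du Dv); ring.
have n1 : rnorm u <= rnorm a + 1.
  by have := rnormD (u - a) a; rewrite subrK; lra.
rewrite normrN (le_trans (ler_normD _ _))//.
have c1 : `|G (u - a) b| <= k * q * rnorm b.
  by rewrite (le_trans (Gk _ _))// ler_wpM2r// ler_wpM2l// ltW.
have c2 : `|G u (v - b)| <= k * (rnorm a + 1) * q.
  by rewrite (le_trans (Gk _ _))// ler_pM// ?(ltW hv)// ?mulr_ge0// ler_wpM2l.
apply: le_trans qe; rewrite /K.
apply: le_trans (_ : q * (k * (rnorm b + rnorm a + 1)) <= _); last first.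
  by rewrite ler_wpM2l// ?(ltW q0)// lerDr.
apply: le_trans (lerD c1 c2) _.
by rewrite le_eqVlt; apply/orP; left; apply/eqP; ring.
Qed.

Lemma Re_continuous : continuous (fun z : R[i]^o => complex.Re z).
Proof.
move=> z P /nbhs_normP[e /= e0 he].
suff : \forall w \near z, P (complex.Re w) by [].
apply/nbhs_normP; exists (e%:C)%C; first by rewrite /= ltcR.
move=> w /= h; apply: he => /=.
have := le_lt_trans (normc_ge_Re _) h; rewrite ltcR.
by case: (z) (w) => a b [c d].
Qed.

End Clamping.

(** * The integrated Riccati equation *)

Section MildRiccati.
Variables (R : realType) (H U Y : hilbertType R) (D : set H) (A : H -> H) (S : R -> H -> H).
Variables (B : {bounded U -> H}) (C : {bounded H -> Y}) (K : {bounded U -> H}).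
Variable P : R -> {bounded H -> H}.
Hypotheses (sgS : sgroup S) (genS : generator D A S) (coerK : coercive K).
Hypothesis ricP : forall T, 0 < T -> riccati_solution B C K D A T P.
Local Notation mu := (@lebesgue_measure R).
Local Notation Q := (posfam P).

Lemma riccati_sfam : sfam Q.
Proof.
split=> [t|x t]; first exact: bounded_bop.
(* Near t the upper clamp at |t| + 1 is inactive; only the freezing at 0 remains, as in [posfam]. *)
have b0 : 0 < `|t| + 1 by rewrite ltr_wpDl.
have [_ cP _ _] := ricP b0.
have c := clamp_continuous (ltW b0) (cP x).
apply: cvg_near_eq (_ : P (clamp 0 (`|t| + 1) s) x @[s --> t] --> Q t x); last first.
  have e : Q t x = P (clamp 0 (`|t| + 1) t) x.
    have tb : t <= `|t| + 1 by rewrite (le_trans (ler_norm t))// lerDl.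
    by rewrite clamp_le.
  by rewrite e; exact: c.
near=> s; rewrite clamp_le//.
have : `|t - s| < 1 by near: s; exact: cvgr_dist_lt.
by rewrite ltr_norml => /andP[h1 h2]; have := ler_norm t; lra.
Unshelve. all: by end_near. Qed.

Lemma riccati_sym t x y : rdot (Q t x) y = rdot x (Q t y).
Proof.
have b0 : 0 < Num.max 0 t + 1 by rewrite ltr_wpDl// le_max lexx.
have [sP _ _ _] := ricP b0; rewrite /rdot /posfam sP//.
by rewrite in_itv/= le_max lexx/= lerDl.
Qed.

Lemma riccati_0 x : Q 0 x = 0.
Proof. by have [_ _ P0 _] := ricP ltr01; rewrite /posfam maxxx P0. Qed.

Lemma bop_feedback : bop (feedback B K).
Proof. exact: bop_comp (bop_adj B) (bop_gram_inv coerK). Qed.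

Lemma riccati_hasdR x y t : D x -> D y -> 0 < t ->
  hasdR (fun s => rdot (Q s x) y) t
    (rdot (Q t x) (A y) + rdot (Q t (A x)) y
     - rdot (feedback B K (Q t x)) (adj B (Q t y)) + rdot (C x) (C y)).
Proof.
move=> Dx Dy t0; have b0 : 0 < t + 1 by rewrite addr_gt0.
have [_ _ _ /(_ x y t Dx Dy) dP] := ricP b0.
have tin : t \in `[0, t + 1] by rewrite in_itv/= ltW//= lerDl.
(* Such h keep t + h positive and inside [0, t + 1], so the restricted derivative is two-sided and
   [posfam] agrees with P. *)
have small : \forall h \near (0 : R)^', `|h| < Num.min 1 t.
  by apply: dnbhs0_lt; rewrite lt_min ltr01.
move: (dP tin) => {}dP; move: dP; rewrite /is_derive_in; set l := (X in _ --> X) => dP.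
have {}dP : (fun h => ((h^-1)%:C)%C *: (hdot (P (t + h) x) y - hdot (P t x) y) : R[i]^o)
    @ 0^' --> (l : R[i]^o).
  have near_in : \forall h \near (0 : R)^', t + h \in `[0, t + 1].
    apply: filterS small => h /=; rewrite lt_min !ltr_norml in_itv/= => /andP[/andP[a1 a2] /andP[b1 b2]].
    by apply/andP; split; lra.
  move=> V lV; have hV : \forall h \near (0 : R)^', t + h \in `[0, t + 1] ->
      V (((h^-1)%:C)%C *: (hdot (P (t + h) x) y - hdot (P t x) y) : R[i]^o) by exact: (dP V lV).
  by apply: filterS2 near_in hV => h h1; apply.
have h2 : (fun h => complex.Re (((h^-1)%:C)%C * (hdot (P (t + h) x) y - hdot (P t x) y))) @ 0^'
    --> complex.Re l by exact: (cvg_continuous (@Re_continuous R) dP).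
have -> : rdot (Q t x) (A y) + rdot (Q t (A x)) y - rdot (feedback B K (Q t x)) (adj B (Q t y)) +
   rdot (C x) (C y) = complex.Re l.
  by rewrite /l /posfam max_r ?(ltW t0)// /rdot !(ReD, ReN).
apply: cvg_near_eq h2; apply: filterS small => h.
rewrite lt_min !ltr_norml => /andP[_ /andP[b1 b2]].
by rewrite ReZ ReD ReN /posfam !max_r ?(ltW t0)//; lra.
Qed.

(** The part of the Riccati right-hand side that does not contain A; it is bounded, so it makes
    sense on all of H. *)
Definition riccati_form (t : R) (a : H) : H :=
  adj C (C a) - Q t (B (feedback B K (Q t a))).
Local Notation M := riccati_form.

Lemma riccati_form_sfam : sfam M.
Proof.
have bF := bop_feedback; have [bQ cQ] := riccati_sfam.
split=> [t|x].
  apply: bop_sub; first exact: bop_comp (bounded_bop C) (bop_adj C).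
  exact: bop_comp (bop_comp (bop_comp (bQ t) bF) (bounded_bop B)) (bQ t).
have c1 : continuous (fun t => Q t (B (feedback B K (Q t x)))).
  apply: (sfam_cont riccati_sfam) => [t|]; first exact: cvg_id.
  apply: (continuous_fun (bop_continuous (bop_comp bF (bounded_bop B)))).
  exact: cQ.
by move=> t; apply: cvgB (c1 t); exact: cvg_cst.
Qed.

Lemma rdot_riccati_form t a b :
  rdot (M t a) b = rdot (C a) (C b) - rdot (feedback B K (Q t a)) (adj B (Q t b)).
Proof.
by rewrite /riccati_form rdotBl [rdot (adj C _) _]rdotC -rdot_adj [rdot (C b) _]rdotC
  riccati_sym [rdot (B _) _]rdot_adj.
Qed.

Lemma riccati_form_sym t a b : rdot (M t a) b = rdot a (M t b).
Proof.
rewrite [RHS]rdotC !rdot_riccati_form [rdot (C b) _]rdotC; congr (_ - _).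
by rewrite /feedback gram_inv_sym// rdotC.
Qed.

(** For a, b in D, differentiate s -> <P(T-s) S(s-t) a, S(s-t) b>: the terms with A from P and from
    the orbits cancel, leaving minus the integrand. P(0) = 0 removes the boundary term at s = T. *)
Lemma riccati_mild T t a b : t <= T ->
  \int[mu]_(s in `[t, T]) rdot (M (T - s) (S (s - t) a)) (S (s - t) b) =
  rdot (Q (T - t) a) b.
Proof.
move=> tT; have [sS S0 _] := sgS; have [bS cS] := sS.
have sM := riccati_form_sfam; have sQ := riccati_sfam; have [bQ cQ] := sQ.
have cSt x : continuous (fun s => S (s - t) x).
  by apply: (continuous_fun (cS x)); exact: continuous_subr.
pose f a b s := rdot (M (T - s) (S (s - t) a)) (S (s - t) b).
have cf a' b' : continuous (f a' b').
  apply: continuous_rdot => //; apply: (sfam_cont sM); first exact: continuous_subl.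
  exact: cSt.
have i_f a' b' := continuous_integ t T (cf a' b').
suff : forall a b, rdot (Q (T - t) a) b - \int[mu]_(s in `[t, T]) f a b s = 0.
  by move=> /(_ a b)/eqP; rewrite subr_eq0 => /eqP ->.
have [mM mM0 hmM] := sfam_bound 0 (T - t) sM.
have [mS mS0 hmS] := sfam_bound 0 (T - t) sS.
have [_ _ [mQ mQ0 hmQ]] := bQ (T - t).
have mI : measurable (`[t, T]%classic : set R) by exact: measurable_itv.
(* The constant bounds the form on all of H: [mQ] for the value of P, and the length of the interval
   times the bounds of [M] and of the two orbits for the integral. *)
apply: (@bilinear_dense R H D _ (mQ + (T - t) * (mM * mS * mS))).
- by move=> x e; exact: (sgroup_dense x sgS genS).
- move=> a1 b1 c1; rewrite (bopB (bQ _)) rdotBl.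
  rewrite (_ : \int[mu]_(s in `[t, T]) f (a1 - b1) c1 s =
    \int[mu]_(s in `[t, T]) f a1 c1 s - \int[mu]_(s in `[t, T]) f b1 c1 s); first by ring.
  rewrite -RintegralB//; apply: eq_Rintegral => s _.
  by rewrite /f (bopB (bS _)) (bopB (sM.1 _)) rdotBl.
- move=> a1 b1 c1; rewrite rdotBr.
  rewrite (_ : \int[mu]_(s in `[t, T]) f a1 (b1 - c1) s =
    \int[mu]_(s in `[t, T]) f a1 b1 s - \int[mu]_(s in `[t, T]) f a1 c1 s); first by ring.
  rewrite -RintegralB//; apply: eq_Rintegral => s _.
  by rewrite /f (bopB (bS _)) rdotBr.
- by rewrite addr_ge0// !mulr_ge0// subr_ge0.
- move=> a1 b1; rewrite (le_trans (ler_normB _ _))// -mulrA mulrDl lerD//.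
    rewrite (le_trans (abs_rdot_le _ _))// mulrA ler_wpM2r//.
  have icst : mu.-integrable `[t, T] (EFin \o (fun=> mM * mS * mS * (rnorm a1 * rnorm b1))).
    by apply: integ_cst => //; exact: mu_itv_lty.
  have -> : (T - t) * (mM * mS * mS) * (rnorm a1 * rnorm b1) =
      \int[mu]_(s in `[t, T]) (mM * mS * mS * (rnorm a1 * rnorm b1)).
    by rewrite Rintegral_cst// [X in fine X](mu_itv tT) /=; ring.
  apply: le_trans (le_normr_Rintegral _ (i_f a1 b1)) _ => //.
  apply: le_Rintegral => //; first exact: integrable_norm.
  move=> s; rewrite /= in_itv/= => /andP[s1 s2].
  have sin : s - t \in `[0, T - t] by rewrite in_itv/= subr_ge0 s1 lerD2r.
  have sin' : T - s \in `[0, T - t] by rewrite in_itv/= subr_ge0 s2 lerB.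
  rewrite (le_trans (abs_rdot_le _ _))//.
  rewrite (_ : _ * (_ * _) = (mM * (mS * rnorm a1)) * (mS * rnorm b1)); last by ring.
  apply: ler_pM => //; last exact: hmS.
  by rewrite (le_trans (hmM _ _ sin'))// ler_wpM2l// hmS.
move=> a1 b1 Da Db.
have cF : continuous (fun s => rdot (Q (T - s) (S (s - t) a1)) (S (s - t) b1)).
  apply: continuous_rdot => //; apply: (sfam_cont sQ); first exact: continuous_subl.
  exact: cSt.
rewrite (_ : \int[mu]_(s in `[t, T]) f a1 b1 s =
    - \int[mu]_(s in `[t, T]) (- f a1 b1 s)); last first.
  by rewrite RintegralN// opprK.
rewrite (@ftc R (fun s => rdot (Q (T - s) (S (s - t) a1)) (S (s - t) b1)) (fun s => - f a1 b1 s))//.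
- by rewrite !subrr riccati_0 rdot0l S0 S0; ring.
- by move=> s; apply: cvgN; exact: cf.
- by move=> s _ _; exact: cF.
move=> s ts sT.
have st0 : 0 < s - t by rewrite subr_gt0.
have Ts0 : 0 < T - s by rewrite subr_gt0.
have [Das Aas] := sgroup_dom sgS genS Da (ltW st0).
have [Dbs Abs] := sgroup_dom sgS genS Db (ltW st0).
have ha := hasd_shift (sgroup_hasd sgS genS Da st0).
have hb := hasd_shift (sgroup_hasd sgS genS Db st0).
have hq := hasdR_reflect (riccati_hasdR Das Dbs Ts0).
have := hasdR_sfam (sfam_reflect T sQ) ha hb hq.
rewrite /f rdot_riccati_form -Aas -Abs.
set v1 := (X in hasdR _ s X -> _); set v2 := (X in _ -> hasdR _ s X).
suff -> : v2 = v1 by []; rewrite /v1 /v2; ring.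
Qed.

End MildRiccati.

(** * Mild trajectories *)

Section FubiniTriangle.
Variables (R : realType) (H : hilbertType R).
Local Notation mu := (@lebesgue_measure R).
Local Notation integ D h := (mu.-integrable D (EFin \o h)).
Implicit Types (S : R -> H -> H) (G psi eta : R -> H).

(** Expanding both simple functions over their values leaves products of indicators of one
    coordinate and a continuous function of the difference. *)
Lemma measurable_convolution S (G psi : R -> H) : sfam S -> simple G -> simple psi ->
  measurable_fun setT (fun z : R * R => rdot (G z.1) (S (z.1 - z.2) (psi z.2))).
Proof.
move=> sS sG spsi; have [bS cS] := sS.
pose F := fset_set (range G); pose F' := fset_set (range psi).
have -> : (fun z : R * R => rdot (G z.1) (S (z.1 - z.2) (psi z.2))) =
    (fun z => \sum_(v <- F) \sum_(w <- F') (\1_(G @^-1` [set v]) z.1 * \1_(psi @^-1` [set w]) z.2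
       * rdot v (S (z.1 - z.2) w))).
  apply/funext => z.
  have gF : G z.1 \in F by rewrite in_fset_set; [apply: mem_set; exists z.1|exact: sG.1].
  have pF : psi z.2 \in F' by rewrite in_fset_set; [apply: mem_set; exists z.2|exact: spsi.1].
  rewrite (big_fsetD1 _ gF)/= [X in _ = _ + X]big1_seq ?addr0; last first.
    move=> v /andP[_]; rewrite in_fsetD1 => /andP[/eqP nv _].
    by rewrite big1// => w _; rewrite indicE memNset ?mul0r// => /= e; apply: nv.
  rewrite (big_fsetD1 _ pF)/= [X in _ = _ + X]big1_seq ?addr0; last first.
    move=> w /andP[_]; rewrite in_fsetD1 => /andP[/eqP nw _].
    by rewrite [X in _ * X * _]indicE memNset ?(mulr0, mul0r)// => /= e; apply: nw.
  by rewrite !indicE !mem_set// !mul1r.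
apply: measurable_sum => v; apply: measurable_sum => w.
have m1 : measurable_fun setT (\1_(G @^-1` [set v]) : R -> R).
  by apply: measurable_indic; exact: sG.2.
have m2 : measurable_fun setT (\1_(psi @^-1` [set w]) : R -> R).
  by apply: measurable_indic; exact: spsi.2.
have m3 : measurable_fun setT (fun t => rdot v (S t w)).
  apply: continuous_measurable_fun; apply: continuous_rdot => //.
  exact: continuous_cstT.
have m4 : measurable_fun setT (fun z : R * R => z.1 - z.2) by exact: measurable_funB.
apply: measurable_funM; last exact: measurableT_comp m3 m4.
apply: measurable_funM; first exact: measurableT_comp m1 measurable_fst.
exact: measurableT_comp m2 measurable_snd.
Qed.

Lemma L1_convolution_past S psi a b s : sfam S -> L1 `[a, b] psi -> s <= b ->
  L1 `[a, s] (fun r => S (s - r) (psi r)).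
Proof.
move=> sS lg sb.
have mI : measurable (`[a, s]%classic : set R) by exact: measurable_itv.
have sub : `[a, s]%classic `<=` (`[a, b]%classic : set R) by apply: subset_itvl; rewrite bnd_simp.
have [mp ip] : L1 `[a, s] psi by apply: L1_subset lg.
have [M M0 hM] := sfam_bound 0 (s - a) sS.
apply: (L1_le mI _ _ (integZ M mI ip)).
  apply: (@strongly_measurable_joint R _ _ (fun p : R * H => S (s - p.1) p.2)) => //.
  apply: sfam_cont => //; last exact: continuous_snd.
  by apply: (continuous_fun (@continuous_subl R s)); exact: continuous_fst.
move=> r /=; rewrite in_itv/= => /andP[r1 r2]; apply: hM.
by rewrite in_itv/= subr_ge0 r2 lerB.
Qed.

Lemma integ_convolution_past S psi a b s y : sfam S -> L1 `[a, b] psi -> s <= b ->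
  integ `[a, s] (fun r => rdot (S (s - r) (psi r)) y).
Proof.
move=> sS lpsi sb; apply: integ_rdotl; first exact: measurable_itv.
exact: (L1_convolution_past sS lpsi sb).
Qed.

Lemma integ_convolution_future S G a b r y : sfam S -> L1 `[a, b] G -> a <= r ->
  integ `[r, b] (fun s => rdot (G s) (S (s - r) y)).
Proof.
move=> sS lG ar.
have mI : measurable (`[r, b]%classic : set R) by exact: measurable_itv.
have sub : `[r, b]%classic `<=` (`[a, b]%classic : set R) by apply: subset_itvr; rewrite bnd_simp.
have lG' : L1 `[r, b] G by apply: L1_subset lG.
have [M M0 hM] := sfam_bound 0 (b - r) sS.
apply: (integ_rdot (c := M * rnorm y)) => //.
  apply: strongly_measurable_continuous.
  by apply: (continuous_fun (sS.2 y)); exact: continuous_subr.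
move=> s /=; rewrite in_itv/= => /andP[s1 s2]; apply: hM.
by rewrite in_itv/= subr_ge0 s1 lerD2r.
Qed.

Lemma fubini_triangle S G psi eta a b : sfam S -> L1 `[a, b] G -> L1 `[a, b] psi ->
  (forall s y, s \in `[a, b] ->
     rdot (eta s) y = \int[mu]_(r in `[a, s]) rdot (S (s - r) (psi r)) y) ->
  \int[mu]_(s in `[a, b]) rdot (G s) (eta s) =
  \int[mu]_(r in `[a, b]) \int[mu]_(s in `[r, b]) rdot (G s) (S (s - r) (psi r)).
Proof.
move=> sS lG lpsi hη.
have [mG iG] := lG; have [mpsi ipsi] := lpsi.
have [M M0 hM] := sfam_bound 0 (b - a) sS.
pose k (z : R * R) := rdot (G z.1) (S (z.1 - z.2) (psi z.2)).
pose D : set (R * R) := [set z | a <= z.2 /\ z.2 <= z.1 /\ z.1 <= b].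
pose f := (fun z => (k z)%:E) \_ D.
have mI c d : measurable (`[c, d]%classic : set R) by exact: measurable_itv.
have mD : measurable D.
  have m1 : measurable_fun setT (fun z : R * R => z.2) by exact: measurable_snd.
  have m2 : measurable_fun setT (fun z : R * R => z.1 - z.2) by exact: measurable_funB.
  have m3 : measurable_fun setT (fun z : R * R => z.1) by exact: measurable_fst.
  have -> : D = ((fun z : R * R => z.2) @^-1` `[a, +oo[) `&`
     (((fun z : R * R => z.1 - z.2) @^-1` `[0, +oo[) `&` ((fun z : R * R => z.1) @^-1` `]-oo, b])).
    by apply/seteqP; split => z; rewrite /D /= !in_itv/= !andbT subr_ge0.
  apply: measurableI; first by rewrite -[X in measurable X]setTI; exact: (m1 measurableT _ (measurable_itv _)).
  apply: measurableI; first by rewrite -[X in measurable X]setTI; exact: (m2 measurableT _ (measurable_itv _)).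
  by rewrite -[X in measurable X]setTI; exact: (m3 measurableT _ (measurable_itv _)).
(* The simple functions approximate G and psi only on [a, b]; points of the triangle have both
   coordinates there. *)
have mk : measurable_fun D k.
  have [Gn [sGn cGn]] := mG; have [pn [spn cpn]] := mpsi.
  apply: (@measurable_fun_cvg _ _ _ D (fun n z => rdot (Gn n z.1) (S (z.1 - z.2) (pn n z.2)))).
    by move=> n; apply: measurable_funTS; exact: (measurable_convolution sS (sGn n) (spn n)).
  move=> [s r] [/= ar [rs sb]].
  have c1 : Gn n s @[n --> \oo] --> G s by apply: cGn; rewrite /= in_itv/= sb (le_trans ar).
  have c2 : pn n r @[n --> \oo] --> psi r by apply: cpn; rewrite /= in_itv/= ar (le_trans rs).
  exact: cvg_rdot c1 (bop_cvg (sS.1 _) c2).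
have mf : measurable_fun setT f.
  have h : measurable_fun D (EFin \o k) by apply/measurable_EFinP.
  exact: ((measurable_restrictT _ mD).1 h).
have f_in s r : D (s, r) -> f (s, r) = (k (s, r))%:E.
  by move=> Dsr; rewrite /f patchE mem_set.
have f_out s r : ~ D (s, r) -> f (s, r) = 0%E.
  by move=> Dsr; rewrite /f patchE memNset.
have fs s : (fun r => f (s, r)) =
    if s \in `[a, b] then (fun r => (k (s, r))%:E) \_ `[a, s] else cst 0%E.
  apply/funext => r; case: ifPn => sab.
    rewrite patchE; case: ifPn => [/set_mem|/negP nr]; rewrite /= ?in_itv/=.
      move=> /andP[ar rs]; rewrite f_in//; split => //=; split => //.
      by move: sab; rewrite in_itv/= => /andP[].
    apply: f_out => -[/= ar [rs sb]]; apply: nr; apply: mem_set => /=.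
    by rewrite in_itv/= ar.
  apply: f_out => -[/= ar [rs sb]]; move/negP: sab; apply.
  by rewrite in_itv/= sb (le_trans ar).
have fr r : (fun s => f (s, r)) =
    if r \in `[a, b] then (fun s => (k (s, r))%:E) \_ `[r, b] else cst 0%E.
  apply/funext => s; case: ifPn => rab.
    rewrite patchE; case: ifPn => [/set_mem|/negP nr]; rewrite /= ?in_itv/=.
      move=> /andP[rs sb]; rewrite f_in//; split => //=.
      by move: rab; rewrite in_itv/= => /andP[].
    apply: f_out => -[/= ar [rs sb]]; apply: nr; apply: mem_set => /=.
    by rewrite in_itv/= rs.
  apply: f_out => -[/= ar [rs sb]]; move/negP: rab; apply.
  by rewrite in_itv/= ar (le_trans rs).
have int_f : (mu \x mu)%E.-integrable setT f.
  apply/integrable12ltyP => //.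
  have f_s s : measurable_fun setT (fun r => `|f (s, r)|%E).
    by apply: measurableT_comp => //; exact: (measurableT_comp mf).
  (* On the triangle s - r lies in [0, b - a], so |f (s, r)| <= M |G s| |psi r|; the iterated
     integral is then at most M Psi times the L^1 norm of G. *)
  pose Psi := \int[mu]_(r in `[a, b]) rnorm (psi r).
  have iga := integZ (M * Psi) (mI a b) iG.
  apply: (@le_lt_trans _ _ (\int[mu]_(s in `[a, b]) (M * Psi * rnorm (G s))%:E)%E); last first.
    by rewrite EFin_Rintegral// ltry.
  rewrite [leRHS]integral_mkcond.
  have mg : measurable_fun setT ((fun s => (M * Psi * rnorm (G s))%:E) \_ `[a, b]).
    have h : measurable_fun `[a, b] (EFin \o (fun s => M * Psi * rnorm (G s))).
      by apply/measurable_EFinP; exact: (integ_measurable iga).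
    exact: ((measurable_restrictT _ (mI a b)).1 h).
  apply: ge0_le_integral => //.
  - by move=> s _; exact: integral_ge0.
  - have mabs : measurable_fun setT (abse \o f) by exact: measurableT_comp.
    apply: (@measurable_fun_fubini_tonelli_F _ _ (measurableTypeR R) (measurableTypeR R) R mu (abse \o f)) => //.
    by move=> z; exact: abse_ge0.
  move=> s _; rewrite patchE.
  have -> : (s \in (`[a, b]%classic : set R)) = (s \in `[a, b]) by apply/idP/idP => [/set_mem|/mem_set].
  case: ifPn => sab; last first.
    rewrite (eq_integral (cst 0%E)) ?integral0// => r _.
    by have /(congr1 (@^~ r)) := fs s; rewrite (negbTE sab) /= => ->; rewrite abse0.
  have ips := integZ (M * rnorm (G s)) (mI a b) ipsi.
  rewrite (_ : M * Psi * rnorm (G s) = M * rnorm (G s) * Psi); last by ring.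
  rewrite -RintegralZl// -EFin_Rintegral// [leRHS]integral_mkcond.
  have mips : measurable_fun setT ((fun r => (M * rnorm (G s) * rnorm (psi r))%:E) \_ `[a, b]).
    have h : measurable_fun `[a, b] (EFin \o (fun r => M * rnorm (G s) * rnorm (psi r))).
      by apply/measurable_EFinP; exact: (integ_measurable ips).
    exact: ((measurable_restrictT _ (mI a b)).1 h).
  apply: ge0_le_integral => //.
  - exact: f_s.
  move=> r _; rewrite patchE.
  have [[/= ar [rs sb]]|nD] := pselect (D (s, r)); last first.
    rewrite f_out// abse0; case: ifP => // _.
    by rewrite lee_fin !mulr_ge0.
  rewrite mem_set; last by rewrite /= in_itv/= ar (le_trans rs).
  rewrite f_in//= lee_fin (le_trans (abs_rdot_le _ _))// [leRHS]mulrAC mulrC.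
  rewrite ler_wpM2r// hM// in_itv/= subr_ge0 rs lerB//.
have := Fubini int_f.
have -> : (\int[mu]_s \int[mu]_r f (s, r) =
    \int[mu]_(s in `[a, b]) (rdot (G s) (eta s))%:E)%E.
  rewrite [RHS]integral_mkcond; apply: eq_integral => s _; rewrite patchE fs.
  have -> : (s \in (`[a, b]%classic : set R)) = (s \in `[a, b]) by apply/idP/idP => [/set_mem|/mem_set].
  case: ifPn => sab; last by rewrite integral0.
  rewrite -integral_mkcond rdotC hη// -EFin_Rintegral//.
    by apply: eq_integral => r _; rewrite /k /= rdotC.
  by apply: (integ_convolution_past (b := b)) => //; move: sab; rewrite in_itv/= => /andP[].
have -> : (\int[mu]_r \int[mu]_s f (s, r) =
    \int[mu]_(r in `[a, b]) (\int[mu]_(s in `[r, b]) rdot (G s) (S (s - r) (psi r)))%:E)%E.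
  rewrite [RHS]integral_mkcond; apply: eq_integral => r _; rewrite patchE fr.
  have -> : (r \in (`[a, b]%classic : set R)) = (r \in `[a, b]) by apply/idP/idP => [/set_mem|/mem_set].
  case: ifPn => rab; last by rewrite integral0.
  rewrite -integral_mkcond -EFin_Rintegral//.
  by apply: (integ_convolution_future (a := a)) => //; move: rab; rewrite in_itv/= => /andP[].
by rewrite /Rintegral => ->.
Qed.

End FubiniTriangle.

(** * Existence, restarting and continuity of mild trajectories *)

Section Trajectories.
Variables (R : realType) (H : hilbertType R).
Local Notation mu := (@lebesgue_measure R).
Local Notation integ D h := (mu.-integrable D (EFin \o h)).
Implicit Types (S : R -> H -> H) (g x : R -> H).

(* Testing against vectors replaces Bochner integrals by real ones. *)
Definition weak_mild S g (a0 : H) (b : R) x : Prop := forall t y, t \in `[0, b] ->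
  rdot (x t) y = rdot (S t a0) y + \int[mu]_(r in `[0, t]) rdot (S (t - r) (g r)) y.

Lemma posfam_past (S : R -> {bounded H -> H}) g (t r : R) : (`[0, t]%classic : set R) r ->
  posfam S (t - r) (g r) = S (t - r) (g r).
Proof. by rewrite /= in_itv/= => /andP[_ rt]; rewrite posfamE// subr_ge0. Qed.

Lemma mild_weak (S : R -> {bounded H -> H}) g a0 b x :
  mild_solution S g 0 b a0 x -> weak_mild (posfam S) g a0 b x.
Proof.
move=> mx t y tb; have [t0 _] : 0 <= t /\ t <= b by move: tb; rewrite in_itv/= => /andP[].
have mI : measurable (`[0, t]%classic : set R) by exact: measurable_itv.
have [_ /(_ y)] := bochner_integral_weak mI (mu_itv_lty _ _) (mx t tb).
rewrite rdotBl subr0 posfamE// => /eqP; rewrite subr_eq addrC => /eqP ->.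
by congr (_ + _); apply: eq_Rintegral => r /set_mem rt; rewrite posfam_past.
Qed.

Lemma weak_mild_solution (S : R -> {bounded H -> H}) g a0 b x : sfam (posfam S) ->
  L1 `[0, b] g -> weak_mild (posfam S) g a0 b x -> mild_solution S g 0 b a0 x.
Proof.
move=> sS lg wx t tb; have [t0 tb'] : 0 <= t /\ t <= b by move: tb; rewrite in_itv/= => /andP[].
have mI : measurable (`[0, t]%classic : set R) by exact: measurable_itv.
apply: is_bochner_integralP => //; first exact: mu_itv_lty.
  apply: (L1_eq mI _ (L1_convolution_past sS lg tb')) => r rt.
  exact: posfam_past.
move=> y; rewrite rdotBl wx// subr0 posfamE// addrC addKr.
by apply: eq_Rintegral => r /set_mem rt; rewrite posfam_past.
Qed.

Lemma weak_mild_exists S g a0 b : sfam S -> L1 `[0, b] g -> exists x, weak_mild S g a0 b x.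
Proof.
move=> sS lg.
have : forall t, exists I, t \in `[0, b] ->
    forall y, rdot I y = \int[mu]_(r in `[0, t]) rdot (S (t - r) (g r)) y.
  move=> t; have [tb|] := boolP (t \in `[0, b]); last by exists 0.
  have tb' : t <= b by move: tb; rewrite in_itv/= => /andP[].
  have mI : measurable (`[0, t]%classic : set R) by exact: measurable_itv.
  have [I hI] := bochner_integral_exists mI (mu_itv_lty _ _) (L1_convolution_past sS lg tb').
  by exists I => _ y; have [_ ->] := bochner_integral_weak mI (mu_itv_lty _ _) hI.
move=> /choice[I hI]; exists (fun t => S t a0 + I t) => t y tb.
by rewrite rdotDl hI.
Qed.

(** Restart at t: by the semigroup law the history before t is carried by S (s - t) (x t). In tested
    form S (s - t) is moved onto y, giving y'. *)
Lemma weak_mild_from S g a0 b x t s y : sgroup S -> L1 `[0, b] g -> weak_mild S g a0 b x ->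
  0 <= t -> t <= s -> s <= b ->
  rdot (x s - S (s - t) (x t)) y = \int[mu]_(r in `[t, s]) rdot (S (s - r) (g r)) y.
Proof.
move=> [sS _ SD] lg wx t0 ts sb; have [bS _] := sS.
have [y' hy'] := bop_dual y (bS (s - t)).
have st0 : 0 <= s - t by rewrite subr_ge0.
rewrite rdotBl hy' !wx ?in_itv/= ?t0 ?(le_trans ts)// ?(le_trans t0 ts)//.
rewrite -hy' -SD// subrK.
rewrite (@Rintegral_split R _ 0 t s)//; last exact: (integ_convolution_past y sS lg sb).
rewrite (_ : \int[mu]_(r in `[0, t]) rdot (S (t - r) (g r)) y' =
  \int[mu]_(r in `[0, t]) rdot (S (s - r) (g r)) y); first by ring.
apply: eq_Rintegral => r /set_mem; rewrite /= in_itv/= => /andP[r0 rt].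
by rewrite -hy' -SD ?subr_ge0// addrA subrK.
Qed.

Lemma weak_integral_bound S g a b s M (I : H) : sfam S -> L1 `[a, b] g -> a <= s -> s <= b -> 0 <= M ->
  (forall t (v : H), t \in `[0, b - a] -> rnorm (S t v) <= M * rnorm v) ->
  (forall y, rdot I y = \int[mu]_(r in `[a, s]) rdot (S (s - r) (g r)) y) ->
  rnorm I <= M * \int[mu]_(r in `[a, s]) rnorm (g r).
Proof.
move=> sS lg as_ sb M0 hM hI.
have mI : measurable (`[a, s]%classic : set R) by exact: measurable_itv.
have sub : `[a, s]%classic `<=` (`[a, b]%classic : set R) by apply: subset_itvl; rewrite bnd_simp.
have [_ ig] : L1 `[a, s] g by apply: L1_subset lg.
have [_ ic] := L1_convolution_past sS lg sb.
apply: rnorm_le_dual => [|y]; first by rewrite mulr_ge0// Rintegral_ge0.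
rewrite hI (le_trans (ler_norm _))//.
have i1 := integ_convolution_past y sS lg sb.
apply: le_trans (le_normr_Rintegral _ i1) _ => //.
rewrite (_ : M * _ * _ = (M * rnorm y) * \int[mu]_(r in `[a, s]) rnorm (g r)); last by ring.
rewrite -RintegralZl//; apply: le_Rintegral => //; [exact: integrable_norm|exact: integZ|].
move=> r; rewrite /= in_itv/= => /andP[r1 r2].
rewrite (le_trans (abs_rdot_le _ _))// [leRHS]mulrAC ler_wpM2r// hM//.
by rewrite in_itv/= subr_ge0 r2 lerB.
Qed.

(** Near s0 the trajectory is compared with a free orbit started slightly earlier, at c. The orbit
    is continuous, and the error is at most M times the integral of |g| since c. *)
Lemma weak_mild_continuous S g a0 b x : sgroup S -> 0 <= b -> L1 `[0, b] g ->
  weak_mild S g a0 b x -> continuous (fun t => x (clamp 0 b t)).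
Proof.
move=> sgS b0 lg wx; have [sS _ _] := sgS.
have [M M0 hM] := sfam_bound 0 b sS.
have mI c d : measurable (`[c, d]%classic : set R) by exact: measurable_itv.
pose Phi t := \int[mu]_(r in `[0, t]) rnorm (g r).
have [_ ig] := lg.
have cPhi : continuous (fun t => Phi (clamp 0 b t)).
  by apply: clamp_continuous => //; exact: parameterized_integral_continuous.
have PhiB c d : 0 <= c -> c <= d -> d <= b ->
    \int[mu]_(r in `[c, d]) rnorm (g r) = Phi d - Phi c.
  move=> c0 cd db; rewrite /Phi (@Rintegral_split R _ 0 c d)//; first by ring.
  by apply: integrableS ig => //; apply: subset_itvl; rewrite bnd_simp.
have step c s : 0 <= c -> c <= s -> s <= b -> rnorm (x s - S (s - c) (x c)) <= M * (Phi s - Phi c).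
  move=> c0 cs sb; rewrite -PhiB//.
  have lg' : L1 `[c, b] g by apply: L1_subset lg => //; apply: subset_itvr; rewrite bnd_simp.
  apply: (weak_integral_bound sS lg' cs sb M0).
    move=> t v; rewrite in_itv/= => /andP[t1 t2]; apply: hM.
    by rewrite in_itv/= t1 (le_trans t2)// lerBlDr lerDl.
  by move=> y; apply: (weak_mild_from _ sgS lg wx).
suff key s0 e : s0 \in `[0, b] -> 0 < e -> exists2 d, 0 < d & forall s, s \in `[0, b] ->
    `|s - s0| < d -> rnorm (x s - x s0) < e.
  move=> t; apply/cvg_rnorm/cvgrPdist_lt => e e0.
  have [d d0 hd] := key _ e (clamp_in t b0) e0.
  near=> s; rewrite sub0r normrN ger0_norm//; apply: hd; first exact: clamp_in.
  rewrite (le_lt_trans (clamp_lip _ _ _ _))// distrC; near: s; exact: cvgr_dist_lt.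
move=> s0b e0; have [s00 s0b'] : 0 <= s0 /\ s0 <= b by move: s0b; rewrite in_itv/= => /andP[].
have M1 : 0 < M + 1 by rewrite ltr_wpDl.
(* Of the budget e, the error at s takes two quarters, the error at s0 one, and the motion of the
   free orbit the last; M + 1 avoids dividing by zero. *)
have e4 : 0 < e / (4 * (M + 1)) by rewrite divr_gt0// mulr_gt0.
have := cPhi s0 => /cvgrPdist_lt /(_ _ e4)/nbhs_normP[d1 /= d10 h1].
(* Starting to the left of s0, unless s0 = 0, lets one orbit serve times on both sides of s0. *)
pose c := Num.max 0 (s0 - d1 / 2).
have c0 : 0 <= c by rewrite le_max lexx.
have cs0 : c <= s0 by rewrite ge_max s00 lerBlDr lerDl divr_ge0// ltW.
have hPhi s : s \in `[0, b] -> `|s0 - s| < d1 -> `|Phi s0 - Phi s| < e / (4 * (M + 1)).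
  by move=> sb /h1; rewrite !clampE.
have cT : continuous (fun s => S (s - c) (x c)).
  by apply: (continuous_fun (sS.2 (x c))); exact: continuous_subr.
have e4' : 0 < e / 4 by rewrite divr_gt0.
have := cT s0 => /cvg_rnorm/cvgrPdist_lt /(_ _ e4')/nbhs_normP[d2 /= d20 h2].
exists (Num.min (d1 / 2) d2); first by rewrite lt_min d20 divr_gt0.
move=> s sb; rewrite lt_min distrC => /andP[sd1 sd2].
have [s_0 s_b] : 0 <= s /\ s <= b by move: sb; rewrite in_itv/= => /andP[].
have cs : c <= s.
  rewrite ge_max s_0/=; move: sd1; rewrite ltr_norml => /andP[_ a2]; lra.
have a1 := step c s c0 cs s_b; have a2 := step c s0 c0 cs0 s0b'.
have a3 : rnorm (S (s - c) (x c) - S (s0 - c) (x c)) < e / 4.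
  by have := h2 s sd2; rewrite sub0r normrN ger0_norm.
have cin : c \in `[0, b] by rewrite in_itv/= c0 (le_trans cs0).
have a4 : `|Phi s0 - Phi s| < e / (4 * (M + 1)).
  by apply: hPhi => //; rewrite (lt_trans sd1)//; lra.
have a5 : `|Phi s0 - Phi c| < e / (4 * (M + 1)).
  apply: hPhi => //; rewrite ger0_norm ?subr_ge0//.
  have : s0 - d1 / 2 <= c by rewrite le_max lexx orbT.
  lra.
have a6 : rnorm (x s - x s0) <= rnorm (x s - S (s - c) (x c)) +
    rnorm (S (s - c) (x c) - S (s0 - c) (x c)) + rnorm (x s0 - S (s0 - c) (x c)).
  have -> : x s - x s0 = (x s - S (s - c) (x c)) + (S (s - c) (x c) - S (s0 - c) (x c)) -
      (x s0 - S (s0 - c) (x c)) by rewrite addrA subrK opprB addrA subrK.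
  by rewrite (le_trans (rnormB _ _))// lerD2r rnormD.
have ke : (M + 1) * (e / (4 * (M + 1))) = e / 4 by field; rewrite gt_eqF.
move: a4 a5; rewrite !ltr_norml => /andP[b1 b2] /andP[b3 b4].
have b5 : M * (Phi s - Phi c) <= (M + 1) * (2 * (e / (4 * (M + 1)))).
  have mPhi : 0 <= Phi s - Phi c by rewrite -PhiB// Rintegral_ge0.
  apply: le_trans (_ : (M + 1) * (Phi s - Phi c) <= _); first by rewrite ler_wpM2r// lerDl.
  by rewrite ler_wpM2l// ?(ltW M1)//; lra.
have b6 : M * (Phi s0 - Phi c) <= (M + 1) * (e / (4 * (M + 1))).
  have mPhi : 0 <= Phi s0 - Phi c by rewrite -PhiB// Rintegral_ge0.
  apply: le_trans (_ : (M + 1) * (Phi s0 - Phi c) <= _); first by rewrite ler_wpM2r// lerDl.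
  by rewrite ler_wpM2l// ?(ltW M1)// ltW.
rewrite mulrCA ke in b5; rewrite ke in b6; lra.
Unshelve. all: by end_near. Qed.

End Trajectories.

(** * Square integrable functions on a set of finite measure *)

Section SquareIntegrable.
Variable (R : realType).
Implicit Types (V W : hilbertType R).
Local Notation mu := (@lebesgue_measure R).
Local Notation integ D h := (mu.-integrable D (EFin \o h)).
Variable D : set R.
Hypotheses (mD : measurable D) (fD : (mu D < +oo)%E).

Lemma L2P V (f : R -> V) :
  L2 D f <-> strongly_measurable D f /\ integ D (fun t => rnorm (f t) ^+ 2).
Proof.
split=> -[mf h]; split=> //.
  apply/integrableP; split.
    apply/measurable_EFinP; apply: measurable_funX; exact: measurable_rnorm.
  rewrite (_ : integral _ _ _ = \int[mu]_(t in D) (rnorm (f t) ^+ 2)%:E)%E//.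
  by apply: eq_integral => t _ /=; rewrite ger0_norm// exprn_ge0.
by rewrite EFin_Rintegral// ltry.
Qed.

Lemma L2_L1 V (f : R -> V) : L2 D f -> L1 D f.
Proof.
move=> /L2P[mf h]; apply: (L1_le mD mf _ (integD mD (integ_cst 1 mD fD) h)).
by move=> t _; have := sqr_ge0 (rnorm (f t) - 1); have := sqr_ge0 (rnorm (f t)); rewrite sqrrB expr1n; lra.
Qed.

Lemma L2D V (f g : R -> V) : L2 D f -> L2 D g -> L2 D (fun t => f t + g t).
Proof.
move=> /L2P[mf hf] /L2P[mg hg]; apply/L2P.
have ms := strongly_measurableD mf mg; split=> //.
apply: (integ_le mD _ _ (integZ 2 mD (integD mD hf hg))).
  by apply: measurable_funX; exact: measurable_rnorm.
move=> t _; rewrite ger0_norm ?exprn_ge0//.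
by rewrite mulrDr -parallelogram lerDl sqr_ge0.
Qed.

Lemma L2_bop V W (F : V -> W) (f : R -> V) : bop F -> L2 D f -> L2 D (fun t => F (f t)).
Proof.
move=> bF /L2P[mf hf]; apply/L2P; have [_ _ [M M0 hM]] := bF.
have mF : strongly_measurable D (fun t => F (f t)).
  by apply: strongly_measurable_map mf; exact: bop_continuous.
split=> //; apply: (integ_le mD _ _ (integZ (M ^+ 2) mD hf)).
  by apply: measurable_funX; exact: measurable_rnorm.
by move=> t _; rewrite ger0_norm ?exprn_ge0// -exprMn lerXn2r ?nnegrE// mulr_ge0.
Qed.

Lemma bop_rscale V c : bop (rscale c : V -> V).
Proof.
split; first exact: rscaleDr.
  by move=> a x; rewrite !rscaleA mulrC.
by exists `|c| => // x; rewrite rnormZ.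
Qed.

Lemma bop_opp V : bop (fun x : V => - x).
Proof.
split; first by move=> x y; rewrite opprD.
  by move=> a x; rewrite rscaleN.
by exists 1 => // x; rewrite rnormN mul1r.
Qed.

Lemma bounded_L2 V (f : R -> V) c : strongly_measurable D f ->
  (forall t, D t -> rnorm (f t) <= c) -> L2 D f.
Proof.
move=> mf hc; apply/L2P; split=> //; apply: (integ_le mD _ _ (integ_cst (c ^+ 2) mD fD)).
  by apply: measurable_funX; exact: measurable_rnorm.
move=> t Dt; rewrite ger0_norm ?exprn_ge0// lerXn2r ?nnegrE//; last exact: hc.
by rewrite (le_trans _ (hc t Dt)).
Qed.

Lemma L2_indic V E (f : R -> V) : measurable E -> L2 D f ->
  L2 D (fun t => if t \in E then f t else 0).
Proof.
move=> mE /L2P[mf hf]; apply/L2P.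
have ms := strongly_measurable_indic mE mf; split=> //; apply: (integ_le mD _ _ hf).
  by apply: measurable_funX; exact: measurable_rnorm.
move=> t _; rewrite ger0_norm ?exprn_ge0//; case: ifP => // _.
by rewrite rnorm0 expr0n/= exprn_ge0.
Qed.

Lemma L2_rdot V (f g : R -> V) : L2 D f -> L2 D g -> integ D (fun t => rdot (f t) (g t)).
Proof.
move=> lf lg; have /L2P[mf hf] := lf; have /L2P[mg hg] := lg.
apply: (integ_le mD _ _ (integD mD hf hg)); first exact: measurable_rdot.
move=> t _; rewrite (le_trans (abs_rdot_le _ _))//.
have := sqr_ge0 (rnorm (f t) - rnorm (g t)); rewrite sqrrB.
have : 0 <= rnorm (f t) * rnorm (g t) by rewrite mulr_ge0.
lra.
Qed.

Lemma continuous_L2 V (f : R -> V) a b : D = `[a, b]%classic -> continuous f -> L2 D f.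
Proof.
move=> De cf; have [c _ hc] := continuous_bounded_itv a b cf.
apply: (@bounded_L2 V f c); first exact: strongly_measurable_continuous.
by rewrite De => t /=; exact: hc.
Qed.

Lemma L2_eq V (f g : R -> V) : (forall t, D t -> f t = g t) -> L2 D f -> L2 D g.
Proof.
move=> fg /L2P[mf hf]; apply/L2P; split; first exact: strongly_measurable_eq mf.
by apply: (integ_eq mD) hf => t Dt; rewrite fg.
Qed.

End SquareIntegrable.

(** * First variation of the cost *)

Section FirstVariation.
Variables (R : realType) (H U Y : hilbertType R).
Implicit Types (V W : hilbertType R).
Local Notation mu := (@lebesgue_measure R).
Local Notation integ D h := (mu.-integrable D (EFin \o h)).

Lemma L2_sfam V W (F : R -> V -> W) (f : R -> V) a b : sfam F -> L2 `[a, b] f ->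
  L2 `[a, b] (fun t => F t (f t)).
Proof.
move=> sF lf; have mI : measurable (`[a, b]%classic : set R) by exact: measurable_itv.
have [M M0 hM] := sfam_bound a b sF; have /(L2P mI _)[mf hf] := lf.
have mF : strongly_measurable `[a, b] (fun t => F t (f t)).
  exact: (@strongly_measurable_joint R _ _ (fun p : R * V => F p.1 p.2) _ _ (sfam_joint sF)).
apply/L2P => //; split=> //; apply: (integ_le mI _ _ (integZ (M ^+ 2) mI hf)).
  by apply: measurable_funX; exact: measurable_rnorm.
move=> t tI; rewrite ger0_norm ?exprn_ge0// -exprMn lerXn2r ?nnegrE ?mulr_ge0//.
exact: hM.
Qed.

Lemma weak_mild_L2 (S : R -> H -> H) g a0 b x : sgroup S -> 0 <= b -> L1 `[0, b] g ->
  weak_mild S g a0 b x -> L2 `[0, b] x.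
Proof.
move=> sgS b0 lg wx; have c := weak_mild_continuous sgS b0 lg wx.
have mI : measurable (`[0, b]%classic : set R) by exact: measurable_itv.
apply: (L2_eq mI _ (continuous_L2 mI (mu_itv_lty 0 b) erefl c)) => t tb.
by rewrite /= clampE.
Qed.

Lemma weak_mild_perturb (S : R -> H -> H) g h a0 b x xi c : sfam S ->
  L1 `[0, b] g -> L1 `[0, b] h -> weak_mild S g a0 b x -> weak_mild S h 0 b xi ->
  weak_mild S (fun t => g t + c **: h t) a0 b (fun t => x t + c **: xi t).
Proof.
move=> sS lg lh wx wxi t y tb; have tb' : t <= b by move: tb; rewrite in_itv/= => /andP[].
have [bS _] := sS; have mI : measurable (`[0, t]%classic : set R) by exact: measurable_itv.
have i1 := integ_convolution_past y sS lg tb'; have i2 := integ_convolution_past y sS lh tb'.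
rewrite rdotDl rdotZl wx// wxi// (bop0 (bS t)) rdot0l add0r -RintegralZl// -addrA -RintegralD//.
  congr (_ + _); apply: eq_Rintegral => r _.
  by rewrite (bopD (bS _)) (bopZ (bS _)) rdotDl rdotZl.
exact: integZ.
Qed.

Variables (B : {bounded U -> H}) (C : {bounded H -> Y}) (K : {bounded U -> H}).
Variables (z : H) (v : U).

(** Half of the directional derivative of [ell]; the factor 2 stays outside in [ell_perturb]. *)
Definition ell_derivative (x : H) (u : U) (xi : H) (phi : U) : R :=
  rdot (adj C (C x) + z) xi + rdot (gram K u + v) phi.

Lemma ell_perturb x u xi phi c : ell C K z v (x + c **: xi) (u + c **: phi) =
  ell C K z v x u + 2 * c * ell_derivative x u xi phi
    + c ^+ 2 * (rnorm (C xi) ^+ 2 + rnorm (K phi) ^+ 2).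
Proof.
have bC := bounded_bop C; have bK := bounded_bop K.
have eC : rdot (adj C (C x)) xi = rdot (C x) (C xi).
  by rewrite rdotC -rdot_adj rdotC.
have eK : rdot (gram K u) phi = rdot (K u) (K phi).
  by rewrite /gram rdotC -rdot_adj rdotC.
rewrite /ell /ell_derivative -!/(rdot _ _) (bopD bC) (bopZ bC) (bopD bK) (bopZ bK) !rnorm_sqr.
rewrite !(rdotDl, rdotDr, rdotZl, rdotZr) eC eK [rdot (C xi) (C x)]rdotC [rdot (K phi) (K u)]rdotC.
ring.
Qed.

Variables (T : R) (T_ge0 : 0 <= T).
Let mI : measurable (`[0, T]%classic : set R). Proof. exact: measurable_itv. Qed.
Let fI := mu_itv_lty 0 T.

Let L2_cst V (a : V) : L2 `[0, T] (fun=> a).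
Proof. by apply: (continuous_L2 mI fI erefl); exact: continuous_cstT. Qed.

Lemma ell_integ x u : L2 `[0, T] x -> L2 `[0, T] u ->
  integ `[0, T] (fun t => ell C K z v (x t) (u t)).
Proof.
move=> lx lu; have bC := bounded_bop C; have bK := bounded_bop K.
have /(L2P mI _)[_ h1] := L2_bop mI bC lx; have /(L2P mI _)[_ h2] := L2_bop mI bK lu.
have h3 := integZ 2 mI (L2_rdot mI (L2_cst z) lx).
have h4 := integZ 2 mI (L2_rdot mI (L2_cst v) lu).
exact: (integD mI (integD mI (integD mI h1 h2) h3) h4).
Qed.

Lemma ell_derivative_integ x u xi phi :
  L2 `[0, T] x -> L2 `[0, T] u -> L2 `[0, T] xi -> L2 `[0, T] phi ->
  integ `[0, T] (fun t => ell_derivative (x t) (u t) (xi t) (phi t)).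
Proof.
move=> lx lu lxi lphi; apply: integD => //; apply: L2_rdot => //; apply: L2D => //.
  exact: L2_bop (bop_comp (bounded_bop C) (bop_adj C)) lx.
exact: L2_bop (bop_gram K) lu.
Qed.

Variables (S : R -> {bounded H -> H}) (sgS : sgroup (posfam S)).
Let sS : sfam (posfam S). Proof. by case: sgS. Qed.

Let L1_input u : L2 `[0, T] u -> L1 `[0, T] (fun t => B (u t)).
Proof. by move=> lu; apply: L1_bop => //; [exact: bounded_bop|exact: L2_L1]. Qed.

(** The pair (x + c xi, u + c phi) is admissible for every real c, and its cost is a quadratic
    polynomial in c with minimum at c = 0. *)
Lemma first_variation x0 x u xi phi : optimal B C K S z v T x0 x u ->
  L2 `[0, T] phi -> weak_mild (posfam S) (fun t => B (phi t)) 0 T xi ->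
  \int[mu]_(t in `[0, T]) ell_derivative (x t) (u t) (xi t) (phi t) = 0.
Proof.
move=> [[lu mx] opt] lphi wxi; have bB := bounded_bop B.
have wx := mild_weak mx.
have lx := weak_mild_L2 sgS T_ge0 (L1_input lu) wx.
have lxi := weak_mild_L2 sgS T_ge0 (L1_input lphi) wxi.
have iD := ell_derivative_integ lx lu lxi lphi; have iE := ell_integ lx lu.
have /(L2P mI _)[_ h1] := L2_bop mI (bounded_bop C) lxi.
have /(L2P mI _)[_ h2] := L2_bop mI (bounded_bop K) lphi.
have iq := integD mI h1 h2.
apply: (@quadratic_ge0_linear _ _
  (\int[mu]_(t in `[0, T]) (rnorm (C (xi t)) ^+ 2 + rnorm (K (phi t)) ^+ 2))) => c.
pose x' t := x t + c **: xi t; pose u' t := u t + c **: phi t.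
have lx' : L2 `[0, T] x' by apply: L2D => //; exact: L2_bop (bop_rscale H c) lxi.
have lu' : L2 `[0, T] u' by apply: L2D => //; exact: L2_bop (bop_rscale U c) lphi.
have adm : admissible B S T x0 x' u'.
  split=> //; apply: weak_mild_solution => //; first exact: L1_input.
  rewrite (_ : (fun s => B (u' s)) = (fun s => B (u s) + c **: B (phi s))).
    by apply: weak_mild_perturb => //; exact: L1_input.
  by apply/funext => s; rewrite /u' (bopD bB) (bopZ bB).
have := opt _ _ adm; rewrite /cost !EFin_Rintegral//; last exact: ell_integ.
rewrite lee_fin.
under [X in _ <= X]eq_Rintegral do rewrite ell_perturb.
have iD' := integZ (2 * c) mI iD; have iq' := integZ (c ^+ 2) mI iq.
rewrite RintegralD//; last exact: (integD mI iE iD').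
rewrite RintegralD// !RintegralZl//.
by rewrite -addrA lerDl.
Qed.

End FirstVariation.

(** * Vanishing by backward induction in time *)

Section Vanishing.
Variables (R : realType) (V : hilbertType R).
Local Notation mu := (@lebesgue_measure R).
Local Notation integ D h := (mu.-integrable D (EFin \o h)).

Lemma backward_induction (J : R -> Prop) (T d : R) : 0 <= T -> 0 < d -> J T ->
  (forall a b, 0 <= a -> a <= b -> b <= T -> b - a <= d -> J b -> J a) -> J 0.
Proof.
move=> T0 d0 JT step.
(* Steps of length d back from T, cut off at 0; the last one may be shorter. *)
have JN (n : nat) : J (Num.max 0 (T - n%:R * d)).
  elim: n => [|n]; first by rewrite mul0r subr0 max_r.
  apply: step; first by rewrite le_max lexx.
  - by rewrite ge_max le_max lexx/= le_max lerD2l lerN2 ler_wpM2r ?orbT ?(ltW d0)// ler_nat.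
  - by rewrite ge_max T0 lerBlDr lerDl mulr_ge0// ltW.
  rewrite lerBlDr ge_max; apply/andP; split; first by rewrite addr_ge0 ?(ltW d0)// le_max lexx.
  apply: (@le_trans _ _ (d + (T - n.+1%:R * d))); first by rewrite -natr1 mulrDl mul1r; lra.
  by rewrite lerD2l le_max lexx orbT.
pose n := (Num.truncn (T / d)).+1.
suff : T - n%:R * d <= 0 by move=> h; have := JN n; rewrite max_l.
by rewrite subr_le0 -ler_pdivrMr// ltW// truncnS_gt.
Qed.

(** If q has zero integral norm on [b, T], only [a, b] contributes on [a, T]. For 2 c (b - a) <= 1,
    Cauchy-Schwarz bounds the squared L^1 norm there by half of itself, so it vanishes. *)
Lemma L2_vanish (q : R -> V) (T c : R) : 0 <= T -> 0 < c -> L2 `[0, T] q ->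
  (forall a, 0 <= a -> a <= T -> \int[mu]_(t in `[a, T]) rnorm (q t) ^+ 2
     <= c * (\int[mu]_(t in `[a, T]) rnorm (q t)) ^+ 2) ->
  {ae mu, forall t, t \in `[0, T] -> q t = 0}.
Proof.
move=> T0 c0 lq hq.
have mI a b : measurable (`[a, b]%classic : set R) by exact: measurable_itv.
have [mq iq1] := L2_L1 (mI 0 T) (mu_itv_lty 0 T) lq.
have /(L2P (mI 0 T) _)[_ iq2] := lq.
have sub a : 0 <= a -> `[a, T]%classic `<=` (`[0, T]%classic : set R).
  by move=> a0; apply: subset_itvr; rewrite bnd_simp.
have i1 a : 0 <= a -> integ `[a, T] (fun t => rnorm (q t)).
  by move=> a0; apply: integrableS iq1 => //; exact: sub.
have i2 a : 0 <= a -> integ `[a, T] (fun t => rnorm (q t) ^+ 2).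
  by move=> a0; apply: integrableS iq2 => //; exact: sub.
pose J a := \int[mu]_(t in `[a, T]) rnorm (q t).
have J0 : J 0 = 0.
  apply: (@backward_induction (fun a => J a = 0) T (2 * c)^-1) => //.
  - by rewrite invr_gt0 mulr_gt0.
  - by rewrite /J set_itv1 Rintegral_set1.
  move=> a b a0 ab bT bad Jb; have b0 := le_trans a0 ab.
  have subl : `[a, b]%classic `<=` (`[a, T]%classic : set R) by apply: subset_itvl; rewrite bnd_simp.
  have ib1 : integ `[a, b] (fun t => rnorm (q t)) by apply: integrableS (i1 a a0).
  have ib2 : integ `[a, b] (fun t => rnorm (q t) ^+ 2) by apply: integrableS (i2 a a0).
  have Ja : J a = \int[mu]_(t in `[a, b]) rnorm (q t).
    by rewrite /J (@Rintegral_split R _ a b T) ?i1// -/(J b) Jb addr0.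
  have Na := hq a a0 (le_trans ab bT).
  have Nab : \int[mu]_(t in `[a, b]) rnorm (q t) ^+ 2 <= \int[mu]_(t in `[a, T]) rnorm (q t) ^+ 2.
    rewrite (@Rintegral_split R _ a b T) ?i2// lerDl; apply: Rintegral_ge0 => t _.
    exact: exprn_ge0.
  (* Cauchy-Schwarz through [0 <= \int (|q| - l)^2], without dividing by
     [b - a]. *)
  pose l := 2 * c * J a.
  have il := integZ (- (2 * l)) (mI a b) ib1.
  have icst := integ_cst (l ^+ 2) (mI a b) (mu_itv_lty a b).
  have : 0 <= \int[mu]_(t in `[a, b]) (rnorm (q t) ^+ 2 + - (2 * l) * rnorm (q t) + l ^+ 2).
    apply: Rintegral_ge0 => t _; have := sqr_ge0 (rnorm (q t) - l); rewrite sqrrB; lra.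
  rewrite RintegralD//; last exact: (integD (mI a b) ib2 il).
  rewrite RintegralD// RintegralZl// -Ja.
  have -> : \int[mu]_(t in `[a, b]) l ^+ 2 = l ^+ 2 * (b - a).
    by rewrite Rintegral_cst//; congr (_ * _); exact: (congr1 fine (mu_itv ab)).
  have l2 : l ^+ 2 * (b - a) <= l * J a.
    rewrite (_ : l ^+ 2 = l * (2 * c) * J a); last by rewrite /l; ring.
    have : (2 * c) * (b - a) <= 1.
      by rewrite mulrC -ler_pdivlMr ?mulr_gt0// div1r.
    have lJ : 0 <= l * J a by rewrite /l -mulrA pmulr_rge0 ?mulr_gt0// -expr2 sqr_ge0.
    move=> h; have := ler_wpM2l lJ h; rewrite mulr1; lra.
  (* With l = 2 c J a, the estimates combine to 0 <= c J^2 - 2 l J + l J = - c J^2. *)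
  move: l2; rewrite /l => l2 l3; apply/eqP; rewrite -sqrf_eq0 eq_le sqr_ge0 andbT.
  rewrite -(ler_pM2l c0) mulr0; move: Na Nab l2 l3; rewrite -/(J a).
  move: (J a) (\int[mu]_(t in `[a, b]) _) (\int[mu]_(t in `[a, T]) _) => j n1 n2; nra.
have meas : measurable_fun `[0, T] (EFin \o (fun t => rnorm (q t))).
  by apply/measurable_EFinP; exact: (integ_measurable iq1).
have eq0 : (\int[mu]_(t in `[0%R, T]) `|(EFin \o (fun t => rnorm (q t))) t| = 0)%E.
  transitivity (J 0)%:E; last by rewrite J0.
  rewrite /J -EFin_Rintegral//.
  by apply: eq_integral => t _ /=; rewrite ger0_norm.
have := (ae_eq_integral_abs mu (mI 0 T) meas).1 eq0.
apply: filterS => t h tT; apply: rnorm_eq0.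
by have [->] := h tT.
Qed.

End Vanishing.

(** * The adjoint state *)

Section AdjointState.
Variables (R : realType) (H U Y : hilbertType R).
Variables (D : set H) (A : H -> H) (S Sadj : R -> {bounded H -> H}).
Variables (B : {bounded U -> H}) (C : {bounded H -> Y}) (K : {bounded U -> H}).
Variable P : R -> {bounded H -> H}.
Hypotheses (genA : generates D A S) (coerK : coercive K).
Hypothesis ricP : forall T, 0 < T -> riccati_solution B C K D A T P.
Hypothesis genAadj : generates (adj_dom D A) (adjoint D A) Sadj.
Variables (z w : H) (xe : H) (ue : U) (T : R) (E : R -> R -> H -> H).
Hypotheses (Dxe : D xe) (stat : A xe + B ue = 0) (T_gt0 : 0 < T).
Hypotheses (w_dom : adj_dom D A w) (wA : adjoint D A w = z + adj C (C xe)).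
Hypothesis evoE : evolution_operator B K Sadj P T E.
Variables (x0 : H) (x : R -> H) (u : R -> U).
Hypotheses (lu : L2 `[0, T] u) (mx : mild_solution S (fun s => B (u s)) 0 T x0 x).

Local Notation mu := (@lebesgue_measure R).
Local Notation integ D h := (mu.-integrable D (EFin \o h)).
Local Notation Sx := (posfam S).
Local Notation Q := (posfam P).
Local Notation fb := (feedback B K).
Local Notation M := (riccati_form B C K P).

Let sgS : sgroup Sx. Proof. by case: (generates_sgroup genA). Qed.
Let gS : generator D A Sx. Proof. by case: (generates_sgroup genA). Qed.
Let sS : sfam Sx. Proof. by case: sgS. Qed.
Let sQ : sfam Q := riccati_sfam ricP.
Let T0 : 0 <= T. Proof. exact: ltW. Qed.
Let mI (a b : R) : measurable (`[a, b]%classic : set R). Proof. exact: measurable_itv. Qed.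
Let fI (a b : R) := mu_itv_lty a b.
Let bfb := bop_feedback B coerK.

Lemma adjointP y : adj_dom D A y -> adj_rel D A y (adjoint D A y).
Proof. by move=> [x' hx']; rewrite /adjoint; case: xgetP => [x'' -> //|/(_ x')]. Qed.

Lemma rdot_semigroup_adjoint t a b : 0 <= t -> rdot (Sx t a) b = rdot a (posfam Sadj t b).
Proof.
have [sg' g'] := generates_sgroup genAadj.
apply: (sgroup_adjoint _ _ sgS gS sg' g') => a' b' Da' Db'.
by rewrite /rdot (adjointP Db').
Qed.

(* [x] and [E] are only known to be continuous on [0, T]; clamping the time
   makes the deviations continuous on the whole line. *)
Definition state_dev t : H := x (clamp 0 T t) - xe.
Definition control_dev t : U := u t - ue.
Definition evo_dev t : H := E (clamp 0 T (T - t)) 0 w.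
Definition feedback_gap t : U :=
  control_dev t + fb (Q (T - t) (state_dev t)) + fb (evo_dev t).
Definition forcing t : H :=
  z + adj C (C (state_dev t + xe)) - Q (T - t) (B (feedback_gap t)).
(** [- w] is the costate of the steady state ([wA], [wB]), and the other two terms are the deviation
    from it. At t = T the sum is zero, since P(0) = 0 and E(0, 0) w = w. *)
Definition costate t : H := Q (T - t) (state_dev t) + evo_dev t - w.

Local Notation xt := state_dev.
Local Notation ut := control_dev.
Local Notation ht := evo_dev.

Let L1Bu : L1 `[0, T] (fun t => B (u t)).
Proof. by apply: L1_bop => //; [exact: bounded_bop|exact: L2_L1]. Qed.

Lemma control_dev_L2 : L2 `[0, T] ut.
Proof.
apply: L2D => //; apply: (@bounded_L2 R _ (mI 0 T) (fI 0 T) U (fun=> - ue) (rnorm (- ue))) => //.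
exact: strongly_measurable_cst.
Qed.

Let L1But : L1 `[0, T] (fun t => B (ut t)).
Proof. by apply: L1_bop => //; [exact: bounded_bop|apply: L2_L1 => //; exact: control_dev_L2]. Qed.

Lemma state_dev_continuous : continuous xt.
Proof.
have c := weak_mild_continuous sgS T0 L1Bu (mild_weak mx).
by move=> t; apply: cvgB (c t) _; exact: cvg_cst.
Qed.

Lemma state_dev_mild : weak_mild Sx (fun t => B (ut t)) (x0 - xe) T xt.
Proof.
move=> t y tT; have [t0 tT'] : 0 <= t /\ t <= T by move: tT; rewrite in_itv/= => /andP[].
have [bS cS] := sS.
rewrite /xt clampE// rdotBl (mild_weak mx)// (bopB (bS t)) rdotBl.
have i1 := integ_convolution_past y sS L1Bu tT'.
have cc : continuous (fun r => rdot (Sx (t - r) (B ue)) y).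
  apply: continuous_rdot; last exact: continuous_cstT.
  by apply: (continuous_fun (cS (B ue))); exact: continuous_subl.
have i2 := continuous_integ 0 t cc.
rewrite (_ : \int[mu]_(r in `[0, t]) rdot (Sx (t - r) (B (ut r))) y =
   \int[mu]_(r in `[0, t]) rdot (Sx (t - r) (B (u r))) y
   - \int[mu]_(r in `[0, t]) rdot (Sx (t - r) (B ue)) y); last first.
  rewrite -RintegralB//; apply: eq_Rintegral => r _.
  by rewrite /control_dev (bopB (bounded_bop B)) (bopB (bS _)) rdotBl.
(* Because B ue = - A xe, the constant input [ue] contributes minus the integrated derivative of the
   orbit of xe; this cancels the displacement of the equilibrium. *)
have -> : \int[mu]_(r in `[0, t]) rdot (Sx (t - r) (B ue)) y = - rdot (Sx t xe - xe) y.
  have cc' : continuous (fun r => rdot (Sx r (B ue)) y).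
    by apply: continuous_rdot => //; exact: continuous_cstT.
  rewrite (Rintegral_reflect t t0 cc') subrr subr0 -(sgroup_integral y sgS gS Dxe t0).
  have -> : A xe = - B ue by apply/eqP; rewrite -addr_eq0 stat.
  have cc'' : continuous (fun r => rdot (Sx r (- B ue)) y).
    by apply: continuous_rdot => //; exact: continuous_cstT.
  rewrite -RintegralN//; last exact: continuous_integ.
  by apply: eq_Rintegral => s _; rewrite (bopN (bS s)) rdotNl opprK.
rewrite rdotBl; ring.
Qed.

Lemma evo_dev_continuous : continuous ht.
Proof.
have [|cE _] := evoE (tau := 0) w; first by rewrite in_itv/= lexx T0.
exact: (continuous_fun (clamp_continuous T0 cE) (@continuous_subl R T)).
Qed.

(** The mild evolution equation for E(., 0) w in reversed time, with the adjoint semigroup moved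
    onto y. The displacement of w under that semigroup is the integral of its action on A^* w = z +
    C^* C xe. *)
Lemma costate_evo t y : t \in `[0, T] ->
  rdot (ht t - w) y = \int[mu]_(s in `[t, T])
    (rdot (z + adj C (C xe)) (Sx (s - t) y) - rdot (Q (T - s) (B (fb (ht s)))) (Sx (s - t) y)).
Proof.
move=> tT; have [t0 tT'] : 0 <= t /\ t <= T by move: tT; rewrite in_itv/= => /andP[].
have [_ cS] := sS; have [sg' g'] := generates_sgroup genAadj.
have T0in : 0 \in `[0, T] by rewrite in_itv/= lexx T0.
have [_ mE] := evoE w T0in.
pose tau := T - t.
have tau0 : 0 <= tau by rewrite subr_ge0.
have tauin : tau \in `[0, T] by rewrite in_itv/= tau0 lerBlDr lerDl.
have := mild_weak mE y tauin.
rewrite {1}/evo_dev -/tau clampE// rdotBl => ->.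
pose phi s := rdot (Q s (B (fb (E (clamp 0 T s) 0 w)))) (Sx (tau - s) y).
have cE : continuous (fun s => E (clamp 0 T s) 0 w).
  by have [cE _] := evoE w T0in; exact: (clamp_continuous T0 cE).
have cphi : continuous phi.
  apply: continuous_rdot.
    apply: (sfam_cont sQ); first by move=> s; exact: cvg_id.
    exact: (continuous_fun (bop_continuous (bop_comp bfb (bounded_bop B))) cE).
  by apply: (continuous_fun (cS y)); exact: continuous_subl.
have iphi := continuous_integ 0 tau cphi.
have -> : \int[mu]_(r in `[0, tau])
    rdot (posfam Sadj (tau - r) (- P r (B (fb (E r 0 w))))) y = - \int[mu]_(s in `[0, tau]) phi s.
  rewrite -RintegralN//; apply: eq_Rintegral => r /set_mem; rewrite /= in_itv/= => /andP[r0 rt].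
  have rT : r \in `[0, T].
    by rewrite in_itv/= r0 (le_trans rt)//; move: tauin; rewrite in_itv/= => /andP[].
  rewrite rdotC -rdot_semigroup_adjoint ?subr_ge0// rdotNr rdotC /phi (clampE rT).
  by rewrite (posfamE P _ r0).
pose psi s := rdot (z + adj C (C xe)) (Sx s y).
have cpsi : continuous psi by apply: continuous_rdot => //; exact: continuous_cstT.
have e1 : rdot (posfam Sadj tau w) y - rdot w y = \int[mu]_(s in `[0, tau]) psi s.
  rewrite -rdotBl -(sgroup_integral y sg' g' w_dom tau0) wA.
  apply: eq_Rintegral => s /set_mem; rewrite /= in_itv/= => /andP[s0 _].
  by rewrite rdotC -rdot_semigroup_adjoint// rdotC.
have cpsi' : continuous (fun s => psi (s + - t)).
  by apply: (continuous_fun cpsi); exact: continuous_subr.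
have cphi' : continuous (fun s => phi (T - s)).
  by apply: (continuous_fun cphi); exact: continuous_subl.
have e2 : \int[mu]_(s in `[0, tau]) psi s = \int[mu]_(s in `[t, T]) psi (s + - t).
  by rewrite (Rintegral_shift (- t) tT' cpsi) subrr.
have e3 : \int[mu]_(s in `[0, tau]) phi s = \int[mu]_(s in `[t, T]) phi (T - s).
  by rewrite (Rintegral_reflect T tT' cphi) subrr.
rewrite addrAC e1 e2 e3 -RintegralB//; try exact: continuous_integ.
apply: eq_Rintegral => s _; rewrite /psi /phi /evo_dev /tau; congr (_ - rdot _ (Sx _ _)).
by rewrite opprB addrC addrA subrK.
Qed.

(** After time t the state is a free orbit plus the response to [ut]. The integrated Riccati
    equation evaluates the free part directly, and the forced part after an exchange of
    integrals. *)
Lemma costate_state t y : t \in `[0, T] ->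
  rdot (Q (T - t) (xt t)) y = \int[mu]_(s in `[t, T])
    (rdot (xt s) (M (T - s) (Sx (s - t) y)) - rdot (Q (T - s) (B (ut s))) (Sx (s - t) y)).
Proof.
move=> tT; have [t0 tT'] : 0 <= t /\ t <= T by move: tT; rewrite in_itv/= => /andP[].
have [bS cS] := sS; have sM := riccati_form_sfam coerK ricP.
have [_ _ SD] := sgS.
pose G s := M (T - s) (Sx (s - t) y).
have cSt v : continuous (fun s => Sx (s - t) v).
  by apply: (continuous_fun (cS v)); exact: continuous_subr.
have cG : continuous G.
  by apply: (sfam_cont sM); [exact: continuous_subl|exact: cSt].
have sub : `[t, T]%classic `<=` (`[0, T]%classic : set R) by apply: subset_itvr; rewrite bnd_simp.
have lG : L1 `[t, T] G by apply: L2_L1 => //; apply: continuous_L2 => //.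
have lB : L1 `[t, T] (fun s => B (ut s)) by apply: L1_subset L1But.
have iQ : integ `[t, T] (fun s => rdot (B (ut s)) (Q (T - s) (Sx (s - t) y))).
  have cQ : continuous (fun s => Q (T - s) (Sx (s - t) y)).
    by apply: (sfam_cont sQ); [exact: continuous_subl|exact: cSt].
  have [c _ hc] := continuous_bounded_itv t T cQ.
  by apply: (integ_rdot (c := c)) => //; exact: strongly_measurable_continuous.
have := fubini_triangle (eta := fun s => xt s - Sx (s - t) (xt t)) sS lG lB _.
have hη s v : s \in `[t, T] -> rdot (xt s - Sx (s - t) (xt t)) v =
    \int[mu]_(r in `[t, s]) rdot (Sx (s - r) (B (ut r))) v.
  rewrite in_itv/= => /andP[s1 s2].
  exact: (weak_mild_from v sgS L1But state_dev_mild).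
move=> /(_ hη).
(* The inner integral is [riccati_mild] started at time r, with the vectors S(r-t) y and B (ut
   r). *)
have -> : \int[mu]_(r in `[t, T]) \int[mu]_(s in `[r, T]) rdot (G s) (Sx (s - r) (B (ut r))) =
    \int[mu]_(r in `[t, T]) rdot (B (ut r)) (Q (T - r) (Sx (r - t) y)).
  apply: eq_Rintegral => r /set_mem; rewrite /= in_itv/= => /andP[r1 r2].
  rewrite [RHS]rdotC -(riccati_mild sgS gS coerK ricP _ _ r2).
  apply: eq_Rintegral => s /set_mem; rewrite /= in_itv/= => /andP[s1 s2].
  by rewrite /G -SD ?subr_ge0// addrA subrK.
have c1 : continuous (fun s => rdot (G s) (xt s)).
  by apply: continuous_rdot => //; exact: state_dev_continuous.
have c2 : continuous (fun s => rdot (G s) (Sx (s - t) (xt t))).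
  by apply: continuous_rdot.
rewrite (_ : \int[mu]_(s in `[t, T]) rdot (G s) (xt s - Sx (s - t) (xt t)) =
  \int[mu]_(s in `[t, T]) rdot (G s) (xt s) - rdot (Q (T - t) y) (xt t)); last first.
  rewrite -(riccati_mild sgS gS coerK ricP _ _ tT') -RintegralB//; try exact: continuous_integ.
  by apply: eq_Rintegral => s _; rewrite rdotBr.
move=> /eqP; rewrite subr_eq => /eqP e1.
rewrite rdotC -(riccati_sym ricP).
transitivity (\int[mu]_(s in `[t, T]) rdot (G s) (xt s) -
   \int[mu]_(s in `[t, T]) rdot (B (ut s)) (Q (T - s) (Sx (s - t) y))); first by rewrite e1; ring.
rewrite -RintegralB//; last exact: continuous_integ.
by apply: eq_Rintegral => s _; rewrite rdotC (riccati_sym ricP).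
Qed.

Lemma feedback_gap_L2 : L2 `[0, T] feedback_gap.
Proof.
have cx : continuous (fun t => fb (Q (T - t) (xt t))).
  apply: (continuous_fun (bop_continuous bfb)).
  by apply: (sfam_cont sQ); [exact: continuous_subl|exact: state_dev_continuous].
have ch := continuous_fun (bop_continuous bfb) evo_dev_continuous.
apply: L2D => //; last exact: (continuous_L2 (mI 0 T) (fI 0 T) erefl ch).
apply: L2D => //; last exact: (continuous_L2 (mI 0 T) (fI 0 T) erefl cx).
exact: control_dev_L2.
Qed.

Lemma riccati_input_L2 phi : L2 `[0, T] phi -> L2 `[0, T] (fun t => Q (T - t) (B (phi t))).
Proof.
by move=> lphi; apply: (L2_sfam (sfam_reflect T sQ)); exact: L2_bop (bounded_bop B) lphi.
Qed.

Lemma forcing_L2 : L2 `[0, T] forcing.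
Proof.
apply: L2D => //; last first.
  by apply: L2_bop (bop_opp H) _ => //; apply: riccati_input_L2; exact: feedback_gap_L2.
apply: (continuous_L2 (mI 0 T) (fI 0 T) erefl).
have cx : continuous (fun t => xt t + xe).
  by move=> t; apply: cvgD; [exact: state_dev_continuous|exact: cvg_cst].
have cC := continuous_fun (bop_continuous (bop_comp (bounded_bop C) (bop_adj C))) cx.
by move=> t; apply: cvgD; [exact: cvg_cst|exact: cC].
Qed.

(** In the sum of [costate_evo] and [costate_state], the C-part of the Riccati form completes C^* C
    xe to C^* C x, and its feedback part joins the two input terms to form P(T-s) B applied to
    [feedback_gap]. *)
Lemma costate_forcing t y : t \in `[0, T] ->
  rdot (costate t) y = \int[mu]_(s in `[t, T]) rdot (forcing s) (Sx (s - t) y).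
Proof.
move=> tT; have [t0 tT'] : 0 <= t /\ t <= T by move: tT; rewrite in_itv/= => /andP[].
have [bS cS] := sS; have [bQ _] := sQ; have sM := riccati_form_sfam coerK ricP.
have bB := bounded_bop B; have bC := bounded_bop C; have bC' := bop_adj C.
have cSt : continuous (fun s => Sx (s - t) y).
  by apply: (continuous_fun (cS y)); exact: continuous_subr.
have c1 : continuous (fun s => rdot (z + adj C (C xe)) (Sx (s - t) y)).
  by apply: continuous_rdot => //; exact: continuous_cstT.
have c2 : continuous (fun s => rdot (Q (T - s) (B (fb (ht s)))) (Sx (s - t) y)).
  apply: continuous_rdot => //; apply: (sfam_cont sQ); first exact: continuous_subl.
  exact: (continuous_fun (bop_continuous (bop_comp bfb bB)) evo_dev_continuous).
have c3 : continuous (fun s => rdot (xt s) (M (T - s) (Sx (s - t) y))).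
  apply: continuous_rdot; first exact: state_dev_continuous.
  by apply: (sfam_cont sM); [exact: continuous_subl|exact: cSt].
have i1 := integB (mI t T) (continuous_integ t T c1) (continuous_integ t T c2).
have i4 : integ `[t, T] (fun s => rdot (Q (T - s) (B (ut s))) (Sx (s - t) y)).
  apply: integrableS (L2_rdot (mI 0 T) (riccati_input_L2 control_dev_L2)
    (continuous_L2 (mI 0 T) (fI 0 T) erefl cSt)) => //.
  by apply: subset_itvr; rewrite bnd_simp.
have i2 := integB (mI t T) (continuous_integ t T c3) i4.
rewrite /costate -addrA rdotDl costate_state// costate_evo// -RintegralD//.
apply: eq_Rintegral => s _; move: (Sx (s - t) y) => r.
rewrite -(riccati_form_sym coerK ricP) /forcing /feedback_gap /riccati_form.
move: (xt s) (ut s) (ht s) => a b c.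
rewrite (bopD bC) (bopD bC') !(bopD bB) !(bopD (bQ _)) !(rdotDl, rdotNl); ring.
Qed.

Lemma costate_pairing phi xi : L2 `[0, T] phi -> weak_mild Sx (fun t => B (phi t)) 0 T xi ->
  \int[mu]_(s in `[0, T]) rdot (forcing s) (xi s) =
  \int[mu]_(s in `[0, T]) rdot (costate s) (B (phi s)).
Proof.
move=> lphi wxi; have [bS _] := sS.
have lf := L2_L1 (mI 0 T) (fI 0 T) forcing_L2.
have lB := L1_bop (mI 0 T) (bounded_bop B) (L2_L1 (mI 0 T) (fI 0 T) lphi).
rewrite (fubini_triangle (psi := fun t => B (phi t)) sS lf lB); last first.
  by move=> s y sT; rewrite wxi// (bop0 (bS s)) rdot0l add0r.
by apply: eq_Rintegral => r /set_mem rT; rewrite costate_forcing.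
Qed.

Variable v : U.
Hypothesis wB : adj B w = v + gram K ue.

(** [gram K] cancels the inverse in both feedback terms, and [wB] trades B^* w for v + K^* K ue. *)
Lemma gram_feedback_gap t : t \in `[0, T] ->
  gram K (feedback_gap t) = adj B (costate t) + gram K (u t) + v.
Proof.
move=> tT; have bK := bop_gram K; have bB := bop_adj B.
rewrite /feedback_gap /costate /control_dev; move: (Q _ _) (ht t) => a b.
rewrite (bopB bB) (bopD bB) wB !(bopD bK) (bopN bK) /feedback !gram_invK//.
by apply: rdot_inj => y; rewrite !(rdotDl, rdotNl); ring.
Qed.

Hypothesis opt : optimal B C K S z v T x0 x u.

Lemma feedback_gap_variation phi xi : L2 `[0, T] phi ->
  weak_mild Sx (fun t => B (phi t)) 0 T xi ->
  \int[mu]_(s in `[0, T]) (rdot (gram K (feedback_gap s)) (phi s)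
    + rdot (B (feedback_gap s)) (Q (T - s) (xi s))) = 0.
Proof.
move=> lphi wxi; have bB := bounded_bop B.
have lB := L1_bop (mI 0 T) bB (L2_L1 (mI 0 T) (fI 0 T) lphi).
have lxi := weak_mild_L2 sgS T0 lB wxi.
have i1 := L2_rdot (mI 0 T) forcing_L2 lxi.
have i2 := L2_rdot (mI 0 T) (L2_bop (mI 0 T) bB feedback_gap_L2)
  (L2_sfam (sfam_reflect T sQ) lxi).
have lKu : L2 `[0, T] (fun s => gram K (u s) + v).
  apply: L2D => //; first exact: L2_bop (bop_gram K) lu.
  by apply: (continuous_L2 (mI 0 T) (fI 0 T) erefl); exact: continuous_cstT.
have i3 := L2_rdot (mI 0 T) lKu lphi.
have cp : continuous costate.
  have c : continuous (fun t => Q (T - t) (xt t)).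
    by apply: (sfam_cont sQ); [exact: continuous_subl|exact: state_dev_continuous].
  move=> t; apply: cvgB; last exact: cvg_cst.
  by apply: cvgD; [exact: c|exact: evo_dev_continuous].
have i4 := L2_rdot (mI 0 T) (continuous_L2 (mI 0 T) (fI 0 T) erefl cp)
  (L2_bop (mI 0 T) bB lphi).
have i23 := integD (mI 0 T) i2 i3.
transitivity (\int[mu]_(s in `[0, T]) rdot (costate s) (B (phi s)) + \int[mu]_(s in `[0, T])
  (rdot (B (feedback_gap s)) (Q (T - s) (xi s)) + rdot (gram K (u s) + v) (phi s))).
  rewrite -RintegralD//; apply: eq_Rintegral => s /set_mem sT.
  have -> : rdot (costate s) (B (phi s)) = rdot (adj B (costate s)) (phi s).
    by rewrite rdotC rdot_adj rdotC.
  by rewrite (gram_feedback_gap sT) -addrA [in LHS]rdotDl; ring.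
rewrite -(costate_pairing lphi wxi) -RintegralD// -[RHS](first_variation T0 sgS opt lphi wxi).
apply: eq_Rintegral => s /set_mem sT.
rewrite /ell_derivative /forcing /state_dev (clampE sT) subrK.
rewrite !(rdotDl, rdotNl) (riccati_sym ricP); ring.
Qed.

Lemma feedback_gap_bound : exists2 c, 0 < c & forall a, 0 <= a -> a <= T ->
  \int[mu]_(t in `[a, T]) rnorm (gram K (feedback_gap t)) ^+ 2
    <= c * (\int[mu]_(t in `[a, T]) rnorm (gram K (feedback_gap t))) ^+ 2.
Proof.
pose q t := gram K (feedback_gap t).
have lq : L2 `[0, T] q by apply: L2_bop (bop_gram K) _ => //; exact: feedback_gap_L2.
have [bS _] := sS; have bB := bounded_bop B.
have [MS MS0 hMS] := sfam_bound 0 T sS.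
have [MQ MQ0 hMQ] := sfam_bound 0 T (sfam_reflect T sQ).
have [_ _ [k k0 hk]] := bop_gram_inv coerK.
have [_ _ [b b0 hb]] := bB.
have gq t : rnorm (feedback_gap t) <= k * rnorm (q t).
  by apply: le_trans (hk _); rewrite (_ : gram_inv K (q t) = feedback_gap t)//;
    apply: (gram_inj coerK); rewrite gram_invK.
(* The factors come from |B g| <= b k |q| and |P(T-s) xi| <= MQ MS b J, where J is the integral of
   |q| over [a, T]. The witness is c + 1, since c may be 0. *)
pose c := b * k * MQ * MS * b.
have c0 : 0 <= c by rewrite !mulr_ge0.
exists (c + 1) => [|a a0 aT]; first by rewrite ltr_wpDl.
pose phi t := if t \in (`[a, T]%classic : set R) then q t else 0.
have lphi : L2 `[0, T] phi by apply: L2_indic.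
have lphi1 := L2_L1 (mI 0 T) (fI 0 T) lphi; have [_ i1] := lphi1.
have /(L2P (mI 0 T) _)[_ i2] := lphi.
have lB := L1_bop (mI 0 T) bB lphi1.
have [xi wxi] := weak_mild_exists 0 sS lB.
have lxi := weak_mild_L2 sgS T0 lB wxi.
have phi_mkcond (h : U -> R) : h 0 = 0 ->
    \int[mu]_(t in `[0, T]) h (phi t) = \int[mu]_(t in `[a, T]) h (q t).
  move=> h0; have -> : (`[a, T]%classic : set R) = `[a, T] `&` `[0, T].
    by apply/esym/setIidPl; apply: subset_itvr; rewrite bnd_simp.
  rewrite [RHS]Rintegral_mkcondl; apply: eq_Rintegral => t _.
  by rewrite patchE /phi; case: ifP.
pose J := \int[mu]_(t in `[a, T]) rnorm (q t).
have J0 : 0 <= J by exact: Rintegral_ge0.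
have eJ : \int[mu]_(t in `[0, T]) rnorm (phi t) = J by apply: (phi_mkcond (fun y => rnorm y)); rewrite rnorm0.
have xi_bound s : s \in `[0, T] -> rnorm (xi s) <= MS * b * J.
  move=> sT; have [s0 sT'] : 0 <= s /\ s <= T by move: sT; rewrite in_itv/= => /andP[].
  have subs : `[0, s]%classic `<=` (`[0, T]%classic : set R) by apply: subset_itvl; rewrite bnd_simp.
  have hM t (y : H) : t \in `[0, T - 0] -> rnorm (Sx t y) <= MS * rnorm y by rewrite subr0; exact: hMS.
  have := weak_integral_bound sS lB s0 sT' MS0 hM (I := xi s).
  move=> /(_ (fun y => _))/le_trans; apply.
    by move=> y; rewrite wxi// (bop0 (bS s)) rdot0l add0r.
  rewrite -mulrA ler_wpM2l//.
  have is1 : integ `[0, s] (fun t => rnorm (phi t)) by apply: integrableS i1.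
  have [_ iB] := lB; have iBs : integ `[0, s] (fun t => rnorm (B (phi t))) by apply: integrableS iB.
  apply: (@le_trans _ _ (b * \int[mu]_(t in `[0, s]) rnorm (phi t))).
    rewrite -RintegralZl//; apply: le_Rintegral => //; first exact: integZ.
  rewrite ler_wpM2l// -eJ (@Rintegral_split R _ 0 s T)// lerDl.
  by apply: Rintegral_ge0.
(* Causality: for s < a the input vanishes on [0, s], hence so does the response. This confines the
   coupling term to [a, T]. *)
have xi0 s : s \in `[0, T] -> s < a -> xi s = 0.
  move=> sT sa; apply: rdot_inj => y; rewrite wxi// (bop0 (bS s)) !rdot0l add0r.
  transitivity (\int[mu]_(r in `[0, s]) (0 : R)); last by rewrite Rintegral_cst// mul0r.
  apply: eq_Rintegral => r /set_mem; rewrite /= in_itv/= => /andP[_ rs].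
  rewrite /phi memNset ?(bop0 bB) ?(bop0 (bS _)) ?rdot0l// /= in_itv/= => /andP[ar _].
  by have := le_lt_trans (le_trans ar rs) sa; rewrite ltxx.
have iBQ := L2_rdot (mI 0 T) (L2_bop (mI 0 T) bB feedback_gap_L2)
  (L2_sfam (sfam_reflect T sQ) lxi).
have := feedback_gap_variation lphi wxi.
rewrite RintegralD//; last exact: L2_rdot.
move=> /eqP; rewrite addr_eq0 => /eqP eN.
rewrite -/(J ^+ 2) -(phi_mkcond (fun y => rnorm y ^+ 2)) ?rnorm0 ?expr0n//.
have -> : \int[mu]_(t in `[0, T]) rnorm (phi t) ^+ 2 =
    \int[mu]_(t in `[0, T]) rdot (gram K (feedback_gap t)) (phi t).
  apply: eq_Rintegral => t _; rewrite -/(q t) /phi; case: ifP => _; first by rewrite rnorm_sqr.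
  by rewrite rnorm0 expr0n/= rdotC rdot0l.
rewrite eN -RintegralN//.
have iJ := integZ (c * J) (mI 0 T) i1.
apply: (@le_trans _ _ (\int[mu]_(t in `[0, T]) (c * J * rnorm (phi t)))); last first.
  by rewrite RintegralZl// eJ -mulrA -expr2 ler_wpM2r ?sqr_ge0// lerDl.
apply: le_Rintegral => //.
  by apply: (integ_eq (mI 0 T) _ (integZ (-1) (mI 0 T) iBQ)) => s _; rewrite mulN1r.
move=> s sT; rewrite (le_trans (ler_norm _))// normrN.
have [sa|as_] := ltP s a.
  by rewrite xi0// (bop0 (sQ.1 _)) rdotC rdot0l normr0 !mulr_ge0.
rewrite (le_trans (abs_rdot_le _ _))//.
have -> : phi s = q s by rewrite /phi mem_set// /= in_itv/= as_; move: sT; rewrite /= in_itv/= => /andP[].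
have h1 : rnorm (B (feedback_gap s)) <= b * (k * rnorm (q s)).
  by apply: le_trans (hb _) _; rewrite ler_wpM2l.
have h2 : rnorm (Q (T - s) (xi s)) <= MQ * (MS * b * J).
  by apply: le_trans (hMQ s _ sT) _; rewrite ler_wpM2l// xi_bound.
apply: le_trans (ler_pM _ _ h1 h2) _ => //.
by rewrite le_eqVlt; apply/orP; left; apply/eqP; rewrite /c; ring.
Qed.

Lemma feedback_gap_vanish : {ae mu, forall t, t \in `[0, T] -> feedback_gap t = 0}.
Proof.
have [c c0 hc] := feedback_gap_bound.
have lq : L2 `[0, T] (fun t => gram K (feedback_gap t)).
  by apply: L2_bop (bop_gram K) _ => //; exact: feedback_gap_L2.
have := L2_vanish T0 c0 lq hc; apply: (@filterS _ _ (ae_filter_ringOfSetsType mu)) => t h tT; apply: (gram_inj coerK).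
by rewrite h// (bop0 (bop_gram K)).
Qed.

End AdjointState.

Theorem lemma20 (R : realType) (H U Y : hilbertType R)
    (D : set H) (A : H -> H) (S : R -> {bounded H -> H})
    (B : {bounded U -> H}) (C : {bounded H -> Y}) (K : {bounded U -> H})
    (z : H) (v : U)
    (genA : generates D A S)
    (coerK : coercive K)
    (stab : exp_stabilizable D A B)
    (detect : exp_detectable D A C)
    (P : R -> {bounded H -> H})
    (ricP : forall T, 0 < T -> riccati_solution B C K D A T P)
    (P_ge0 : forall t x, 0 <= t -> 0 <= hdot (P t x) x)
    (xe : H) (ue : U)
    (minE : steady_state_minimizer B C K D A z v xe ue)
    (w : H)
    (w_dom : adj_dom D A w)
    (wA : adjoint D A w = z + adj C (C xe))
    (wB : adj B w = v + gram K ue)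
    (Sadj : R -> {bounded H -> H})
    (genAadj : generates (adj_dom D A) (adjoint D A) Sadj)
    (T : R) (T_gt0 : 0 < T)
    (E : R -> R -> H -> H)
    (evoE : evolution_operator B K Sadj P T E)
    (x0 : H) (x : R -> H) (u : R -> U)
    (opt : optimal B C K S z v T x0 x u) :
  {ae lebesgue_measure, forall t, t \in `[0, T] ->
     u t = - feedback B K (P (T - t) (x t - xe))
           - feedback B K (E (T - t) 0 w) + ue}.
Proof.
have [Dxe stat _] := minE; have [[lu mx] _] := opt.
have := feedback_gap_vanish genA coerK ricP genAadj Dxe stat T_gt0 w_dom wA evoE lu mx wB opt.
apply: (@filterS _ _ (ae_filter_ringOfSetsType lebesgue_measure)) => t h tT; have [t0 tT'] : 0 <= t /\ t <= T by move: tT; rewrite in_itv/= => /andP[].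
have Ttin : T - t \in `[0, T] by rewrite in_itv/= subr_ge0 tT' lerBlDr lerDl.
have := h tT; rewrite /feedback_gap /control_dev /state_dev /evo_dev !clampE// posfamE ?subr_ge0//.
by move=> /eqP; rewrite -addrA addr_eq0 subr_eq opprD => /eqP.
Qed.
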